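(* Let $M$ be a (complete, finite-dimensional) Alexandrov space with a lower curvature bound, with distance $d$, and let $X$ be a random variable on $M$ with distribution $\mathbb{P}^X$ and finite second moments, i.e. $\int_M d(q,x)^2\,d\mathbb{P}^X(x)<\infty$ for one (hence for all) $q\in M$. Let $\mu\in M$ be a Fréchet mean of $X$, i.e. a minimizer of $F:M\to\mathbb{R}$, $F(q)=\int_M d(q,x)^2\,d\mathbb{P}^X(x)$. Then for $\mathbb{P}^X$-almost every point $x\in M$ there exists exactly one shortest curve (up to reparametrization) connecting $x$ and $\mu$.
   Context: An Alexandrov space with a lower curvature bound is a complete, finite-dimensional length space with curvature $\ge\kappa$ in the sense of Alexandrov (triangle comparison) for some $\kappa\in\mathbb{R}$; its boundary may be non-empty. A shortest curve between two points is a curve whose length equals their distance. *)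

(* Defs.v *)
From HB Require Import structures.
From mathcomp Require Import all_boot all_order all_algebra.
From mathcomp Require Import all_classical all_reals all_analysis.

Set Implicit Arguments.
Unset Strict Implicit.
Unset Printing Implicit Defensive.

Import Order.TTheory GRing.Theory Num.Theory.
Import numFieldNormedType.Exports.

Local Open Scope classical_set_scope.
Local Open Scope ring_scope.

(* The library has complete uniform spaces and metric spaces, but not their
   join. Complete types are pointed, hence nonempty. *)
#[short(type="completeMetricType")]
HB.structure Definition CompleteMetric (K : numDomainType) :=
  {M of Metric K M & Complete M}.

(* M with its Borel sigma-algebra. *)
Notation borel M := (g_sigma_algebraType (@open M)).

Section Curves.
Context {R : realType} {M : metricType R}.
Implicit Types (x y : M) (g h : R -> M).

(* Curves are parametrized by [0, 1]; values outside [0, 1] are irrelevant. *)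
Definition curve_from_to x y : set (R -> M) :=
  [set g : R -> M | [/\ {within `[0, 1], continuous g}, g 0 = x & g 1 = y]].

Definition polygon_length g (s : seq R) : R :=
  let G := g \o nth 1 (0 :: s) in
  \sum_(0 <= i < size s) mdist (G i) (G i.+1).

Definition curve_length g : \bar R :=
  ereal_sup [set (polygon_length g s)%:E | s in itv_partition 0 1].

Definition shortest_curve x y : set (R -> M) :=
  [set g : R -> M | curve_from_to x y g /\ curve_length g = (mdist x y)%:E].

Definition reparametrizes g h : Prop :=
  exists phi : R -> R,
    [/\ {within `[0, 1], continuous phi},
        {in `[0, 1] &, {homo phi : s t / s <= t}},
        phi 0 = 0 /\ phi 1 = 1
      & {in `[0, 1], forall t, g t = h (phi t)}].

(* As phi may be constant on subintervals, reparametrizes is not symmetric;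
   curves are identified when they are reparametrizations of a common one. *)
Definition same_up_to_reparam g h : Prop :=
  exists k : R -> M,
    [/\ {within `[0, 1], continuous k}, reparametrizes g k
      & reparametrizes h k].

Definition unique_shortest_curve x y : Prop :=
  exists2 g, shortest_curve x y g &
    forall h, shortest_curve x y h -> same_up_to_reparam g h.

End Curves.

(* Any two points are joined by curves (the infimum of the empty set is +oo)
   whose lengths have the distance as infimum, which need not be attained. *)
Definition length_space {R : realType} (M : metricType R) : Prop :=
  forall x y : M,
    (mdist x y)%:E = ereal_inf [set curve_length g | g in curve_from_to x y].

Section HausdorffDimension.
Context {R : realType} {M : metricType R}.
Local Open Scope ereal_scope.

Definition diameter (A : set M) : \bar R :=
  maxe 0 (ereal_sup [set (mdist p.1 p.2)%:E | p in A `*` A]).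

Definition hausdorff_content (s delta : R) (A : set M) : \bar R :=
  ereal_inf [set \sum_(0 <= i <oo) (diameter (E i) `^ s) | E in
    [set E : (set M)^nat | A `<=` \bigcup_i E i /\
                           forall i, diameter (E i) <= delta%:E]].

Definition hausdorff_measure (s : R) (A : set M) : \bar R :=
  ereal_sup [set hausdorff_content s delta A | delta in [set e | (0 < e)%R]].

(* Restricting to s > 0 does not change the infimum and avoids 0 `^ 0. *)
Definition hausdorff_dim (A : set M) : \bar R :=
  ereal_inf [set s%:E | s in [set s | (0 < s)%R /\ hausdorff_measure s A = 0]].

End HausdorffDimension.

Section ModelPlane.
Context {R : realType}.
Variable kappa : R.
Implicit Types u v : 'rV[R]_3.

Definition dot u v := u 0 0 * v 0 0 + u 0 1 * v 0 1 + u 0 2 * v 0 2.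
Definition lorentz u v := u 0 0 * v 0 0 - u 0 1 * v 0 1 - u 0 2 * v 0 2.
Definition arcosh (t : R) : R := ln (t + Num.sqrt (t ^+ 2 - 1)).

(* The complete simply connected surface of constant curvature kappa: the
   unit sphere rescaled by 1 / sqrt kappa, the Euclidean plane, or the upper
   sheet of the hyperboloid rescaled by 1 / sqrt (- kappa). *)
Definition model_plane : set 'rV[R]_3 :=
  [set u | if 0 < kappa then dot u u = 1
           else if kappa == 0 then u 0 0 = 0
           else 0 < u 0 0 /\ lorentz u u = 1].

Definition model_dist u v : R :=
  if 0 < kappa then acos (dot u v) / Num.sqrt kappa
  else if kappa == 0 then Num.sqrt (dot (u - v) (u - v))
  else arcosh (lorentz u v) / Num.sqrt (- kappa).

End ModelPlane.

Section Alexandrov.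
Context {R : realType} (M : metricType R).

(* Every point of the side g from a to c of a triangle a b c is at least as
   far from b as the corresponding point d' of a comparison triangle a' b' c'
   is from b'. For kappa > 0, comparison triangles exist and are unique up to
   isometry when the perimeter is less than 2 pi / sqrt kappa. The other two
   sides do not enter the inequality; they exist under locally_geodesic_in. *)
Definition triangle_comparison (kappa : R) (U : set M) : Prop :=
  forall a b c : M, U a -> U b -> U c ->
  (0 < kappa ->
     mdist a b + mdist b c + mdist c a < 2 * pi / Num.sqrt kappa) ->
  forall g : R -> M, shortest_curve a c g ->
  forall t : R, 0 <= t <= 1 ->
  forall a' b' c' d' : 'rV[R]_3,
    model_plane kappa a' -> model_plane kappa b' ->
    model_plane kappa c' -> model_plane kappa d' ->
    model_dist kappa a' b' = mdist a b ->
    model_dist kappa b' c' = mdist b c ->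
    model_dist kappa a' c' = mdist a c ->
    model_dist kappa a' d' = mdist a (g t) ->
    model_dist kappa d' c' = mdist (g t) c ->
  model_dist kappa b' d' <= mdist b (g t).

Definition locally_geodesic_in (U : set M) : Prop :=
  forall x y : M, U x -> U y -> shortest_curve x y !=set0.

(* Triangle comparison speaks about triangles with shortest sides and would be
   void without such curves, so their existence near every point is part of
   the notion. The sides may leave U. *)
Definition curvature_ge (kappa : R) : Prop :=
  forall p : M, exists2 U : set M, nbhs p U &
    locally_geodesic_in U /\ triangle_comparison kappa U.

Definition alexandrov_space : Prop :=
  [/\ length_space M, (hausdorff_dim [set: M] < +oo)%E
    & exists kappa : R, curvature_ge kappa].

End Alexandrov.

Section FrechetMean.
Context {R : realType} {M : completeMetricType R}.
Variable Q : probability (borel M) R.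
Local Open Scope ereal_scope.

(* Extended-real valued; finite everywhere as soon as it is finite at one
   point. *)
Definition frechet_function (q : M) : \bar R :=
  \int[Q]_x ((mdist q (x : M)) ^+ 2)%:E.

Definition finite_second_moments : Prop :=
  exists q : M, frechet_function q < +oo.

Definition frechet_mean (mu : M) : Prop :=
  forall q : M, frechet_function mu <= frechet_function q.

End FrechetMean.

(* Main.v *)
Require Import Defs.
From HB Require Import structures.
From mathcomp Require Import all_boot all_order all_algebra.
From mathcomp Require Import all_classical all_reals all_analysis.
From mathcomp Require Import measurable_realfun lra ring.

Set Implicit Arguments.
Unset Strict Implicit.
Unset Printing Implicit Defensive.

Import Order.TTheory GRing.Theory Num.Theory.
Import numFieldNormedType.Exports.

Local Open Scope classical_set_scope.
Local Open Scope ring_scope.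

(** Write o for the mean, R(y) for the distance from o to y, and F for the
    Frechet function.

    A lower curvature bound says that, along a shortest curve, squared distances
    to a third point are at least those of a model triangle. At small scales all
    model planes are almost flat, so that around every point, up to a factor
    1 - eta, one has the inequality [hinge_point] which the Euclidean law of
    cosines turns into an equality ([curvature_ge_hinge]). Everything below
    combines this inequality at a few chosen points; there, first order means
    with an error that is small compared with the distance to o.

    The inequality makes squared distances semiconcave near o
    ([hinge_semiconcave]), and so is every partial integral of F. As o may be
    singular, minimality alone leaves open that F grows linearly in some
    directions. Suppose that the largest rate G of growth is positive. A direction of almost
    maximal rate makes an angle of at most about pi / 2 with every direction
    towards some y: otherwise, by semiconcavity, on a path first leading in the
    steep direction and then turning slightly towards y, F would be larger than
    G allows at that distance from o ([steep_direction_far]). But moving at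
    such an angle to y does not increase the distance to y to first order, so F
    does not grow at all, a contradiction. Hence F is constant near o to first order
    ([mean_is_critical]).

    Now let b and b' be two points at distance s from o, and let D be a set of
    points y that lie beyond both, in the sense that d(b, y) and d(b', y) are
    almost R(y) - s. Towards b, the integral over D decreases as fast as it can,
    so by minimality the integral over the complement of D increases at that
    rate, and likewise towards b'. By semiconcavity it does so on the path that
    leads from o towards b and then turns slightly towards b'. Since F is
    constant to first order, the integral over D has to decrease accordingly,
    which is only possible if the end of the turning path is as far from o as if
    the path were straight. Hence b and b' are close: if d(b, b') >= k s and s
    is small, then D has small mass ([mass_two_directions]).

    In order to let b and b' vary with y, they are replaced by members of a
    finite net whose size does not depend on s. Such nets exist because the
    Hausdorff dimension is finite: with too many separated points in a small
    ball, moving again and again towards them would produce a Cantor set of too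
    large dimension ([packing]). So, for almost every y and every small t, the
    points almost between o and y at distance t from o form sets whose
    diameters tend to 0 ([ae_thin]); y is then called thin at t.

    Finally shortest curves do not branch where the hinge inequality holds, so
    thinness propagates from small t to all t up to R(y) ([thin_step],
    [thin_everywhere]). By completeness there is, at each distance t from o, a
    single point between o and y. These points form a shortest curve, and any
    other shortest curve runs through them in the same order
    ([unique_shortest_curve_of_points]). *)

(** * Limits of sequences *)

Lemma harmonic_small {R : realType} (e : R) : 0 < e ->
  exists N, forall n, (N <= n)%N -> harmonic n < e.
Proof.
move=> e0; pose N := Num.truncn e^-1; exists N => n Nn.
have /andP[_ hn] : N%:R <= e^-1 < N.+1%:R by apply: truncn_itv; rewrite invr_ge0 ltW.
rewrite -[ltRHS]invrK ltf_pV2 ?posrE ?invr_gt0//.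
by apply: lt_le_trans hn _; rewrite ler_nat.
Qed.

Lemma expr_small {R : realType} (q eps : R) : 0 <= q <= 1 / 2 -> 0 < eps ->
  exists n, q ^+ n < eps.
Proof.
move=> /andP[q0 q1] e0; exists (Num.truncn eps^-1).+1; set k := Num.truncn _.
have /andP[_ hk] : k%:R <= eps^-1 < k.+1%:R by apply: truncn_itv; rewrite invr_ge0 ltW.
apply: (@le_lt_trans _ _ ((1 / 2) ^+ k.+1)).
  by rewrite ler_pXn2r// nnegrE; lra.
rewrite div1r exprVn -[ltRHS]invrK ltf_pV2 ?posrE ?exprn_gt0 ?invr_gt0//.
by apply: lt_trans hk _; rewrite -natrX ltr_nat ltn_expl.
Qed.

Lemma cauchy_limit {R : realType} {M : completeMetricType R} (u : nat -> M) :
  (forall e : R, 0 < e -> exists N, forall n, (N <= n)%N -> mdist (u N) (u n) < e) ->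
  exists x, forall e : R, 0 < e -> exists N, forall n, (N <= n)%N -> mdist x (u n) < e.
Proof.
move=> ue.
have cu : cvg (u @ \oo).
  apply: cauchy_cvg; apply: cauchy_exP => eps /ue[n en]; exists (u n).
  by exists n => // m /= nm; rewrite ballEmdist /=; exact: en.
exists (lim (u @ \oo)) => e e0.
have [N _ hN] := metricType_numDomainType.cvgr_dist_lt cu e0.
by exists N => n /hN.
Qed.

(** Keeping the rate of convergence: a quantitative estimate between the terms
    survives in the limit, which later separates points of a Cantor set. *)
Lemma cauchy_limit_rate {R : realType} {M : completeMetricType R}
  (u : nat -> M) (e : nat -> R) :
  (forall n m, (n <= m)%N -> mdist (u n) (u m) <= e n) ->
  (forall eps, 0 < eps -> exists n, e n < eps) ->
  exists x, forall n, mdist (u n) x <= e n.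
Proof.
move=> ue e0; have [|x hx] := cauchy_limit (u := u).
  move=> eps /e0[n en]; exists n => m nm; exact: le_lt_trans (ue n m nm) en.
exists x => n; apply/ler_addgt0Pr => eps /hx[N hN].
have := hN (maxn n N) (leq_maxr _ _); have := ue n (maxn n N) (leq_maxl _ _).
have := metric_triangle (u n) (u (maxn n N)) x.
rewrite (metric_sym (u (maxn n N)) x); lra.
Qed.

(** * Hyperbolic functions and slopes at the origin *)

Section Hyperbolic.
Context {R : realType}.
Implicit Types x y u : R.

Definition cosh x := (expR x + expR (- x)) / 2.
Definition sinh x := (expR x - expR (- x)) / 2.

Lemma expRNM x : expR x * expR (- x) = 1.
Proof. by rewrite -expRD subrr expR0. Qed.

Lemma coshB x y : cosh (x - y) = cosh x * cosh y - sinh x * sinh y.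
Proof. by rewrite /cosh /sinh opprB !expRD; field. Qed.

Lemma coshN x : cosh (- x) = cosh x.
Proof. by rewrite /cosh opprK addrC. Qed.

Lemma sinhN x : sinh (- x) = - sinh x.
Proof. by rewrite /sinh opprK; field. Qed.

Lemma coshD x y : cosh (x + y) = cosh x * cosh y + sinh x * sinh y.
Proof. by rewrite -[y in LHS]opprK coshB coshN sinhN; ring. Qed.

Lemma cosh2sinh2 x : cosh x ^+ 2 - sinh x ^+ 2 = 1.
Proof. by rewrite -(expRNM x) /cosh /sinh; field. Qed.

(** Differences of cosh, like those of squares and cosines, factor into two
    terms; this gives the three laws of cosines the same shape. *)
Lemma coshBcosh x y :
  cosh x - cosh y = 2 * sinh ((x + y) / 2) * sinh ((x - y) / 2).
Proof.
have -> : cosh x = cosh ((x + y) / 2 + (x - y) / 2) by congr cosh; field.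
have -> : cosh y = cosh ((x + y) / 2 - (x - y) / 2) by congr cosh; field.
by rewrite coshD coshB; ring.
Qed.

Lemma cosh0 : cosh 0 = 1.
Proof. by rewrite /cosh oppr0 expR0; field. Qed.

Lemma sinh_ge0 x : 0 <= x -> 0 <= sinh x.
Proof. by move=> x0; rewrite divr_ge0// subr_ge0 ler_expR; lra. Qed.

Lemma sinh_gt0 x : 0 < x -> 0 < sinh x.
Proof. by move=> x0; rewrite divr_gt0// subr_gt0 ltr_expR; lra. Qed.

Lemma cosh_ge1 x : 1 <= cosh x.
Proof.
suff : 0 <= cosh x - 1 by lra.
rewrite -cosh0 coshBcosh addr0 subr0 -mulrA -expr2.
by rewrite mulr_ge0// sqr_ge0.
Qed.

Lemma le_cosh x y : 0 <= x -> x <= y -> cosh x <= cosh y.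
Proof.
move=> x0 xy; rewrite -subr_ge0 coshBcosh.
by apply: mulr_ge0; [apply: mulr_ge0 => //|]; apply: sinh_ge0; lra.
Qed.

Lemma arcosh_cosh u : 0 <= u -> arcosh (cosh u) = u.
Proof.
move=> u0; rewrite /arcosh.
have -> : cosh u ^+ 2 - 1 = sinh u ^+ 2 by rewrite -(cosh2sinh2 u); ring.
rewrite sqrtr_sqr ger0_norm ?sinh_ge0//.
have -> : cosh u + sinh u = expR u by rewrite /cosh /sinh; field.
by rewrite expRK.
Qed.

Lemma arcosh_le x u : 1 <= x -> 0 <= u -> arcosh x <= u -> x <= cosh u.
Proof.
move=> x1 u0; rewrite /arcosh.
set r := Num.sqrt _; have r0 : 0 <= r by exact: sqrtr_ge0.
have r2 : r ^+ 2 = x ^+ 2 - 1 by rewrite sqr_sqrtr//; nra.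
rewrite -ler_expR lnK ?posrE; last lra.
have := expRNM u; rewrite /cosh; set v := expR u; set v' := expR (- u).
have v'0 : 0 < v' by exact: expR_gt0.
move=> vv wv; have vge : 1 <= v by lra.
rewrite ler_pdivlMr//.
have : (v - (x + r)) * (v * (x + r) - 1) >= 0.
  by rewrite mulr_ge0//; nra.
move=> h; rewrite -(ler_pM2r (_ : 0 < v * (x + r))); last by nra.
have -> : (v + v') * (v * (x + r)) = v ^+ 2 * (x + r) + (v * v') * (x + r) by ring.
rewrite vv; have e : (x + r) * (x - r) = 1 by rewrite mulrC -subr_sqr r2; ring.
have -> : x * 2 * (v * (x + r)) = v * (x + r) ^+ 2 + v * ((x + r) * (x - r)) by ring.
by rewrite e; nra.
Qed.

(** Sine, hyperbolic sine and the identity enter the comparison with model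
    planes only through their common slope 1 at the origin. *)
Lemma slope_bounds (S : R -> R) (e : R) : is_derive (0 : R) 1 S (1 : R) -> S 0 = 0 ->
  0 < e -> exists2 r, 0 < r &
  forall z, 0 <= z <= r -> (1 - e) * z <= S z <= (1 + e) * z.
Proof.
move=> [dS S1] S0 e0.
have : h^-1 *: ((S \o shift 0) (h *: (1 : R)) - S 0) @[h --> 0^'] --> (1 : R).
  by rewrite -[X in _ --> X]S1; exact: dS.
move=> /cvgrPdist_le/(_ e e0) [r /= r0 hr].
exists (r / 2) => [|z /andP[z0 zr]]; first lra.
have [->|zn0] := eqVneq z 0; first by rewrite !mulr0 S0 lexx.
have {}z0 : 0 < z by rewrite lt_neqAle eq_sym zn0.
have := hr z; rewrite /= sub0r normrN (gtr0_norm z0) => /(_ ltac:(lra) zn0).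
rewrite S0 subr0 addr0 => hz.
have {hz} : `|1 - z^-1 * S z| <= e by move: hz; rewrite -[z *: _]/(z * 1) mulr1.
rewrite ler_distl.
have e1 : z^-1 * S z * z = S z by rewrite mulrC mulrA mulfV// mul1r.
move=> /andP[]; rewrite -(ler_pM2r z0) mulrBl e1 => h1.
by rewrite -(ler_pM2r z0) mulrDl e1 => h2; apply/andP; split; lra.
Qed.

Lemma sin_slope (e : R) : 0 < e -> exists2 r, 0 < r &
  forall z, 0 <= z <= r -> (1 - e) * z <= sin z <= (1 + e) * z.
Proof.
apply: slope_bounds; last exact: sin0.
by rewrite -[X in is_derive _ _ _ X](@cos0 R); exact: is_derive_sin.
Qed.

Lemma sinh_slope (e : R) : 0 < e -> exists2 r, 0 < r &
  forall z, 0 <= z <= r -> (1 - e) * z <= sinh z <= (1 + e) * z.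
Proof.
apply: slope_bounds; last by rewrite /sinh oppr0 subrr mul0r.
have h1 : is_derive (0 : R) 1 (expR \o -%R) (expR (- 0) * - 1).
  by apply: is_derive1_comp.
have h := is_deriveZ 2^-1 (is_deriveB (is_derive_expR (0 : R)) h1).
have -> : sinh = 2^-1 *: (expR - (expR \o -%R)).
  by apply/funext => x; rewrite /sinh mulrC.
apply: (is_derive_eq h).
rewrite oppr0 expR0 -[_ *: _]/(_ * _).
by lra.
Qed.
End Hyperbolic.

(** * The law of cosines in the model planes *)

Section Models.
Context {R : realType}.
Implicit Types kappa k x y u B L l D : R.

Definition vec3 (p q r : R) : 'rV[R]_3 := \row_i nth 0 [:: p; q; r] i.

Lemma vec3_0 p q r : vec3 p q r 0 0 = p. Proof. by rewrite mxE. Qed.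
Lemma vec3_1 p q r : vec3 p q r 0 1 = q. Proof. by rewrite mxE. Qed.
Lemma vec3_2 p q r : vec3 p q r 0 2 = r. Proof. by rewrite mxE. Qed.
Definition vec3E := (vec3_0, vec3_1, vec3_2).

(** The conclusion of triangle comparison for a triangle a, b, c and a point d
    on the side from a to c, reduced to the lengths involved: x = |ab|, B = |bc|,
    L = |ac|, l = |ad|, and D is the distance from b to d in the space. *)
Definition model_comparison kappa x B L l D :=
  forall a b c d : 'rV[R]_3,
    model_plane kappa a -> model_plane kappa b ->
    model_plane kappa c -> model_plane kappa d ->
    model_dist kappa a b = x ->
    model_dist kappa b c = B ->
    model_dist kappa a c = L ->
    model_dist kappa a d = l ->
    model_dist kappa d c = L - l ->
  model_dist kappa b d <= D.

(** By the law of cosines both differences of cosh are multiples of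
    1 - cos(alpha), where alpha is the angle at a of the comparison triangle,
    with factors sinh (k x) sinh (k L) and sinh (k x) sinh (k l). Eliminating
    the angle leaves an inequality between lengths. To exploit the hypothesis,
    comparison points have to be exhibited: the side from a to c is placed on a
    fixed geodesic, and b is placed at angle alpha. *)
Lemma hyperbolic_hinge kappa k x B L l D : kappa < 0 ->
  k = Num.sqrt (- kappa) -> 0 < x -> 0 < L ->
  0 <= l <= L -> x - L <= B -> L - x <= B -> B <= x + L -> 0 <= D ->
  model_comparison kappa x B L l D ->
  sinh (k * l) * (cosh (k * B) - cosh (k * (x - L))) <=
  sinh (k * L) * (cosh (k * D) - cosh (k * (x - l))).
Proof.
move=> k0 kE x0 L0 /andP[l0 lL] t1 t2 t3 D0 H.
have kp : 0 < k by rewrite kE sqrtr_gt0; lra.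
have sx : 0 < sinh (k * x) by rewrite sinh_gt0// mulr_gt0.
have sL : 0 < sinh (k * L) by rewrite sinh_gt0// mulr_gt0.
have B0 : 0 <= B by lra.
(* the cosine of the angle at a, from the law of cosines *)
pose ct := (cosh (k * x) * cosh (k * L) - cosh (k * B)) /
  (sinh (k * x) * sinh (k * L)).
have ssp : 0 < sinh (k * x) * sinh (k * L) by exact: mulr_gt0.
have ctE : ct * (sinh (k * x) * sinh (k * L)) =
  cosh (k * x) * cosh (k * L) - cosh (k * B) by rewrite mulfVK// gt_eqF.
have c1 : cosh (k * (x - L)) <= cosh (k * B).
  have [xL|xL] := leP L x.
    by apply: le_cosh; [rewrite mulr_ge0//; lra|rewrite ler_pM2l].
  rewrite -[k * (x - L)]opprK coshN -mulrN opprB.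
  by apply: le_cosh; [rewrite mulr_ge0//; lra|rewrite ler_pM2l].
have c2 : cosh (k * B) <= cosh (k * (x + L)).
  by apply: le_cosh; [rewrite mulr_ge0//; lra|rewrite ler_pM2l].
have ct1 : ct <= 1.
  by rewrite ler_pdivrMr// mul1r; move: c1; rewrite mulrBr coshB; lra.
have ctN1 : -1 <= ct.
  by rewrite ler_pdivlMr// mulN1r; move: c2; rewrite mulrDr coshD; lra.
pose st := Num.sqrt (1 - ct ^+ 2).
have st2 : ct ^+ 2 + st ^+ 2 = 1 by rewrite /st sqr_sqrtr; [ring|nra].
have kn0 : (0 < kappa) = false by apply/negbTE; rewrite -leNgt ltW.
have kn1 : (kappa == 0) = false by apply/negbTE; rewrite lt_eqF.
pose b' := vec3 (cosh (k * x)) (sinh (k * x) * ct) (sinh (k * x) * st).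
pose pt u := vec3 (cosh (k * u)) (sinh (k * u)) 0.
have mpt u : model_plane kappa (pt u).
  rewrite /model_plane/= kn0 kn1 /lorentz /pt !vec3E; split.
    exact: lt_le_trans ltr01 (cosh_ge1 _).
  by rewrite -(cosh2sinh2 (k * u)); ring.
have mb : model_plane kappa b'.
  rewrite /model_plane/= kn0 kn1 /lorentz /b' !vec3E; split.
    exact: lt_le_trans ltr01 (cosh_ge1 _).
  rewrite -[RHS](cosh2sinh2 (k * x)) -[X in _ = _ - X]mulr1 -st2; ring.
have arc u : 0 <= u -> arcosh (cosh (k * u)) / k = u.
  by move=> u0; rewrite arcosh_cosh ?mulr_ge0 ?(ltW kp)// mulrAC mulfV ?mul1r// gt_eqF.
have dpt u v : u <= v -> model_dist kappa (pt u) (pt v) = v - u.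
  move=> uv; rewrite /model_dist kn0 kn1 -kE /lorentz /pt !vec3E.
  rewrite mulr0 subr0 (mulrC (cosh _)) (mulrC (sinh _)) -coshB -mulrBr arc//; lra.
have lbp u : lorentz b' (pt u) =
    cosh (k * x) * cosh (k * u) - sinh (k * x) * ct * sinh (k * u).
  by rewrite /lorentz /b' /pt !vec3E mulr0 subr0.
have pt0 : pt 0 = vec3 1 0 0.
  by rewrite /pt mulr0 cosh0 /sinh oppr0 subrr mul0r.
have := H (pt 0) b' (pt L) (pt l) (mpt _) mb (mpt _) (mpt _).
rewrite !dpt ?(ltW L0)// !subr0.
have -> : model_dist kappa (pt 0) b' = x.
  rewrite /model_dist kn0 kn1 -kE /lorentz pt0 /b' !vec3E !mul0r !subr0 mul1r.
  by rewrite arc// ltW.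
have -> : model_dist kappa b' (pt L) = B.
  rewrite /model_dist kn0 kn1 -kE lbp.
  have -> : cosh (k * x) * cosh (k * L) - sinh (k * x) * ct * sinh (k * L) =
    cosh (k * B) by move: ctE; lra.
  by rewrite arc.
move=> /(_ erefl erefl erefl erefl erefl).
rewrite /model_dist kn0 kn1 -kE lbp ler_pdivrMr// => h.
have X1 : 1 <= cosh (k * x) * cosh (k * l) - sinh (k * x) * ct * sinh (k * l).
  apply: le_trans (cosh_ge1 (k * (x - l))) _.
  rewrite mulrBr coshB lerD2l lerN2 -mulrA ler_pM2l// ler_piMl//.
  by rewrite sinh_ge0// mulr_ge0// ltW.
have := arcosh_le X1 (mulr_ge0 D0 (ltW kp)) h.
rewrite (mulrC D) => {}h.
have : sinh (k * L) * (cosh (k * x) * cosh (k * l) -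
   sinh (k * x) * ct * sinh (k * l)) <= sinh (k * L) * cosh (k * D) by rewrite ler_pM2l.
have e : sinh (k * L) * (sinh (k * x) * ct * sinh (k * l)) =
  sinh (k * l) * (cosh (k * x) * cosh (k * L) - cosh (k * B)) by rewrite -ctE; ring.
rewrite !mulrBr e !coshB; lra.
Qed.

Lemma flat_hinge x B L l D : 0 < x -> 0 < L ->
  0 <= l <= L -> x - L <= B -> L - x <= B -> B <= x + L -> 0 <= D ->
  model_comparison 0 x B L l D ->
  l * (B ^+ 2 - (x - L) ^+ 2) <= L * (D ^+ 2 - (x - l) ^+ 2).
Proof.
move=> x0 L0 /andP[l0 lL] t1 t2 t3 D0 H.
have B0 : 0 <= B by lra.
pose ct := (x ^+ 2 + L ^+ 2 - B ^+ 2) / (2 * x * L).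
have ssp : 0 < 2 * x * L by rewrite !mulr_gt0.
have ctE : ct * (2 * x * L) = x ^+ 2 + L ^+ 2 - B ^+ 2 by rewrite mulfVK// gt_eqF.
have ct1 : ct <= 1 by rewrite ler_pdivrMr// mul1r; nra.
have ctN1 : -1 <= ct by rewrite ler_pdivlMr// mulN1r; nra.
pose st := Num.sqrt (1 - ct ^+ 2).
have st2 : ct ^+ 2 + st ^+ 2 = 1 by rewrite /st sqr_sqrtr; [ring|nra].
pose b' := vec3 0 (x * ct) (x * st).
pose pt u := vec3 0 u 0.
have mpt u : model_plane 0 (pt u).
  by rewrite /model_plane/= ltxx eqxx /pt vec3E.
have mb : model_plane 0 b' by rewrite /model_plane/= ltxx eqxx /b' vec3E.
have dE (u v : 'rV[R]_3) : model_dist 0 u v = Num.sqrt (dot (u - v) (u - v)).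
  by rewrite /model_dist ltxx eqxx.
have dpt u v : u <= v -> model_dist 0 (pt u) (pt v) = v - u.
  move=> uv; rewrite dE /dot /pt !mxE /= !subr0 !mul0r add0r addr0.
  by rewrite -expr2 sqrtr_sqr distrC ger0_norm// subr_ge0.
have dbp u : dot (b' - pt u) (b' - pt u) = x ^+ 2 + u ^+ 2 - 2 * x * u * ct.
  have := congr1 ( *%R (x ^+ 2)) st2.
  rewrite /dot /b' /pt !mxE /=; lra.
have := H (pt 0) b' (pt L) (pt l) (mpt _) mb (mpt _) (mpt _).
rewrite !dpt ?(ltW L0)// !subr0.
have -> : model_dist 0 (pt 0) b' = x.
  rewrite dE /dot /pt /b' !mxE /= !sub0r oppr0 mul0r add0r !mulrNN.
  have -> : x * ct * (x * ct) + x * st * (x * st) = x ^+ 2.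
    by rewrite -[RHS]mulr1 -st2; ring.
  by rewrite sqrtr_sqr gtr0_norm.
have -> : model_dist 0 b' (pt L) = B.
  rewrite dE dbp.
  have -> : x ^+ 2 + L ^+ 2 - 2 * x * L * ct = B ^+ 2 by move: ctE; lra.
  by rewrite sqrtr_sqr ger0_norm.
move=> /(_ erefl erefl erefl erefl erefl); rewrite dE dbp => h.
have X0 : 0 <= x ^+ 2 + l ^+ 2 - 2 * x * l * ct.
  have : 0 <= x * l * (1 - ct) by rewrite !mulr_ge0 ?subr_ge0// ltW.
  have := sqr_ge0 (x - l); nra.
have {}h : x ^+ 2 + l ^+ 2 - 2 * x * l * ct <= D ^+ 2.
  by rewrite -(sqr_sqrtr X0) ler_pXn2r ?nnegrE ?sqrtr_ge0.
have : L * (x ^+ 2 + l ^+ 2 - 2 * x * l * ct) <= L * D ^+ 2 by rewrite ler_pM2l.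
have e : L * (2 * x * l * ct) = l * (x ^+ 2 + L ^+ 2 - B ^+ 2) by rewrite -ctE; ring.
rewrite mulrBr e; lra.
Qed.

Lemma cosBcos u v :
  cos v - cos u = 2 * sin ((u + v) / 2) * sin ((u - v) / 2).
Proof.
have -> : cos u = cos ((u + v) / 2 + (u - v) / 2) by congr cos; field.
have -> : cos v = cos ((u + v) / 2 - (u - v) / 2) by congr cos; field.
by rewrite cosB cosD; ring.
Qed.

Lemma le_cos_pi u v : 0 <= u -> u <= v -> v <= pi -> cos v <= cos u.
Proof.
move=> u0 uv vp; rewrite -subr_ge0 cosBcos.
by apply: mulr_ge0; [apply: mulr_ge0 => //|]; apply: sin_ge0_pi; apply/andP; split; lra.
Qed.

Lemma acos_le u t : -1 <= u <= 1 -> t <= pi -> acos u <= t -> cos t <= u.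
Proof.
move=> u1 tp h; have [/andP[a0 _] <-] := acos_def u1.
exact: le_cos_pi.
Qed.

(** The bounds by pi keep all lengths in the range where the cosine is
    decreasing. *)
Lemma spherical_hinge kappa k x B L l D : 0 < kappa ->
  k = Num.sqrt kappa -> 0 < x -> 0 < L ->
  0 <= l <= L -> x - L <= B -> L - x <= B -> B <= x + L -> 0 <= D ->
  k * (x + L) < pi -> k * D <= pi ->
  model_comparison kappa x B L l D ->
  sin (k * l) * (cos (k * (x - L)) - cos (k * B)) <=
  sin (k * L) * (cos (k * (x - l)) - cos (k * D)).
Proof.
move=> k0 kE x0 L0 /andP[l0 lL] t1 t2 t3 D0 xLp Dp H.
have kp : 0 < k by rewrite kE sqrtr_gt0; lra.
have kx0 : 0 < k * x by rewrite mulr_gt0.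
have kL0 : 0 < k * L by rewrite mulr_gt0.
have kl0 : 0 <= k * l by rewrite mulr_ge0// ltW.
have klL : k * l <= k * L by rewrite ler_pM2l.
rewrite mulrDr in xLp.
have sx : 0 < sin (k * x) by apply: sin_gt0_pi; apply/andP; split; lra.
have sL : 0 < sin (k * L) by apply: sin_gt0_pi; apply/andP; split; lra.
have sl : 0 <= sin (k * l) by apply: sin_ge0_pi; apply/andP; split; lra.
have B0 : 0 <= B by lra.
have kB : 0 <= k * B by rewrite mulr_ge0// ltW.
have kB1 : k * B <= k * x + k * L by rewrite -mulrDr ler_pM2l.
have kB2 : k * x - k * L <= k * B by rewrite -mulrBr ler_pM2l.
have kB3 : k * L - k * x <= k * B by rewrite -mulrBr ler_pM2l.
pose ct := (cos (k * B) - cos (k * x) * cos (k * L)) /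
  (sin (k * x) * sin (k * L)).
have ssp : 0 < sin (k * x) * sin (k * L) by exact: mulr_gt0.
have ctE : ct * (sin (k * x) * sin (k * L)) =
  cos (k * B) - cos (k * x) * cos (k * L) by rewrite mulfVK// gt_eqF.
have c1 : cos (k * B) <= cos (k * (x - L)).
  rewrite mulrBr; have [xL|xL] := leP (k * L) (k * x).
    by apply: le_cos_pi => //; move: xL kB1 xLp; clear; lra.
  rewrite -[k * x - k * L]opprK cosN opprB.
  by apply: le_cos_pi => //; move: xL kB1 xLp; clear; lra.
have c2 : cos (k * (x + L)) <= cos (k * B).
  by rewrite mulrDr; apply: le_cos_pi => //; exact: ltW.
have ct1 : ct <= 1.
  by rewrite ler_pdivrMr// mul1r; move: c1; rewrite mulrBr cosB; lra.
have ctN1 : -1 <= ct.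
  by rewrite ler_pdivlMr// mulN1r; move: c2; rewrite mulrDr cosD; lra.
pose st := Num.sqrt (1 - ct ^+ 2).
have st2 : ct ^+ 2 + st ^+ 2 = 1 by rewrite /st sqr_sqrtr; [ring|nra].
pose b' := vec3 (cos (k * x)) (sin (k * x) * ct) (sin (k * x) * st).
pose pt u := vec3 (cos (k * u)) (sin (k * u)) 0.
have mpt u : model_plane kappa (pt u).
  rewrite /model_plane/= k0 /dot /pt !vec3E.
  by rewrite -(cos2Dsin2 (k * u)); ring.
have mb : model_plane kappa b'.
  rewrite /model_plane/= k0 /dot /b' !vec3E.
  rewrite -[RHS](cos2Dsin2 (k * x)) -[X in _ = _ + X]mulr1 -st2; ring.
have arc u : 0 <= k * u -> k * u <= pi -> acos (cos (k * u)) / k = u.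
  move=> u0 up; rewrite cosK ?in_itv/= ?u0// mulrAC mulfV ?mul1r// gt_eqF//.
have dpt u v : 0 <= k * (v - u) -> k * (v - u) <= pi ->
    model_dist kappa (pt u) (pt v) = v - u.
  move=> uv vu; rewrite /model_dist k0 -kE /dot /pt !vec3E.
  by rewrite mulr0 addr0 (mulrC (cos _)) (mulrC (sin _)) -cosB -mulrBr arc.
have lbp u : dot b' (pt u) =
    cos (k * x) * cos (k * u) + sin (k * x) * ct * sin (k * u).
  by rewrite /dot /b' /pt !vec3E mulr0 addr0.
have pt0 : pt 0 = vec3 1 0 0.
  by rewrite /pt mulr0 cos0 sin0.
have := H (pt 0) b' (pt L) (pt l) (mpt _) mb (mpt _) (mpt _).
have kLp : k * L <= pi by move: xLp kx0; clear; lra.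
have klp := le_trans klL kLp.
rewrite !dpt ?subr0 ?mulrBr ?subr_ge0 ?(ltW kL0)//;
  try by move: kLp kl0; clear; lra.
have -> : model_dist kappa (pt 0) b' = x.
  rewrite /model_dist k0 -kE /dot pt0 /b' !vec3E !mul0r !addr0 mul1r.
  by rewrite arc ?(ltW kx0)//; move: xLp kL0; clear; lra.
have -> : model_dist kappa b' (pt L) = B.
  rewrite /model_dist k0 -kE lbp.
  have -> : cos (k * x) * cos (k * L) + sin (k * x) * ct * sin (k * L) =
    cos (k * B) by move: ctE; lra.
  by rewrite arc//; lra.
move=> /(_ erefl erefl erefl erefl erefl).
rewrite /model_dist k0 -kE lbp ler_pdivrMr// => h.
have ssl : 0 <= sin (k * x) * sin (k * l) by rewrite mulr_ge0// ltW.
have X1 : cos (k * x) * cos (k * l) + sin (k * x) * ct * sin (k * l) <= 1.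
  apply: le_trans (cos_le1 (k * (x - l))).
  rewrite mulrBr cosB; nra.
have X2 : -1 <= cos (k * x) * cos (k * l) + sin (k * x) * ct * sin (k * l).
  apply: le_trans (cos_geN1 (k * (x + l))) _.
  rewrite mulrDr cosD; nra.
rewrite (mulrC D) in h.
have {}h := acos_le (introT andP (conj X2 X1)) Dp h.
have : sin (k * L) * cos (k * D) <= sin (k * L) * (cos (k * x) * cos (k * l) +
   sin (k * x) * ct * sin (k * l)) by rewrite ler_pM2l.
have e : sin (k * L) * (sin (k * x) * ct * sin (k * l)) =
  sin (k * l) * (cos (k * B) - cos (k * x) * cos (k * L)) by rewrite -ctE; ring.
rewrite mulrDr e !mulrBr !cosB; lra.
Qed.

End Models.

(** * Shortest curves and the hinge inequality *)

Section ShortestCurves.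
Context {R : realType} {M : metricType R}.
Implicit Types (a b c p x y : M) (g h : R -> M) (s t u v : R).

Lemma mdist_dist_le a x y : `|mdist a x - mdist a y| <= mdist x y.
Proof.
have h1 := metric_triangle a x y; have h2 := metric_triangle a y x.
rewrite [mdist y x]metric_sym in h2.
by rewrite ler_norml; apply/andP; split; lra.
Qed.

Lemma continuous_mdist a : continuous (mdist a : M -> R).
Proof.
move=> x; apply/cvgrPdist_lt => e e0.
near=> y; apply: le_lt_trans (mdist_dist_le _ _ _) _.
near: y; apply/metricType_numDomainType.nbhs_mdistP.
by exists e.
Unshelve. all: by end_near. Qed.

Lemma curve_length_ge g (s : seq R) : itv_partition 0 1 s ->
  ((polygon_length g s)%:E <= curve_length g)%E.
Proof. by move=> hs; apply: ereal_sup_ubound; exists s. Qed.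

(** The polygon through 0, u, v and 1 is not longer than the curve; when u or v
    is 0 or 1, or they coincide, degenerate vertices have to be left out, since
    partitions are strictly increasing. *)
Lemma shortest_curve_between a c g u v : shortest_curve a c g ->
  0 <= u -> u <= v -> v <= 1 ->
  mdist a (g u) + mdist (g u) (g v) + mdist (g v) c <= mdist a c.
Proof.
move=> [[_ g0 g1] gl] u0 uv v1.
have L (s : seq R) : itv_partition 0 1 s -> polygon_length g s <= mdist a c.
  by move=> hs; rewrite -lee_fin -gl; exact: curve_length_ge.
have T (w : R) : 0 <= w -> w <= 1 -> mdist a (g w) + mdist (g w) c <= mdist a c.
  move=> w0 w1; have [->|w00] := eqVneq w 0; first by rewrite g0 mdistxx add0r.
  have [->|w10] := eqVneq w 1; first by rewrite g1 mdistxx addr0.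
  have := L [:: w; 1]; rewrite /polygon_length /= !big_nat_recl// big_geq//= addr0 g0 g1.
  apply; rewrite /itv_partition /= eqxx andbT; split => //.
  by apply/andP; split; rewrite lt_neqAle ?w0 ?w1 ?w10 // eq_sym w00.
have [->|u00] := eqVneq u 0.
  by rewrite g0 mdistxx add0r; apply: T; lra.
have [->|uv0] := eqVneq u v.
  by rewrite mdistxx addr0; apply: T; lra.
have [->|v10] := eqVneq v 1.
  by rewrite g1 mdistxx addr0; apply: T; lra.
have := L [:: u; v; 1]; rewrite /polygon_length /= !big_nat_recl// big_geq//= addr0 g0 g1 addrA.
apply; rewrite /itv_partition /= eqxx !andbT; split => //.
by apply/and3P; split; rewrite lt_neqAle ?uv ?uv0 ?u0 ?v1 ?v10 // eq_sym u00.
Qed.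

Lemma shortest_curve_add a c g u : shortest_curve a c g -> 0 <= u <= 1 ->
  mdist a (g u) + mdist (g u) c = mdist a c.
Proof.
move=> gs /andP[u0 u1]; apply/eqP; rewrite eq_le metric_triangle andbT.
by have := shortest_curve_between gs u0 (lexx u) u1; rewrite mdistxx addr0.
Qed.

Lemma curve_IVT a c g (w : R) : curve_from_to a c g -> 0 <= w <= mdist a c ->
  exists2 u, 0 <= u <= 1 & mdist a (g u) = w.
Proof.
move=> [gc g0 g1] w01.
have [||u] := @IVT _ (mdist a \o g) 0 1 w ler01.
- by move=> x; apply: continuous_comp (gc x) (@continuous_mdist a _).
- by rewrite /= g0 g1 mdistxx min_l ?max_r ?mdist_ge0.
by rewrite in_itv /= => ? ?; exists u.
Qed.

Lemma shortest_curve_point a c g t : shortest_curve a c g -> 0 <= t <= 1 ->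
  exists u, [/\ 0 <= u <= 1, mdist a (g u) = t * mdist a c &
                mdist (g u) c = (1 - t) * mdist a c].
Proof.
move=> gs /andP[t0 t1]; have /= L0 := mdist_ge0 a c.
have [|u u01 hu] := @curve_IVT a c g (t * mdist a c) gs.1.
  by rewrite mulr_ge0//= ler_piMl.
by exists u; split => //; have := shortest_curve_add gs u01; lra.
Qed.

Lemma nbhs_mdist p (U : set M) : nbhs p U ->
  exists2 r : R, 0 < r & forall x, mdist p x < r -> U x.
Proof.
by move=> /metricType_numDomainType.nbhs_mdistP [r /= r0 h]; exists r => // x /h.
Qed.

(** The point m divides the pair a, c in the ratio t, and satisfies with each b
    near p the inequality that the law of cosines makes an equality with
    eta = 0 in the plane: there, both |bc|^2 - (|ab| - |ac|)^2 and
    |bm|^2 - (|ab| - t |ac|)^2 are multiples of 1 - cos of the angle at a, and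
    their ratio is t. Stated in this way, the inequality is invariant under
    scaling and does not mention angles. *)
Definition hinge_point p r (eta : R) a c t m : Prop :=
  [/\ mdist a m = t * mdist a c, mdist m c = (1 - t) * mdist a c &
    forall b, mdist p b < r ->
      (1 - eta) * t * (mdist b c ^+ 2 - (mdist a b - mdist a c) ^+ 2) <=
      mdist b m ^+ 2 - (mdist a b - t * mdist a c) ^+ 2].

Definition hinge_ball p r (eta : R) : Prop := forall a c,
  mdist p a < r -> mdist p c < r -> forall t, 0 <= t <= 1 ->
  exists m, hinge_point p r eta a c t m.

(** The three model inequalities become the flat one up to 1 - eta: after
    factoring, both sides are products of three values of S, and S z differs
    from z by a factor between 1 - e and 1 + e. *)
Lemma hinge_of_slope (S : R -> R) (e eta k x L t B D : R) :
  0 < eta <= 1 -> e = eta / 10 -> 0 < k -> 0 < L -> 0 <= t <= 1 ->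
  (forall z, 0 <= z <= k * (x + L + B + D) -> (1 - e) * z <= S z <= (1 + e) * z) ->
  0 <= x ->
  `|x - L| <= B -> `|x - t * L| <= D ->
  S (k * (t * L)) * (S (k * ((B + (x - L)) / 2)) * S (k * ((B - (x - L)) / 2))) <=
  S (k * L) * (S (k * ((D + (x - t * L)) / 2)) * S (k * ((D - (x - t * L)) / 2))) ->
  (1 - eta) * t * (B ^+ 2 - (x - L) ^+ 2) <= D ^+ 2 - (x - t * L) ^+ 2.
Proof.
move=> /andP[eta0 eta1] eE k0 L0 /andP[t0 t1] hS x0.
(* e = eta / 10 is small enough for (1 - eta) (1 + e)^3 <= (1 - e)^3 *)
rewrite !ler_norml => /andP[B1 B2] /andP[D1 D2].
have tL0 : 0 <= t * L by rewrite mulr_ge0// ltW.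
have tL1 : t * L <= L by rewrite ler_piMl// ltW.
have hS' z : 0 <= z -> z <= x + L + B + D ->
    (1 - e) * (k * z) <= S (k * z) <= (1 + e) * (k * z).
  by move=> z0 z1; apply: hS; rewrite mulr_ge0 ?(ltW k0)//= ler_pM2l.
set p := (B + (x - L)) / 2; set q := (B - (x - L)) / 2.
set p' := (D + (x - t * L)) / 2; set q' := (D - (x - t * L)) / 2.
have p0 : 0 <= p by rewrite /p; lra.
have q0 : 0 <= q by rewrite /q; lra.
have p'0 : 0 <= p' by rewrite /p'; lra.
have q'0 : 0 <= q' by rewrite /q'; lra.
have pqE : B ^+ 2 - (x - L) ^+ 2 = 4 * (p * q) by rewrite /p /q; field.
have pqE' : D ^+ 2 - (x - t * L) ^+ 2 = 4 * (p' * q') by rewrite /p' /q'; field.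
have /andP[a1 _] := hS' p p0 ltac:(rewrite /p; lra).
have /andP[a2 _] := hS' q q0 ltac:(rewrite /q; lra).
have /andP[a3 _] := hS' (t * L) tL0 ltac:(lra).
have /andP[_ b1] := hS' p' p'0 ltac:(rewrite /p'; lra).
have /andP[_ b2] := hS' q' q'0 ltac:(rewrite /q'; lra).
have /andP[_ b3] := hS' L (ltW L0) ltac:(lra).
have /andP[c1 _] := hS' p' p'0 ltac:(rewrite /p'; lra).
have /andP[c2 _] := hS' q' q'0 ltac:(rewrite /q'; lra).
have e1 : 0 <= 1 - e by rewrite eE; lra.
have e2 : 0 <= 1 + e by rewrite eE; lra.
have nn z : 0 <= z -> 0 <= (1 - e) * (k * z).
  by move=> z0; rewrite !mulr_ge0// ltW.
move=> H.
have lo : (1 - e) * (k * (t * L)) * (((1 - e) * (k * p)) * ((1 - e) * (k * q))) <=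
    S (k * (t * L)) * (S (k * p) * S (k * q)).
  apply: ler_pM => //; first exact: nn.
    by apply: mulr_ge0; apply: nn.
  by apply: ler_pM => //; apply: nn.
have hi : S (k * L) * (S (k * p') * S (k * q')) <=
    (1 + e) * (k * L) * (((1 + e) * (k * p')) * ((1 + e) * (k * q'))).
  have sp := le_trans (nn _ p'0) c1; have sq := le_trans (nn _ q'0) c2.
  apply: ler_pM => //; last by apply: ler_pM.
    by apply: le_trans (nn _ (ltW L0)) _; have /andP[] := hS' L (ltW L0) ltac:(lra).
  exact: mulr_ge0.
have {H lo hi}H := le_trans lo (le_trans H hi).
have kL : 0 < k ^+ 3 * L by rewrite mulr_gt0// exprn_gt0.
have {}H : (1 - e) ^+ 3 * (t * (p * q)) <= (1 + e) ^+ 3 * (p' * q').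
  rewrite -(ler_pM2l kL); move: H; set lhs := (X in X <= _); set rhs := (X in _ <= X).
  have -> : lhs = k ^+ 3 * L * ((1 - e) ^+ 3 * (t * (p * q))) by rewrite /lhs; ring.
  by have -> : rhs = k ^+ 3 * L * ((1 + e) ^+ 3 * (p' * q')) by rewrite /rhs; ring.
have pq0 : 0 <= t * (p * q) by apply: mulr_ge0 => //; exact: mulr_ge0.
have pq'0 : 0 <= p' * q' by exact: mulr_ge0.
have ee : (1 - eta) * (1 + e) ^+ 3 <= (1 - e) ^+ 3.
  have -> : eta = 10 * e by rewrite eE; field.
  have e0 : 0 <= e by rewrite eE; move: eta0; clear; lra.
  rewrite -subr_ge0.
  have -> : (1 - e) ^+ 3 - (1 - 10 * e) * (1 + e) ^+ 3 =
    4 * e + 30 * e ^+ 2 + 28 * e ^+ 3 + 10 * e ^+ 4 by ring.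
  by rewrite !addr_ge0// mulr_ge0// exprn_ge0.
rewrite pqE pqE'.
have e3 : 0 < (1 + e) ^+ 3 by rewrite exprn_gt0// eE; move: eta0; clear; lra.
suff : (1 + e) ^+ 3 * ((1 - eta) * (t * (p * q))) <= (1 + e) ^+ 3 * (p' * q').
  by rewrite ler_pM2l//; clear; lra.
apply: le_trans H.
by move: (ler_wpM2r pq0 ee); clear; lra.
Qed.

(** Degenerate triangles, which have no angle at a. *)
Lemma hinge_ball_trivial a c b t (eta : R) : mdist a c = 0 \/ mdist a b = 0 ->
  eta <= 1 -> 0 <= eta -> 0 <= t <= 1 -> forall m, mdist a m = t * mdist a c ->
  (1 - eta) * t * (mdist b c ^+ 2 - (mdist a b - mdist a c) ^+ 2) <=
      mdist b m ^+ 2 - (mdist a b - t * mdist a c) ^+ 2.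
Proof.
move=> H eta1 eta0 /andP[t0 t1] m am; case: H => [ac|ab].
  rewrite ac mulr0 in am; rewrite ac.
  rewrite -(mdist_positivity _ _ ac) -(mdist_positivity _ _ am) (metric_sym b a); lra.
by rewrite ab -(mdist_positivity _ _ ab) am; lra.
Qed.

Lemma triangle_comparison_hinge kappa (U : set M) p (eta : R) : 0 < eta <= 1 ->
  nbhs p U -> locally_geodesic_in U -> triangle_comparison kappa U ->
  exists2 r : R, 0 < r & hinge_ball p r eta.
Proof.
move=> /andP[eta0 eta1] /nbhs_mdist[r0 r00 rU] gU cU.
pose e := eta / 10; have e0 : 0 < e by rewrite /e; lra.
suff [r1 r10 H] : exists2 r1 : R, 0 < r1 & forall a b c m t,
    mdist p a < Num.min r0 r1 -> mdist p b < Num.min r0 r1 ->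
    mdist p c < Num.min r0 r1 -> 0 < mdist a c -> 0 < mdist a b ->
    0 <= t <= 1 -> mdist a m = t * mdist a c -> mdist m c = (1 - t) * mdist a c ->
    ((0 < kappa -> mdist a b + mdist b c + mdist c a < 2 * pi / Num.sqrt kappa) ->
     model_comparison kappa (mdist a b) (mdist b c) (mdist a c) (mdist a m) (mdist b m)) ->
    (1 - eta) * t * (mdist b c ^+ 2 - (mdist a b - mdist a c) ^+ 2) <=
      mdist b m ^+ 2 - (mdist a b - t * mdist a c) ^+ 2.
  exists (Num.min r0 r1) => [|a c pa pc t t01]; first by rewrite lt_min r00.
  have Uin z : mdist p z < Num.min r0 r1 -> U z.
    by rewrite lt_min => /andP[/rU].
  have [g gs] := gU a c (Uin a pa) (Uin c pc).
  have [u [u01 hu1 hu2]] := shortest_curve_point gs t01.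
  exists (g u); split => // b pb.
  have [ac|ac] := eqVneq (mdist a c) 0.
    by apply: hinge_ball_trivial => //; [left|rewrite ltW].
  have [ab|ab] := eqVneq (mdist a b) 0.
    by apply: hinge_ball_trivial => //; [right|rewrite ltW].
  have pos x y : mdist x y != 0 -> 0 < mdist x y.
    by move=> xy; rewrite lt_neqAle eq_sym xy mdist_ge0.
  apply: H => //; [exact: pos|exact: pos|].
  move=> per a' b' c' d' ma mb mc md e1 e2 e3 e4 e5.
  apply: (cU a b c (Uin _ pa) (Uin _ pb) (Uin _ pc) per g gs u u01 a' b' c' d') => //.
  by rewrite e5 hu1 hu2; ring.
have gen a b c m t : 0 <= t <= 1 -> mdist a m = t * mdist a c ->
  mdist m c = (1 - t) * mdist a c ->
  [/\ 0 <= mdist a m <= mdist a c, mdist a b - mdist a c <= mdist b c,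
   mdist a c - mdist a b <= mdist b c, mdist b c <= mdist a b + mdist a c &
   0 <= mdist b m].
  move=> /andP[t0 t1] am mc; split.
  - rewrite mdist_ge0 /= am ler_piMl// mdist_ge0//.
  - have := metric_triangle a c b; rewrite (metric_sym c b); lra.
  - have := metric_triangle a b c; lra.
  - have := metric_triangle b a c; rewrite (metric_sym b a); lra.
  - exact: mdist_ge0.
have small k r a b c m t : 0 < k -> mdist p a < r -> mdist p b < r -> mdist p c < r ->
  0 <= t <= 1 -> mdist a m = t * mdist a c ->
  k * (mdist a b + mdist a c + mdist b c + mdist b m) <= k * (10 * r).
  move=> k0 pa pb pc /andP[t0 t1] am; rewrite ler_pM2l//.
  have am' : mdist a m <= mdist a c by rewrite am ler_piMl ?mdist_ge0.
  have := metric_triangle a p b; rewrite (metric_sym a p).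
  have := metric_triangle a p c; rewrite (metric_sym a p).
  have := metric_triangle b p c; rewrite (metric_sym b p).
  have := metric_triangle b a m; rewrite (metric_sym b a); lra.
have [k0|k0|k0] := ltgtP 0 kappa.
- pose k := Num.sqrt kappa; have k00 : 0 < k by rewrite sqrtr_gt0.
  have [rs rs0 hs] := sin_slope e0.
  have pi0 : 0 < pi :> R by exact: pi_gt0.
  exists (Num.min rs pi / (k * 20)).
    by rewrite divr_gt0 ?mulr_gt0// lt_min rs0.
  move=> a b c m t pa pb pc ac ab t01 am mc H.
  have sm := small k _ a b c m t k00 pa pb pc t01 am.
  have sm1 : k * (mdist a b + mdist a c + mdist b c + mdist b m) < Num.min rs pi.
    apply: le_lt_trans sm _.
    have h1 : Num.min r0 (Num.min rs pi / (k * 20)) <= Num.min rs pi / (k * 20).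
      by rewrite ge_min lexx orbT.
    apply: (@le_lt_trans _ _ (k * (10 * (Num.min rs pi / (k * 20))))).
      by rewrite ler_pM2l// ler_pM2l.
    have h2 : 0 < Num.min rs pi by rewrite lt_min rs0.
    suff -> : k * (10 * (Num.min rs pi / (k * 20))) = Num.min rs pi / 2 by lra.
    by field; rewrite gt_eqF.
  move: (sm1); rewrite lt_min => /andP[sm2 sm3].
  have [g1 g2 g3 g4 g5] := gen a b c m t t01 am mc.
  have P z : z <= mdist a b + mdist a c + mdist b c + mdist b m -> k * z < pi.
    by move=> hz; apply: le_lt_trans sm3; rewrite ler_pM2l.
  have bc0 := mdist_ge0 b c.
  have am0 := mdist_ge0 b m.
  have per : mdist a b + mdist b c + mdist c a < 2 * pi / Num.sqrt kappa.
    rewrite -/k ltr_pdivlMr// (metric_sym c a) mulrC.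
    move: (P (mdist a b + mdist b c + mdist a c) ltac:(by move: am0; clear; lra)) pi0.
    by clear; lra.
  have p1 := P (mdist a b + mdist a c) ltac:(by move: bc0 am0; clear; lra).
  have p2 := P (mdist b m) ltac:(by move: ab ac bc0; clear; lra).
  have := @spherical_hinge _ kappa k (mdist a b) (mdist b c) (mdist a c) (mdist a m)
    (mdist b m) k0 erefl ab ac g1 g2 g3 g4 g5 p1 (ltW p2) (H (fun _ => per)).
  rewrite !cosBcos am -!mulrDr -!mulrBr -!(mulrA k) => h.
  apply: (@hinge_of_slope sin e eta k) => //; rewrite ?eta0 ?eta1 ?mdist_ge0//.
  + move=> z /andP[z0 z1]; apply: hs; rewrite z0/=; apply: le_trans z1 (ltW sm2).
  + exact: mdist_dist_le.
  + by rewrite -am; exact: mdist_dist_le.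
  + by move: h; clear; lra.
- pose k := Num.sqrt (- kappa); have k00 : 0 < k by rewrite sqrtr_gt0; lra.
  have [rs rs0 hs] := sinh_slope e0.
  exists (rs / (k * 20)).
    by rewrite divr_gt0 ?mulr_gt0//.
  move=> a b c m t pa pb pc ac ab t01 am mc H.
  have sm := small k _ a b c m t k00 pa pb pc t01 am.
  have sm1 : k * (mdist a b + mdist a c + mdist b c + mdist b m) < rs.
    apply: le_lt_trans sm _.
    have h1 : Num.min r0 (rs / (k * 20)) <= rs / (k * 20).
      by rewrite ge_min lexx orbT.
    apply: (@le_lt_trans _ _ (k * (10 * (rs / (k * 20))))).
      by rewrite ler_pM2l// ler_pM2l.
    suff -> : k * (10 * (rs / (k * 20))) = rs / 2 by lra.
    by field; rewrite gt_eqF.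
  have [g1 g2 g3 g4 g5] := gen a b c m t t01 am mc.
  have := @hyperbolic_hinge _ kappa k (mdist a b) (mdist b c) (mdist a c) (mdist a m)
    (mdist b m) k0 erefl ab ac g1 g2 g3 g4 g5.
  move=> /(_ (H (fun f => False_ind _ (notF f)))).
  rewrite !coshBcosh am -!mulrDr -!mulrBr -!(mulrA k) => h.
  apply: (@hinge_of_slope sinh e eta k) => //; rewrite ?eta0 ?eta1 ?mdist_ge0//.
  + move=> z /andP[z0 z1]; apply: hs; rewrite z0/=; apply: le_trans z1 (ltW sm1).
  + exact: mdist_dist_le.
  + by rewrite -am; exact: mdist_dist_le.
  + by move: h; clear; lra.
- subst kappa.
  exists 1 => // a b c m t pa pb pc ac ab t01 am mc H.
  have [g1 g2 g3 g4 g5] := gen a b c m t t01 am mc.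
  have := @flat_hinge _ (mdist a b) (mdist b c) (mdist a c) (mdist a m)
    (mdist b m) ab ac g1 g2 g3 g4 g5 (H (fun f => False_ind _ (notF f))).
  rewrite am => h.
  apply: (@hinge_of_slope id e eta 1) => //; rewrite ?eta0 ?eta1 ?mdist_ge0//.
  + move=> z /andP[z0 _]; move: (mulr_ge0 (ltW e0) z0).
    by move=> ez; apply/andP; split; move: ez; clear; lra.
  + exact: mdist_dist_le.
  + by rewrite -am; exact: mdist_dist_le.
  + by rewrite !mul1r; lra.
Qed.

Lemma curvature_ge_hinge kappa p (eta : R) : 0 < eta <= 1 ->
  curvature_ge M kappa -> exists2 r : R, 0 < r & hinge_ball p r eta.
Proof.
move=> eta01 /(_ p)[U pU [gU cU]]; exact: triangle_comparison_hinge cU.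
Qed.

End ShortestCurves.

(** * Contraction and semiconcavity of the squared distance *)

Section Hinges.
Context {R : realType} {M : metricType R}.
Implicit Types (a b c o p x y z m : M) (g h : R -> M) (r s t u v eta : R).

Lemma hinge_ball_le p r r' eta : r' <= r -> hinge_ball p r eta ->
  hinge_ball p r' eta.
Proof.
move=> rr H a c pa pc t t01.
have [m [m1 m2 m3]] := H a c (lt_le_trans pa rr) (lt_le_trans pc rr) t t01.
by exists m; split => // b pb; apply: m3; exact: lt_le_trans rr.
Qed.

(** Moving from o towards a and b in the same ratio l shrinks their distance by
    at most the factor l, up to 1 - eta: this is the hinge inequality for o, a
    tested at b, combined with the one for o, b tested at m. *)
Lemma hinge_contraction p r eta o a b l m m' : 0 <= eta <= 1 -> 0 <= l <= 1 ->
  mdist p b < r -> mdist p m < r ->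
  hinge_point p r eta o a l m -> hinge_point p r eta o b l m' ->
  (1 - eta) * l * mdist a b <= mdist m m'.
Proof.
move=> /andP[e0 e1] /andP[l0 l1] pb pm [om ma hm] [om' mb hm'].
have := hm b pb; have := hm' m pm; rewrite om.
have h1 := mdist_dist_le o a b; rewrite ler_norml in h1; have /andP[h2 h3] := h1.
have D0 := mdist_ge0 a b; have D1 := mdist_ge0 m m'.
rewrite (metric_sym b a) (metric_sym b m).
set x := mdist o a; set y := mdist o b; set D := mdist a b; set E := mdist m m'.
set F := mdist m b; set u := 1 - eta => k1 k2.
have u0 : 0 <= u by rewrite /u; lra.
have u1 : u <= 1 by rewrite /u; lra.
have ul : 0 <= u * l by exact: mulr_ge0.
rewrite -(@ler_pXn2r _ 2)// ?nnegrE ?mulr_ge0//.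
have k3 : (u * l) * (u * l * (D ^+ 2 - (y - x) ^+ 2)) <=
    u * l * (F ^+ 2 - (y - l * x) ^+ 2) by exact: ler_wpM2l.
have k4 : 0 <= (1 - u ^+ 2) * (l * (x - y)) ^+ 2.
  by rewrite mulr_ge0 ?sqr_ge0// subr_ge0 expr_le1.
by lra.
Qed.

(** The substitute for a shortest curve between points that are far apart. *)
Lemma length_space_point x y w delta : length_space M -> 0 <= w <= mdist x y ->
  0 < delta ->
  exists2 p, mdist x p = w & mdist p y <= mdist x y - w + delta.
Proof.
move=> lM w01 d0.
have : (ereal_inf [set curve_length g | g in curve_from_to x y] <
    (mdist x y + delta)%:E)%E by rewrite -lM lte_fin ltrDl.
move=> /ereal_inf_lt[_ [g gxy <-]] gl.
have [u u01 xu] := curve_IVT gxy w01.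
exists (g u) => //.
suff : mdist x (g u) + mdist (g u) y <= mdist x y + delta by lra.
have [gc g0 g1] := gxy; have /andP[u0 u1] := u01.
have [->|un0] := eqVneq u 0; first by rewrite g0 mdistxx add0r; lra.
have [->|un1] := eqVneq u 1; first by rewrite g1 mdistxx addr0; lra.
rewrite -lee_fin; apply: le_trans (ltW gl).
have := @curve_length_ge _ _ g [:: u; 1].
rewrite /polygon_length /= !big_nat_recl// big_geq//= addr0 g0 g1.
apply; rewrite /itv_partition /= eqxx andbT; split => //.
by apply/andP; split; rewrite lt_neqAle ?u0 ?u1 ?un1 // eq_sym un0.
Qed.

(** As |bc|^2 - (|ab| - |ac|)^2 <= 4 |ab| |ac|, giving up the factor 1 - eta
    costs an error that is linear in |ac|. *)
Lemma hinge_semiconcave_near p r eta a c t m b :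
  0 <= eta -> 0 <= t <= 1 -> hinge_point p r eta a c t m -> mdist p b < r ->
  (1 - t) * mdist a b ^+ 2 + t * mdist c b ^+ 2 <=
  mdist m b ^+ 2 + mdist a c * (mdist a c + 4 * eta * mdist a b).
Proof.
move=> eta0 /andP[t0 t1] [_ _ hm] pb.
have := hm b pb; rewrite (metric_sym b c) (metric_sym b m).
have D0 := mdist_ge0 a b; have D1 := mdist_ge0 m b; have D2 := mdist_ge0 a c.
have D3 := mdist_ge0 c b.
have := metric_triangle a b c; rewrite (metric_sym b c).
have := metric_triangle a c b; have := metric_triangle c a b; rewrite (metric_sym c a).
set x := mdist a b; set L := mdist a c; set y := mdist c b; set d := mdist m b.
move=> h1 h2 h2' h3.
have q : y ^+ 2 - (x - L) ^+ 2 <= 4 * L * x.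
  have -> : y ^+ 2 - (x - L) ^+ 2 = (y - x + L) * (y + x - L) by ring.
  have : 0 <= (2 * L - (y - x + L)) * (y + x - L) by apply: mulr_ge0; lra.
  have : 0 <= (2 * L) * (2 * x - (y + x - L)) by apply: mulr_ge0; lra.
  by lra.
have q2 : eta * t * (y ^+ 2 - (x - L) ^+ 2) <= eta * (4 * L * x).
  rewrite -mulrA ler_wpM2l//; apply: le_trans (ler_wpM2l t0 q) _.
  by rewrite ler_piMl// !mulr_ge0.
have q3 : t * (1 - t) * L ^+ 2 <= L ^+ 2.
  by rewrite ler_piMl ?sqr_ge0//; nra.
by move: h3 q2; rewrite mulrBl mul1r; lra.
Qed.

(** Semiconcavity at arbitrary y, with an error of first order in |ab| that is
    proportional to eta. Comparison is only available near o, so y is replaced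
    by a point p at the fixed distance e from c on an almost shortest path from
    c to y. The estimate at p, where squares of distances are about e^2, is
    carried over to y by the triangle inequality; the average of the distances
    is controlled by that of their squares. *)
Lemma hinge_semiconcave o r eta a b t c y : length_space M ->
  0 < eta <= 1 -> 0 < r <= 1 -> 0 <= t <= 1 ->
  mdist o a < eta * r / 16 -> mdist o b < eta * r / 16 ->
  hinge_point o r eta a b t c ->
  (1 - t) * mdist a y ^+ 2 + t * mdist b y ^+ 2 <=
  mdist c y ^+ 2 + 9 * eta * mdist a b * (1 + mdist c y).
Proof.
move=> lM /andP[eta0 eta1] /andP[r0 r1] t01 oa ob hc.
have /andP[t0 t1] := t01.
pose e := r / 4; have e0 : 0 < e by rewrite /e; lra.
set L := mdist a b; have L0 : 0 <= L := mdist_ge0 _ _.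
have er : eta * r <= r by rewrite ler_piMl// ltW.
have Le : L <= eta * e / 2.
  have := metric_triangle a o b; rewrite (metric_sym a o) -/L.
  have -> : eta * e / 2 = eta * r / 16 + eta * r / 16 by rewrite /e; field.
  lra.
have ac : mdist a c <= L by case: hc => -> _ _; rewrite ler_piMl.
have ee : eta * e <= e by rewrite ler_piMl// ltW.
have near p : mdist c p <= e ->
    (1 - t) * mdist a p ^+ 2 + t * mdist b p ^+ 2 <=
    mdist c p ^+ 2 + 9 * eta * L * e.
  move=> cp; have ap : mdist a p <= 2 * e.
    by have := metric_triangle a c p; lra.
  have op : mdist o p < r.
    have := metric_triangle o a p; rewrite /e in ap ee *; lra.
  apply: le_trans (hinge_semiconcave_near (ltW eta0) t01 hc op) _.
  rewrite lerD2l -/L.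
  have : L * (4 * eta * mdist a p) <= L * (4 * eta * (2 * e)).
    by rewrite ler_wpM2l// ler_wpM2l// mulr_ge0// ltW.
  have : L * L <= L * (eta * e / 2) by rewrite ler_wpM2l.
  have : 0 <= L * eta * e by rewrite !mulr_ge0// ltW.
  lra.
have eL : 0 <= 9 * eta * L by rewrite !mulr_ge0// ltW.
have [cy|cy] := leP (mdist c y) e.
  apply: le_trans (near y cy) _; rewrite lerD2l ler_wpM2l//.
  have := mdist_ge0 c y; rewrite /e; lra.
set d := mdist c y.
have main delta : 0 < delta -> (1 - t) * mdist a y ^+ 2 + t * mdist b y ^+ 2 <=
    (d + delta) ^+ 2 + 9 * eta * L * (d + delta).
  move=> d0; have [|p cp py] := @length_space_point c y e delta lM _ d0.
    by rewrite !ltW.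
  have := near p; rewrite cp lexx => /(_ isT) h.
  rewrite -/d in py.
  set D := mdist p y in py *; have D0 : 0 <= D := mdist_ge0 _ _.
  have aD := metric_triangle a p y; have bD := metric_triangle b p y.
  rewrite -/D in aD bD.
  set x := mdist a p in h aD; set z := mdist b p in h bD.
  have x0 : 0 <= x := mdist_ge0 _ _; have z0 : 0 <= z := mdist_ge0 _ _.
  have a2 : mdist a y ^+ 2 <= (x + D) ^+ 2.
    by rewrite ler_pXn2r// ?nnegrE ?mdist_ge0// addr_ge0.
  have b2 : mdist b y ^+ 2 <= (z + D) ^+ 2.
    by rewrite ler_pXn2r// ?nnegrE ?mdist_ge0// addr_ge0.
  have t1' : 0 <= 1 - t by lra.
  have a3 := ler_wpM2l t1' a2; have b3 := ler_wpM2l t0 b2.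
  have m1 : (1 - t) * x + t * z <= e + 9 * eta * L / 2.
    (* Jensen's inequality for the square *)
    rewrite -(@ler_pXn2r _ 2)// ?nnegrE; last 2 first.
    - by rewrite addr_ge0// mulr_ge0.
    - by rewrite addr_ge0// ?(ltW e0)// mulr_ge0.
    have j : ((1 - t) * x + t * z) ^+ 2 <= (1 - t) * x ^+ 2 + t * z ^+ 2.
      have : 0 <= t * (1 - t) * (x - z) ^+ 2.
        by apply: mulr_ge0; [exact: mulr_ge0|exact: sqr_ge0].
      lra.
    apply: le_trans j (le_trans h _).
    have := sqr_ge0 (9 * eta * L / 2); lra.
  have m2 := ler_wpM2l D0 m1.
  have eD : e + D <= d + delta by move: py; clear; lra.
  have s1 : (e + D) ^+ 2 <= (d + delta) ^+ 2.
    by rewrite ler_pXn2r// ?nnegrE; move: e0 D0 eD; clear; lra.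
  have s2 := ler_wpM2l eL eD.
  by move: a3 b3 m2 h s1 s2; clear; lra.
apply/ler_addgt0Pr => k k0.
have d0 : 0 <= d := mdist_ge0 _ _.
pose del := Num.min 1 (k / (2 * d + 1 + 9 * eta * L)).
have q0 : 0 < 2 * d + 1 + 9 * eta * L by lra.
have del0 : 0 < del by rewrite lt_min ltr01 divr_gt0.
have del1 : del <= 1 by rewrite ge_min lexx.
have delk : del * (2 * d + 1 + 9 * eta * L) <= k.
  by rewrite -ler_pdivlMr// ge_min lexx orbT.
apply: le_trans (main _ del0) _.
have : del * del <= del by rewrite ler_piMl// ltW.
lra.
Qed.

End Hinges.

(** * First and second moments over measurable sets *)

Section Moments.
Context {R : realType} {M : completeMetricType R}.
Variable Q : probability (borel M) R.
Implicit Types (a b c o p q x y z : M) (D : set (borel M)).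

Lemma measurable_mdist q : measurable_fun setT (mdist q : borel M -> R).
Proof.
apply: (measurability _ (RGenOInfty.measurableE R)) => //.
move=> _ [_ [x ->] <-]; rewrite setTI; apply: sub_sigma_algebra.
have -> : (mdist q : borel M -> R) @^-1` `]x, +oo[ = (mdist q : M -> R) @^-1` [set z | x < z].
  by apply/seteqP; split => y /=; rewrite in_itv/= andbT.
apply: open_comp; last exact: open_gt.
by move=> y _; exact: continuous_mdist.
Qed.

Lemma measurable_mdist_sq q :
  measurable_fun setT (fun y : borel M => mdist q (y : M) ^+ 2).
Proof. by apply: measurable_funX; exact: measurable_mdist. Qed.

Hypothesis hQ : finite_second_moments Q.

Lemma integrable_sq q :
  Q.-integrable setT (EFin \o (fun y : borel M => mdist q (y : M) ^+ 2)).
Proof.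
have [q0 hq0] := hQ.
have i0 : Q.-integrable setT (EFin \o (fun y : borel M => mdist q0 (y : M) ^+ 2)).
  apply/integrableP; split; first by apply/measurable_EFinP; exact: measurable_mdist_sq.
  apply: le_lt_trans hq0; apply: ge0_le_integral => //.
  - by apply: measurableT_comp => //; apply/measurable_EFinP; exact: measurable_mdist_sq.
  - by apply/measurable_EFinP; exact: measurable_mdist_sq.
  - by move=> y _ /=; rewrite ger0_norm// sqr_ge0.
pose c := 2 * mdist q q0 ^+ 2.
have i1 : Q.-integrable setT (EFin \o (fun y : borel M => c + 2 * mdist q0 (y : M) ^+ 2)).
  apply: eq_integrable (integrableD measurableT (finite_measure_integrable_cst Q c
    measurableT) (integrableZl measurableT 2 i0)) => //.
apply: le_integrable i1 => //; first by apply/measurable_EFinP; exact: measurable_mdist_sq.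
move=> y _ /=; rewrite lee_fin !ger0_norm ?sqr_ge0 ?addr_ge0 ?mulr_ge0 ?sqr_ge0 ?mdist_ge0//.
have h1 := metric_triangle q q0 (y : M).
have h2 := mdist_ge0 q (y : M); have h3 := mdist_ge0 q q0.
have h4 := mdist_ge0 q0 (y : M).
apply: (@le_trans _ _ ((mdist q q0 + mdist q0 (y : M)) ^+ 2)).
  by rewrite ler_pXn2r// ?nnegrE ?addr_ge0.
by rewrite /c; have := sqr_ge0 (mdist q q0 - mdist q0 (y : M)); lra.
Qed.

Lemma integrable_mdist q :
  Q.-integrable setT (EFin \o (fun y : borel M => mdist q (y : M))).
Proof.
have i1 : Q.-integrable setT (EFin \o (fun y : borel M => 1 + mdist q (y : M) ^+ 2)).
  apply: eq_integrable (integrableD measurableT (finite_measure_integrable_cst Q 1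
    measurableT) (integrable_sq q)) => //.
apply: le_integrable i1 => //; first by apply/measurable_EFinP; exact: measurable_mdist.
move=> y _ /=; rewrite lee_fin !ger0_norm ?mdist_ge0 ?addr_ge0 ?sqr_ge0//.
by have := sqr_ge0 (mdist q (y : M) - 1); nra.
Qed.

Definition moment2 D q : R := \int[Q]_(y in D) (mdist q (y : M) ^+ 2).
Definition moment1 D q : R := \int[Q]_(y in D) (mdist q (y : M)).
Definition mass D : R := fine (Q D).

(** All comparisons of moments below integrate a pointwise inequality of this
    form, with points a, b and c near o, and o itself in the linear term. *)
Lemma moment_ineq D a b c o (al be ga de ze : R) : measurable D ->
  (forall y : M, D y -> 0 <= al * mdist a y ^+ 2 + be * mdist b y ^+ 2 +
     ga * mdist c y ^+ 2 + de * mdist o y + ze) ->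
  0 <= al * moment2 D a + be * moment2 D b + ga * moment2 D c +
     de * moment1 D o + ze * mass D.
Proof.
move=> mD H.
have iS q : Q.-integrable D (EFin \o (fun y : borel M => mdist q (y : M) ^+ 2)).
  exact: integrableS (integrable_sq q).
have iZ q k : Q.-integrable D (EFin \o (fun y : borel M => k * mdist q (y : M) ^+ 2)).
  by apply: eq_integrable (integrableZl mD k (iS q)).
have i1 : Q.-integrable D (EFin \o (fun y : borel M => mdist o (y : M))).
  exact: integrableS (integrable_mdist o).
have i1Z k : Q.-integrable D (EFin \o (fun y : borel M => k * mdist o (y : M))).
  by apply: eq_integrable (integrableZl mD k i1).
have ic : Q.-integrable D (EFin \o cst ze).
  exact: finite_measure_integrable_cst.
have iD f g : Q.-integrable D (EFin \o f) -> Q.-integrable D (EFin \o g) ->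
   Q.-integrable D (EFin \o (fun y => f y + g y)).
  by move=> fi gi; apply: eq_integrable (integrableD mD fi gi).
have := @Rintegral_ge0 _ _ _ Q D _ H.
have iab := iD _ _ (iZ a al) (iZ b be).
have iabc := iD _ _ iab (iZ c ga).
have iabco := iD _ _ iabc (i1Z de).
rewrite RintegralD// RintegralD// RintegralD// RintegralD//.
by rewrite Rintegral_cst// !RintegralZl.
Qed.

Lemma mass_le1 D : measurable D -> mass D <= 1.
Proof.
move=> mD; rewrite -lee_fin fineK ?probability_le1//.
exact: fin_num_measure.
Qed.

Lemma mass_setT : mass setT = 1.
Proof. by rewrite /mass probability_setT. Qed.

Lemma moment2_setC D q : measurable D ->
  moment2 setT q = moment2 D q + moment2 (~` D) q.
Proof.
move=> mD; rewrite /moment2 -Rintegral_setU ?setUv//.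
- exact: measurableC.
- exact: integrable_sq.
- by apply/disj_setPCl.
Qed.

Lemma frechet_mean_moment2 o q : frechet_mean Q o ->
  moment2 setT o <= moment2 setT q.
Proof.
move=> /(_ q) h; apply: fine_le => //; apply: integrable_fin_num => //; exact: integrable_sq.
Qed.

End Moments.

(** * A broken path leaving a point *)

Section Apex.
Context {R : realType} {M : metricType R}.
Implicit Types (a b c o p x y z m : M) (r s t u v eta : R).

(** The path o, a, c turns at a: it leads towards ah up to the ratio t, then
    towards b up to the ratio tau. The hinge at o is tested at c, and the hinge
    at a is tested at ah; the distance from c to ah occurs in both and cancels
    up to a multiple of eta. What remains bounds the distance from ah to b in
    terms of the distance from o to c: the farther c is from o, the smaller the
    angle between ah and b. *)
Lemma apex_bound p r eta o ah a b c t tau : 0 <= eta -> 0 <= t -> 0 <= tau ->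
  hinge_point p r eta o ah t a -> hinge_point p r eta a b tau c ->
  mdist p c < r -> mdist p ah < r ->
  (1 - t) * mdist o c ^+ 2 + t * tau * mdist ah b ^+ 2 <=
  tau ^+ 2 * mdist a b ^+ 2 + t * tau * (1 - tau) * mdist a b ^+ 2 +
  t * (1 - t) * mdist o ah ^+ 2 * (1 - (1 - tau) * (1 - t)) +
  eta * t * (mdist c ah ^+ 2 + tau * mdist ah b ^+ 2).
Proof.
move=> e0 t0 u0 [_ a1 ha] [c1 _ hc] pc pah.
have := ha c pc; have := hc ah pah.
rewrite (metric_sym c a) c1 a1 (metric_sym ah c).
set X := mdist c ah; set d := mdist ah b; set L := mdist a b; set s := mdist o ah.
set C := mdist o c => h2 h1.
have {}h2 := ler_wpM2l t0 h2.
have y1 : 0 <= eta * t * (C - s) ^+ 2 by apply: mulr_ge0; [rewrite mulr_ge0|exact: sqr_ge0].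
have y2 : 0 <= eta * t * tau * ((1 - t) * s - L) ^+ 2.
  by apply: mulr_ge0; [rewrite !mulr_ge0|exact: sqr_ge0].
lra.
Qed.

(** With s = |o ah| and |ob| = K s, if c is at least as far from o as a is, up
    to a factor close to 1, then |ah b|^2 <= (K^2 + 2) s^2, the Pythagorean
    bound with s^2 to spare. The choices of t and tau make each error at most a
    fraction of t tau s^2: writing all terms as multiples of t tau s^2, the
    term with (1 - tau) L^2 gives K^2 + 2 / 8 + t^2, those with tau^2, and with
    e1 and eta, give 1 / 4 and 1 / 2, and the difference of the terms with s^2
    and C^2 gives 1 - t^2. *)
Lemma apex_far (K t tau s L C X d eta e1 : R) :
  1 <= K -> t = (8 * K)^-1 -> tau = t / (4 * (K + 1) ^+ 2) -> 0 < s ->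
  0 <= eta -> 0 <= e1 ->
  2 * e1 + eta * (9 + (K + 1) ^+ 2) <= t * tau / 2 ->
  0 <= L -> L <= (K + t) * s -> 0 <= C -> (1 - tau) * t * s - e1 * s <= C ->
  0 <= X <= 3 * s -> 0 <= d <= (K + 1) * s ->
  (1 - t) * C ^+ 2 + t * tau * d ^+ 2 <=
  tau ^+ 2 * L ^+ 2 + t * tau * (1 - tau) * L ^+ 2 +
  t * (1 - t) * s ^+ 2 * (1 - (1 - tau) * (1 - t)) +
  eta * t * (X ^+ 2 + tau * d ^+ 2) ->
  d <= (K + K^-1) * s.
Proof.
move=> K1 tE tauE s0 eta0 e10 small L0 LK C0 CX /andP[X0 X3] /andP[d0 dK] H.
have K0 : 0 < K by lra.
have t0 : 0 < t by rewrite tE invr_gt0; lra.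
have tK : t * K = 8^-1 by rewrite tE; field; rewrite gt_eqF.
have t1 : t <= 8^-1.
  by rewrite -tK ler_peMr// ltW.
have K2 : 0 < (K + 1) ^+ 2 by rewrite exprn_gt0; lra.
have tau0 : 0 < tau by rewrite tauE divr_gt0// mulr_gt0.
have tauK : tau * (K + 1) ^+ 2 = t / 4 by rewrite tauE; field; rewrite gt_eqF//; lra.
have tau1 : tau <= 1.
  have : 1 <= (K + 1) ^+ 2 by rewrite exprn_ege1; lra.
  by nra.
have s2 : 0 < s ^+ 2 by rewrite exprn_gt0.
set Y := (1 - tau) * t * s in CX.
have Y0 : 0 <= Y by rewrite !mulr_ge0 ?subr_ge0 ?(ltW t0) ?(ltW s0).
have Ys : Y <= s.
  rewrite -[leRHS]mul1r /Y; apply: ler_wpM2r; first exact: ltW.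
  nra.
have C2 : Y ^+ 2 - 2 * e1 * s ^+ 2 <= C ^+ 2.
  have es : 0 <= e1 * s by rewrite mulr_ge0// ltW.
  have h : Y * (e1 * s) <= s * (e1 * s) by rewrite ler_wpM2r.
  have [h1|h1] := leP (e1 * s) Y.
    have : (Y - e1 * s) ^+ 2 <= C ^+ 2 by rewrite ler_pXn2r// ?nnegrE; lra.
    have := sqr_ge0 (e1 * s); lra.
  have := sqr_ge0 C; have : Y * Y <= Y * (e1 * s) by rewrite ler_wpM2l// ltW.
  have := mulr_ge0 (ltW s0) es; lra.
have L2 : L ^+ 2 <= ((K + t) * s) ^+ 2.
  by rewrite ler_pXn2r// nnegrE; exact: le_trans LK.
have L2' : L ^+ 2 <= (K + 1) ^+ 2 * s ^+ 2.
  apply: le_trans L2 _; rewrite exprMn; apply: ler_wpM2r; first exact: ltW.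
  by rewrite ler_pXn2r// ?nnegrE; move: K0 t0 t1; clear; lra.
have X2 : X ^+ 2 <= 9 * s ^+ 2.
  have -> : 9 * s ^+ 2 = (3 * s) ^+ 2 by ring.
  by rewrite ler_pXn2r// ?nnegrE; lra.
have d2 : d ^+ 2 <= (K + 1) ^+ 2 * s ^+ 2.
  by rewrite -exprMn ler_pXn2r// ?nnegrE//; apply: le_trans dK.
have E1 : eta * t * (X ^+ 2 + tau * d ^+ 2) <= eta * (9 + (K + 1) ^+ 2) * s ^+ 2.
  rewrite -!mulrA ler_wpM2l//.
  have a1 : X ^+ 2 + tau * d ^+ 2 <= (9 + (K + 1) ^+ 2) * s ^+ 2.
    have : tau * d ^+ 2 <= d ^+ 2 by rewrite ler_piMl// sqr_ge0.
    by lra.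
  have a2 : 0 <= X ^+ 2 + tau * d ^+ 2 by rewrite addr_ge0 ?mulr_ge0 ?sqr_ge0// ltW.
  apply: le_trans a1; rewrite ler_piMl//; lra.
have E2 : (1 - t) * (2 * e1 * s ^+ 2) <= 2 * e1 * s ^+ 2.
  by rewrite ler_piMl ?mulr_ge0 ?(ltW s2)//; move: t0 e10 s0; clear; lra.
have E3 : (2 * e1 + eta * (9 + (K + 1) ^+ 2)) * s ^+ 2 <= t * tau / 2 * s ^+ 2.
  by rewrite ler_wpM2r// ltW.
have E4 : tau ^+ 2 * L ^+ 2 <= t * tau / 4 * s ^+ 2.
  apply: (@le_trans _ _ (tau ^+ 2 * ((K + 1) ^+ 2 * s ^+ 2))).
    by rewrite ler_wpM2l// sqr_ge0.
  have -> : tau ^+ 2 * ((K + 1) ^+ 2 * s ^+ 2) = tau * (tau * (K + 1) ^+ 2) * s ^+ 2 by ring.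
  rewrite tauK; lra.
have E5 : t * tau * (1 - tau) * L ^+ 2 <= t * tau * (K ^+ 2 + 2 * 8^-1 + t ^+ 2) * s ^+ 2.
  have -> : t * tau * (K ^+ 2 + 2 * 8^-1 + t ^+ 2) * s ^+ 2 = t * tau * ((K + t) * s) ^+ 2.
    by rewrite -tK; ring.
  rewrite -mulrA; apply: ler_wpM2l; first by apply: mulr_ge0; exact: ltW.
  by apply: le_trans L2; rewrite ler_piMl ?sqr_ge0//; move: tau0; clear; lra.
have E6 : (1 - t) * C ^+ 2 >= (1 - t) * (Y ^+ 2 - 2 * e1 * s ^+ 2).
  by rewrite ler_wpM2l//; lra.
have E7 : t * (1 - t) * s ^+ 2 * (1 - (1 - tau) * (1 - t)) - (1 - t) * Y ^+ 2 <=
    t * tau * (1 - t ^+ 2) * s ^+ 2.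
  rewrite -subr_ge0.
  have -> : t * tau * (1 - t ^+ 2) * s ^+ 2 -
    (t * (1 - t) * s ^+ 2 * (1 - (1 - tau) * (1 - t)) - (1 - t) * Y ^+ 2) =
    (t * tau) ^+ 2 * ((1 - t) * s ^+ 2) by rewrite /Y; ring.
  by rewrite mulr_ge0 ?sqr_ge0// mulr_ge0 ?(ltW s2)//; move: t1; clear; lra.
have tt : 0 < t * tau by rewrite mulr_gt0.
have : t * tau * d ^+ 2 <= t * tau * ((K ^+ 2 + 2) * s ^+ 2).
  by move: H E1 E2 E3 E4 E5 E6 E7; clear; lra.
rewrite ler_pM2l// => fin.
rewrite -(@ler_pXn2r _ 2)// ?nnegrE//; last first.
  by rewrite mulr_ge0 ?(ltW s0)// addr_ge0 ?(ltW K0)// invr_ge0 ltW.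
apply: le_trans fin _; rewrite exprMn; apply: ler_wpM2r; first exact: ltW.
have KK : K * K^-1 = 1 by rewrite mulfV// gt_eqF.
by move: KK (sqr_ge0 K^-1); clear; lra.
Qed.

End Apex.

(** * The mean is a critical point to first order *)

(** The lower bound for C = |oc| in the lemma on steep directions: Pah, Pa, Pb,
    Pc are the increments of F at ah, a, b, c; w is the error of semiconcavity.
    At the end of the path from o to a and then to c, the
    increment is at least (1 - tau) t (G - e) s up to w, and at most (G + e) C. *)
Lemma steep_numeric {R : realType} (G e w K t tau s L C Pah Pa Pb Pc e1 : R) :
  0 < G -> 0 <= e -> 0 <= w -> 0 <= t <= 1 -> 0 <= tau <= 1 -> 0 <= s ->
  G * e1 = 3 * e + w * (K + 2) ->
  (G - e) * s <= Pah -> t * Pah <= Pa + w * s ->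
  (1 - tau) * Pa + tau * Pb <= Pc + w * L -> 0 <= Pb -> Pc <= (G + e) * C ->
  C <= 2 * s -> L <= (K + 1) * s ->
  (1 - tau) * t * s - e1 * s <= C.
Proof.
move=> G0 e0 w0 /andP[t0 t1] /andP[u0 u1] s0 e1G h1 h2 h3 h4 h5 h6 h7.
rewrite -(ler_pM2l G0).
have -> : G * ((1 - tau) * t * s - e1 * s) =
  (1 - tau) * t * (G * s) - (G * e1) * s by ring.
rewrite e1G.
have v0 : 0 <= 1 - tau by rewrite subr_ge0.
have k1 : (1 - tau) * (t * ((G - e) * s)) <= (1 - tau) * (Pa + w * s).
  by rewrite ler_wpM2l//; apply: le_trans h2; rewrite ler_wpM2l.
have k2 : 0 <= tau * Pb by exact: mulr_ge0.
have k3 : 0 <= tau * (w * s) by rewrite !mulr_ge0.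
have k4 : (1 - tau) * t * (e * s) <= e * s.
  by rewrite ler_piMl ?mulr_ge0// mulr_ile1//; move: u0; clear; lra.
have k5 := ler_wpM2l w0 h7.
have k6 := ler_wpM2l e0 h6.
move: k1 k2 k3 k4 k5 k6 h3 h5; clear; lra.
Qed.

Section MeanIsCritical.
Context {R : realType} {M : completeMetricType R}.
Variable Q : probability (borel M) R.
Hypothesis hQ : finite_second_moments Q.
Hypothesis lM : length_space M.
Variable o : M.
Implicit Types (a b c p q x y z : M) (D : set (borel M)) (r s t eta : R).

Local Notation mom D q := (moment2 Q D q).
Local Notation m1 := (moment1 Q setT o).
Local Notation phi q := (mom setT q - mom setT o).

Lemma moment1_ge0 D : 0 <= moment1 Q D o.
Proof. by apply: Rintegral_ge0 => y _; exact: mdist_ge0. Qed.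

Lemma moment1_le D : measurable D -> moment1 Q D o <= m1.
Proof.
move=> mD; rewrite /moment1 (_ : setT = D `|` ~` D); last by rewrite setUv.
rewrite Rintegral_setU//; last 3 first.
- exact: measurableC.
- by rewrite setUv; exact: integrable_mdist.
- by apply/disj_setPCl.
by rewrite lerDl; apply: Rintegral_ge0 => y _; exact: mdist_ge0.
Qed.

(** It holds over every measurable set, with the same error; this permits to
    treat a set of points and its complement separately. *)
Lemma moment2_semiconcave D r eta a b t c : measurable D ->
  0 < eta <= 1 -> 0 < r <= 1 -> 0 <= t <= 1 ->
  mdist o a < eta * r / 16 -> mdist o b < eta * r / 16 -> mdist o c <= 1 ->
  hinge_point o r eta a b t c ->
  (1 - t) * mom D a + t * mom D b <=
  mom D c + 9 * eta * mdist a b * (2 + m1).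
Proof.
move=> mD e01 r01 t01 oa ob oc hc.
have eL : 0 <= 9 * eta * mdist a b.
  by rewrite !mulr_ge0 ?mdist_ge0//; case/andP: e01 => /ltW.
have := @moment_ineq _ _ Q hQ D a b c o (- (1 - t)) (- t) 1
   (9 * eta * mdist a b) (2 * (9 * eta * mdist a b)) mD.
move=> H; have {}/H : forall y : M, D y -> 0 <= - (1 - t) * mdist a y ^+ 2 +
    - t * mdist b y ^+ 2 + 1 * mdist c y ^+ 2 + 9 * eta * mdist a b * mdist o y
    + 2 * (9 * eta * mdist a b).
  move=> y _.
  have := hinge_semiconcave y lM e01 r01 t01 oa ob hc.
  have cy : mdist c y <= 1 + mdist o y.
    by have := metric_triangle c o y; rewrite (metric_sym c o); lra.
  have := ler_wpM2l eL cy; lra.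
have := ler_wpM2l eL (moment1_le mD).
have := ler_wpM2l eL (mass_le1 Q mD); have := moment1_ge0 D; lra.
Qed.

(** A first bound on the rate of growth of F at o. *)
Lemma phi_lipschitz q : phi q <= mdist o q * (2 * m1 + mdist o q).
Proof.
have := @moment_ineq _ _ Q hQ setT q o o o (-1) 1 0 (2 * mdist o q) (mdist o q ^+ 2)
   measurableT.
rewrite mass_setT => H; suff /H : forall y : M, [set: borel M] y -> 0 <= - 1 * mdist q y ^+ 2 +
    1 * mdist o y ^+ 2 + 0 * mdist o y ^+ 2 + 2 * mdist o q * mdist o y + mdist o q ^+ 2.
  by lra.
move=> y _; have := metric_triangle q o y; rewrite (metric_sym q o) => h.
have : mdist q y ^+ 2 <= (mdist o q + mdist o y) ^+ 2.
  by rewrite ler_pXn2r// ?nnegrE ?addr_ge0 ?mdist_ge0.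
lra.
Qed.

Hypothesis hmin : frechet_mean Q o.

Lemma phi_ge0 q : 0 <= phi q.
Proof. by rewrite subr_ge0; exact: frechet_mean_moment2. Qed.

Hypothesis hinges : forall eta, 0 < eta <= 1 ->
  exists2 r, 0 < r & hinge_ball o r eta.

Local Ltac slra := clear -hQ lM hmin hinges; lra.

(** If F grows at almost the maximal rate G > 0 towards ah, then the angle at o
    between ah and any b is at most about pi / 2: by semiconcavity, F grows at
    least at the rate G along the path o, a, c of [apex_bound], as F >= F(o) at
    b. So c cannot be closer to o than a is, up to small errors, and
    [apex_far] applies. *)
Lemma steep_direction_far (G K : R) : 0 < G -> 1 <= K ->
  (forall e, 0 < e -> exists2 r, 0 < r & forall q, mdist o q < r ->
     phi q <= (G + e) * mdist o q) ->
  exists e r, [/\ 0 < e, e <= G / 4, 0 < r &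
    forall ah, 0 < mdist o ah < r -> (G - e) * mdist o ah <= phi ah ->
    forall b, mdist o b = K * mdist o ah ->
      mdist ah b <= (K + K^-1) * mdist o ah].
Proof.
move=> G0 K1 up.
have K0 : 0 < K by lra.
pose t := (8 * K)^-1; pose tau := t / (4 * (K + 1) ^+ 2).
have t0 : 0 < t by rewrite invr_gt0; lra.
have t1 : t <= 1 by rewrite invf_le1; lra.
have K2 : 1 <= (K + 1) ^+ 2 by rewrite exprn_ege1; lra.
have tau0 : 0 < tau by rewrite divr_gt0// mulr_gt0; lra.
have tau1 : tau <= 1.
  by rewrite ler_pdivrMr ?mul1r; lra.
pose B := 2 + m1; have B0 : 0 < B by rewrite /B; have := moment1_ge0 setT; lra.
pose k0 := t * tau / 2; have k00 : 0 < k0 by rewrite divr_gt0// mulr_gt0.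
pose e := Num.min (G / 4) (G * k0 / 24).
have e0 : 0 < e by rewrite lt_min !divr_gt0// mulr_gt0.
have eG : e <= G / 4 by rewrite ge_min lexx.
have ek : 24 * e <= G * k0.
  have : e <= G * k0 / 24 by rewrite ge_min lexx orbT.
  lra.
pose den := 18 * B * (K + 2) + G * (9 + (K + 1) ^+ 2).
have d1 : 0 <= 18 * B * (K + 2) by rewrite !mulr_ge0//; lra.
have d2 : 0 < G * (9 + (K + 1) ^+ 2) by rewrite mulr_gt0//; lra.
have den0 : 0 < den by rewrite /den; lra.
pose eta := Num.min 1 (G * k0 / 4 / den).
have eta0 : 0 < eta by rewrite lt_min ltr01 !divr_gt0// mulr_gt0.
have eta1 : eta <= 1 by rewrite ge_min lexx.
have etak : eta * den <= G * k0 / 4.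
  by rewrite -ler_pdivlMr// ge_min lexx orbT.
have [r0 r00 hb0] := hinges (introT andP (conj eta0 eta1)).
pose r := Num.min r0 1.
have r_gt0 : 0 < r by rewrite lt_min r00 ltr01.
have r1 : r <= 1 by rewrite ge_min lexx orbT.
have hb : hinge_ball o r eta by apply: hinge_ball_le hb0; rewrite ge_min lexx.
have [ru ru0 upe] := up e e0.
pose rr := Num.min ru (eta * r / 16) / (K + 3).
have er : 0 < eta * r / 16 by rewrite divr_gt0// mulr_gt0.
have rr0 : 0 < rr by rewrite divr_gt0 ?lt_min ?ru0//; lra.
exists e, rr; split => // ah /andP[s0 sr] steep b ob.
set s := mdist o ah in s0 sr steep ob *.
have sK : (K + 3) * s < Num.min ru (eta * r / 16) by rewrite mulrC -ltr_pdivlMr//; lra.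
move: sK; rewrite lt_min => /andP[sK1 sK2].
have etar : eta * r / 16 <= r / 16 by rewrite ler_pM2r// ler_piMl// ltW.
have Ks : s <= K * s by rewrite ler_peMl// ltW.
have oo : mdist o o < eta * r / 16 by rewrite mdistxx.
have oah : mdist o ah < eta * r / 16 by rewrite -/s; move: sK2 Ks s0; slra.
have obr : mdist o b < eta * r / 16 by rewrite ob; move: sK2 s0; slra.
have t01 : 0 <= t <= 1 by rewrite t1 ltW.
have tau01 : 0 <= tau <= 1 by rewrite tau1 ltW.
have inr x : mdist o x < eta * r / 16 -> mdist o x < r.
  by move: etar r_gt0; slra.
(* the turning path: from o towards ah, then from a towards b *)
have [a ha] := hb o ah (inr _ oo) (inr _ oah) t t01.
have oa : mdist o a = t * s by case: ha.
have ts : t * s <= s by rewrite ler_piMl// ltW.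
have oar : mdist o a < eta * r / 16 by rewrite oa; exact: le_lt_trans oah.
have [c hc] := hb a b (inr _ oar) (inr _ obr) tau tau01.
set L := mdist a b.
have L0 : 0 <= L by exact: mdist_ge0.
have LK : L <= (K + t) * s.
  by have := metric_triangle a o b; rewrite (metric_sym a o) oa ob -/L; slra.
have ac : mdist a c = tau * L by case: hc.
have tauK : tau * (K + 1) <= 1.
  have K4 : 0 < 4 * (K + 1) ^+ 2 by move: K2; slra.
  rewrite /tau mulrAC ler_pdivrMr// mul1r.
  have Kp : 0 <= K + 1 by move: K0; slra.
  have : t * (K + 1) <= K + 1 by rewrite ler_piMl.
  have : K + 1 <= (K + 1) ^+ 2 by rewrite expr2; apply: ler_peMr => //; move: K0; slra.
  by move: K0; slra.
have LK1 : L <= (K + 1) * s.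
  by apply: le_trans LK _; rewrite ler_pM2r// lerD2l.
have tL : tau * L <= s.
  apply: (@le_trans _ _ (tau * ((K + 1) * s))); first by rewrite ler_pM2l.
  by rewrite mulrA; apply: ler_piMl => //; exact: ltW.
have oc : mdist o c <= 2 * s.
  by have := metric_triangle o a c; rewrite oa ac; move: ts tL; slra.
have ocr : mdist o c < eta * r / 16 by move: oc sK2 Ks s0; slra.
have e01 : 0 < eta <= 1 by rewrite eta0.
have r01 : 0 < r <= 1 by rewrite r_gt0.
have oa1 : mdist o a <= 1 by move: oar etar r1; slra.
have oc1 : mdist o c <= 1 by move: ocr etar r1; slra.
have c1 := moment2_semiconcave measurableT e01 r01 t01 oo oah oa1 ha.
have c2 := moment2_semiconcave measurableT e01 r01 tau01 oar obr oc1 hc.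
rewrite -/B -/s -/L in c1 c2.
have pb := phi_ge0 b.
have pc : phi c <= (G + e) * mdist o c.
  by apply: upe; move: sK1 oc K1 s0 Ks; slra.
pose e1 := (3 * e + 9 * eta * B * (K + 2)) / G.
have e1G : G * e1 = 3 * e + 9 * eta * B * (K + 2) by rewrite /e1 mulrC mulfVK// gt_eqF.
have eB : 0 <= 9 * eta * B by rewrite !mulr_ge0// ltW.
have e10 : 0 <= e1.
  apply: divr_ge0; last exact: ltW.
  apply: addr_ge0; first by rewrite mulr_ge0// ltW.
  by apply: mulr_ge0 => //; move: K0; slra.
have Cl : (1 - tau) * t * s - e1 * s <= mdist o c.
  apply: (steep_numeric (w := 9 * eta * B) (e := e) (K := K) (L := L)
    (Pah := phi ah) (Pa := phi a) (Pb := phi b) (Pc := phi c) G0 (ltW e0) eB t01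
    tau01 (ltW s0) e1G steep _ _ pb pc oc LK1).
    by move: c1; slra.
  by move: c2; slra.
have small : 2 * e1 + eta * (9 + (K + 1) ^+ 2) <= t * tau / 2.
  rewrite -(ler_pM2l G0) mulrDr mulrCA e1G -/k0.
  by move: etak ek (mulr_gt0 G0 k00); rewrite /den; slra.
have X3 : 0 <= mdist c ah <= 3 * s.
  rewrite mdist_ge0/=; have := metric_triangle c o ah; rewrite (metric_sym c o) -/s.
  by move: oc; slra.
have dK : 0 <= mdist ah b <= (K + 1) * s.
  rewrite mdist_ge0/=; have := metric_triangle ah o b; rewrite (metric_sym ah o) -/s ob.
  by slra.
apply: (apex_far K1 (erefl t) (erefl tau) s0 (ltW eta0) e10 small L0 LK
  (mdist_ge0 o c) Cl X3 dK).
by apply: apex_bound ha hc (inr _ ocr) (inr _ oah); rewrite ltW.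
Qed.

(** If y is farther than K s from o, then some b with |ob| = K s is almost
    between o and y, and |ah b| <= (K + K^-1) s gives
    |ah y| <= |oy| + K^-1 s. For closer y a quadratic error suffices. *)
Lemma phi_le_of_far (K : R) ah : 1 <= K ->
  (forall b, mdist o b = K * mdist o ah ->
     mdist ah b <= (K + K^-1) * mdist o ah) ->
  phi ah <= 2 * K^-1 * mdist o ah * m1 + (2 * K + 1) * mdist o ah ^+ 2.
Proof.
move=> K1 far; set s := mdist o ah.
have K0 : 0 < K by lra.
have s0 : 0 <= s := mdist_ge0 _ _.
have V0 : 0 < K^-1 by rewrite invr_gt0.
have V1 : K^-1 <= 1 by rewrite invf_le1.
have ssV : K^-1 * s <= s by rewrite ler_piMl.
have := @moment_ineq _ _ Q hQ setT ah o o o (-1) 1 0 (2 * K^-1 * s)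
  ((2 * K + 1) * s ^+ 2) measurableT.
rewrite mass_setT => H; suff /H : forall y : M, [set: borel M] y -> 0 <= - 1 * mdist ah y ^+ 2 +
    1 * mdist o y ^+ 2 + 0 * mdist o y ^+ 2 + 2 * K^-1 * s * mdist o y + (2 * K + 1) * s ^+ 2.
  by lra.
move=> y _; set y0 := mdist o y; set ya := mdist ah y.
have y00 : 0 <= y0 := mdist_ge0 _ _; have ya0 : 0 <= ya := mdist_ge0 _ _.
have sy : 0 <= K^-1 * s * y0 by rewrite !mulr_ge0// ltW.
have s2 : 0 <= K * s ^+ 2 by apply: mulr_ge0; [exact: ltW|exact: sqr_ge0].
have [Ks|Ks] := leP (K * s) y0; last first.
  have h : ya <= s + y0 by have := metric_triangle ah o y; rewrite (metric_sym ah o).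
  have h2 : ya ^+ 2 <= (s + y0) ^+ 2 by rewrite ler_pXn2r// ?nnegrE addr_ge0.
  have h3 : s * y0 <= s * (K * s) by rewrite ler_wpM2l// ltW.
  lra.
have h : ya <= y0 + K^-1 * s.
  apply/ler_addgt0Pr => del del0.
  have [|b ob by_] := @length_space_point _ _ o y (K * s) del lM _ del0.
    by rewrite Ks mulr_ge0// ltW.
  have := far b ob; rewrite -/s mulrDl => h1.
  have := metric_triangle ah b y; rewrite -/ya; rewrite -/y0 in by_; lra.
have Vs0 : 0 <= K^-1 * s by rewrite mulr_ge0// ltW.
have h2 : ya ^+ 2 <= (y0 + K^-1 * s) ^+ 2.
  by rewrite ler_pXn2r// nnegrE addr_ge0.
have h3 : (K^-1 * s) ^+ 2 <= s ^+ 2 by rewrite ler_pXn2r// nnegrE.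
by move: h2 h3 s2; slra.
Qed.

(** Let G be the infimum of the rates at which F grows at most near o. If
    G > 0, then by the two preceding lemmas, with K large compared with
    m1 / G, F grows at a rate of at most G / 2 in the steep directions, so that
    G - d is still a bound on the rates for some d > 0. *)
Lemma mean_is_critical e : 0 < e ->
  exists2 r, 0 < r & forall q, mdist o q < r -> phi q <= e * mdist o q.
Proof.
pose A := [set g : R | 0 <= g /\ exists2 r, 0 < r &
  forall q, mdist o q < r -> phi q <= g * mdist o q].
have m10 : 0 <= m1 by exact: moment1_ge0.
have A0 : A (2 * m1 + 1).
  split; first lra; exists 1 => // q q1; apply: le_trans (phi_lipschitz q) _.
  rewrite mulrC ler_wpM2r ?mdist_ge0//; lra.
have Alb : has_inf A by split; [exists (2 * m1 + 1)|exists 0 => g []].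
have G0 : 0 <= inf A by apply: lb_le_inf; [exists (2 * m1 + 1)|move=> g []].
have up d : 0 < d -> exists2 r, 0 < r & forall q, mdist o q < r ->
     phi q <= (inf A + d) * mdist o q.
  move=> d0; have [g [g0 [r r0 hr]] gd] := inf_adherent d0 Alb.
  exists r => // q qr; apply: le_trans (hr q qr) _.
  by rewrite ler_wpM2r ?mdist_ge0// ltW.
have [G00|GN0] := eqVneq (inf A) 0.
  by move=> e0; have [r r0 hr] := up e e0; exists r => // q /hr; rewrite G00 add0r.
have Gp : 0 < inf A by rewrite lt_neqAle eq_sym GN0.
pose G := inf A; pose K := Num.max 1 (8 * m1 / G).
have K1 : 1 <= K by rewrite le_max lexx.
have K0 : 0 < K by lra.
have Km : 2 * K^-1 * m1 <= G / 4.
  rewrite mulrAC ler_pdivrMr//.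
  have : 8 * m1 / G <= K by rewrite le_max lexx orbT.
  by rewrite ler_pdivrMr//; lra.
have [d [r1 [d0 dG r10 far]]] := steep_direction_far Gp K1 up.
pose r2 := Num.min r1 (G / (8 * (2 * K + 1))).
have K3 : 0 < 8 * (2 * K + 1) by lra.
suff : A (G - d).
  by move/(ge_inf Alb.2) => h; exfalso; move: h; rewrite -/G; lra.
split; first by rewrite -/G in dG; lra.
exists r2; first by rewrite lt_min r10 divr_gt0.
move=> q; rewrite lt_min => /andP[q1]; rewrite ltr_pdivlMr// => q2.
have [q0|qN0] := eqVneq (mdist o q) 0.
  by rewrite q0 -(mdist_positivity _ _ q0) subrr mulr0.
have qp : 0 < mdist o q by rewrite lt_neqAle eq_sym qN0 mdist_ge0.
rewrite leNgt; apply/negP => /ltW steep.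
have fq := far q (introT andP (conj qp q1)) steep.
have := le_trans steep (phi_le_of_far K1 fq).
have h1 := ler_wpM2r (ltW qp) Km.
have h2 := ler_wpM2r (ltW qp) (ltW q2).
have h3 := ler_wpM2r (ltW qp) dG.
have h4 : 0 < G * mdist o q by rewrite mulr_gt0.
rewrite -/G in h3 *; lra.
Qed.

End MeanIsCritical.

(** * Two directions shared by a set of positive mass *)

Section TwoDirections.
Context {R : realType} {M : completeMetricType R}.
Implicit Types (a b c o p q x y z : M) (r s t eta : R).

(** With |ob|, |ob'| at most about s and c about as far from o as if b and b'
    were the same point, the bound of [apex_bound] on d = |bb'| contradicts
    d >= k s. Here B, C, X, L are |ob|, |oc|, |cb|, |ab'|. The flat bound on d^2
    is t tau d^2 <= (4 t^2 tau + 9 tau^2) s^2 up to multiples of zeta and eta,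
    and the choices of t, tau, zeta and eta make the four terms at most
    1/4, 1/4, 1/8 and 1/8 of t tau k^2 s^2. *)
Lemma apex_near (k t tau zeta s L C X B d eta : R) :
  0 < k <= 1 -> t = k ^+ 2 / 16 -> tau = t * k ^+ 2 / 36 ->
  zeta = t * tau * k ^+ 2 / 184 -> 34 * eta <= t * tau * k ^+ 2 / 8 ->
  0 <= eta -> 0 < s -> 0 <= L -> L <= (1 + t) * ((1 + zeta) * s) ->
  0 <= B -> B <= (1 + zeta) * s -> 0 <= C ->
  ((1 - tau) * t + tau - 4 * zeta) * s <= C ->
  0 <= X <= 5 * s -> k * s <= d -> d <= 3 * s ->
  (1 - t) * C ^+ 2 + t * tau * d ^+ 2 <=
  tau ^+ 2 * L ^+ 2 + t * tau * (1 - tau) * L ^+ 2 +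
  t * (1 - t) * B ^+ 2 * (1 - (1 - tau) * (1 - t)) +
  eta * t * (X ^+ 2 + tau * d ^+ 2) -> False.
Proof.
move=> /andP[k0 k1] tE tauE zE etaE eta0 s0 L0 LL B0 BB C0 CC /andP[X0 X5] kd d3 H.
have k2 : 0 < k ^+ 2 by rewrite exprn_gt0.
have k21 : k ^+ 2 <= 1 by rewrite expr_le1// ltW.
have t0 : 0 < t by rewrite tE; lra.
have t1 : t <= 1 / 16 by rewrite tE; lra.
have tau0 : 0 < tau by rewrite tauE divr_gt0// mulr_gt0.
have tk : t * k ^+ 2 <= t by rewrite ler_piMr// ltW.
have tau1 : tau <= 1 / 36 by rewrite tauE; lra.
have tt0 : 0 < t * tau by rewrite mulr_gt0.
have ttk0 : 0 < t * tau * k ^+ 2 by rewrite mulr_gt0.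
have tt1 : t * tau <= 1 by nra.
have ttk1 : t * tau * k ^+ 2 <= 1 by rewrite mulr_ile1 ?(ltW tt0)// ltW.
have z0 : 0 < zeta by rewrite zE; lra.
have z1 : zeta <= 1 / 184 by rewrite zE; lra.
have s2 : 0 < s ^+ 2 by rewrite exprn_gt0.
have zz : (1 + zeta) ^+ 2 <= 1 + 3 * zeta by nra.
have B2 : B ^+ 2 <= (1 + 3 * zeta) * s ^+ 2.
  apply: (@le_trans _ _ (((1 + zeta) * s) ^+ 2)).
    by rewrite ler_pXn2r// ?nnegrE//; apply: le_trans BB.
  by rewrite exprMn ler_wpM2r// ltW.
have L2 : L ^+ 2 <= ((1 + t) ^+ 2 + 12 * zeta) * s ^+ 2.
  apply: (@le_trans _ _ (((1 + t) * ((1 + zeta) * s)) ^+ 2)).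
    by rewrite ler_pXn2r// ?nnegrE//; apply: le_trans LL.
  rewrite !exprMn mulrA ler_wpM2r ?(ltW s2)//.
  have : (1 + t) ^+ 2 * (1 + zeta) ^+ 2 <= (1 + t) ^+ 2 * (1 + 3 * zeta).
    by rewrite ler_wpM2l// sqr_ge0.
  have : (1 + t) ^+ 2 <= 4 by nra.
  by nra.
have L9 : L ^+ 2 <= 9 * s ^+ 2.
  apply: le_trans L2 _; rewrite ler_wpM2r ?(ltW s2)//; nra.
have d2 : (k ^+ 2) * s ^+ 2 <= d ^+ 2.
  rewrite -exprMn ler_pXn2r// ?nnegrE ?mulr_ge0 ?ltW//.
  exact: lt_le_trans (mulr_gt0 k0 s0) kd.
have d0 : 0 <= d by apply: le_trans kd; rewrite mulr_ge0// ltW.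
have d9 : d ^+ 2 <= 9 * s ^+ 2.
  have -> : 9 * s ^+ 2 = (3 * s) ^+ 2 by ring.
  by rewrite ler_pXn2r// ?nnegrE; lra.
have X25 : X ^+ 2 <= 25 * s ^+ 2.
  have -> : 25 * s ^+ 2 = (5 * s) ^+ 2 by ring.
  by rewrite ler_pXn2r// ?nnegrE; lra.
set Y := (1 - tau) * t + tau in CC.
have Y0 : 0 <= Y by rewrite /Y; nra.
have Y1 : Y <= 1 by rewrite /Y; nra.
have zY : 0 <= zeta * (1 - Y) by rewrite mulr_ge0 ?subr_ge0// ltW.
have YY : Y * Y <= Y by rewrite ler_piMr.
have C2 : (Y ^+ 2 - 8 * zeta) * s ^+ 2 <= C ^+ 2.
  have [h1|h1] := leP (4 * zeta) Y.
    have : ((Y - 4 * zeta) * s) ^+ 2 <= C ^+ 2.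
      by rewrite ler_pXn2r// ?nnegrE// mulr_ge0 ?(ltW s0)// subr_ge0.
    rewrite exprMn; apply: le_trans; rewrite ler_wpM2r ?(ltW s2)//.
    by move: zY (sqr_ge0 zeta); clear; lra.
  apply: le_trans (sqr_ge0 C); rewrite mulr_le0_ge0 ?(ltW s2)//.
  by move: h1 YY z0; clear; lra.
have E1 : (1 - t) * ((Y ^+ 2 - 8 * zeta) * s ^+ 2) <= (1 - t) * C ^+ 2.
  by rewrite ler_wpM2l//; move: t1; clear; lra.
have E2 : t * tau * (k ^+ 2 * s ^+ 2) <= t * tau * d ^+ 2 by rewrite ler_pM2l.
have E3 : tau ^+ 2 * L ^+ 2 <= tau ^+ 2 * (9 * s ^+ 2) by rewrite ler_wpM2l// sqr_ge0.
have E4 : t * tau * (1 - tau) * L ^+ 2 <=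
    t * tau * (((1 + t) ^+ 2 + 12 * zeta) * s ^+ 2).
  rewrite -mulrA ler_pM2l//; apply: le_trans L2.
  by rewrite ler_piMl ?sqr_ge0//; move: tau0; clear; lra.
have W0 : 0 <= t * (1 - t) * (1 - (1 - tau) * (1 - t)).
  have ttt : 0 <= 1 - t by move: t1; clear; lra.
  have uuu : 0 <= 1 - tau <= 1 by move: tau0 tau1; clear; lra.
  apply: mulr_ge0; first exact: mulr_ge0 (ltW t0) ttt.
  by rewrite subr_ge0; case/andP: uuu => ? ?; apply: mulr_ile1 => //; move: t0; clear; lra.
have E5 := ler_wpM2l W0 B2.
have E6 : eta * t * (X ^+ 2 + tau * d ^+ 2) <= 34 * eta * s ^+ 2.
  have h1 : tau * d ^+ 2 <= d ^+ 2 by rewrite ler_piMl ?sqr_ge0//; move: tau1; clear; lra.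
  have h2 : 0 <= X ^+ 2 + tau * d ^+ 2.
    by apply: addr_ge0; rewrite ?sqr_ge0//; apply: mulr_ge0; rewrite ?sqr_ge0// ltW.
  have h3 : eta * (t * (X ^+ 2 + tau * d ^+ 2)) <= eta * (34 * s ^+ 2).
    apply: ler_wpM2l => //; apply: (@le_trans _ _ (X ^+ 2 + tau * d ^+ 2)); last by move: h1 X25 d9; clear; lra.
    by rewrite ler_piMl//; move: t1; clear; lra.
  by move: h3; clear; lra.
have {}H : (1 - t) * (Y ^+ 2 - 8 * zeta) + t * tau * k ^+ 2 <=
    tau ^+ 2 * 9 + t * tau * ((1 + t) ^+ 2 + 12 * zeta) +
    t * (1 - t) * (1 - (1 - tau) * (1 - t)) * (1 + 3 * zeta) + 34 * eta.
  rewrite -(ler_pM2r s2).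
  by move: H E1 E2 E3 E4 E5 E6; clear; lra.
have {}H : t * tau * k ^+ 2 <= 4 * t * (t * tau) + 9 * tau ^+ 2 + 23 * zeta + 34 * eta.
  have f1 : 0 <= (1 - t) * (tau * (1 - t)) ^+ 2.
    by apply: mulr_ge0; [move: t1; clear; lra|exact: sqr_ge0].
  have f2 : t * tau * zeta <= zeta by rewrite ler_piMl// ltW.
  have f3 : t * (1 - t) * (1 - (1 - tau) * (1 - t)) <= 1.
    have p1 : 0 <= tau * (1 - t) by apply: mulr_ge0; [exact: ltW|move: t1; clear; lra].
    have p2 : tau * (1 - t) <= tau by move: (mulr_ge0 (ltW tau0) (ltW t0)); clear; lra.
    have p3 : 0 <= t * (1 - t) by apply: mulr_ge0; [exact: ltW|move: t1; clear; lra].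
    have p4 : t * (1 - t) <= t by move: (sqr_ge0 t); clear; lra.
    apply: mulr_ile1 => //.
    - by move: p1 t0; clear; lra.
    - by move: p4 t1; clear; lra.
    - by move: p2 t1 tau1; clear; lra.
  have f4 : t * (1 - t) * (1 - (1 - tau) * (1 - t)) * (3 * zeta) <= 3 * zeta.
    by rewrite ler_piMl//; move: z0; clear; lra.
  have f5 : 0 <= t * zeta by rewrite mulr_ge0 ?(ltW t0)// ltW.
  move: H f1 f2 f4 f5; rewrite /Y; clear; lra.
have g1 : 4 * t * (t * tau) = t * tau * k ^+ 2 / 4 by rewrite [X in 4 * X * _]tE; field.
have g2 : 9 * tau ^+ 2 = t * tau * k ^+ 2 / 4.
  by rewrite expr2 [X in 9 * (X * _)]tauE; field.
by move: H etaE ttk0; rewrite g1 g2 zE; clear; lra.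
Qed.
End TwoDirections.

(** The lower bound for C = |oc| in the lemma on two directions: m and n stand
    for the second moments over D and over its complement, at o, a, b' (named b
    here) and c, and W for the first moment over D. Moving towards a and b'
    decreases m at the rate 2 W, so n increases at that rate by minimality, at c
    by semiconcavity, and m can only decrease by 2 C W. *)
Lemma two_directions_numeric {R : realType}
  (W t tau zeta s u u' C L e w rb mo ma mb mc no na nb nc : R) :
  0 < rb -> rb <= W -> 0 <= tau <= 1 -> 0 < s -> 0 <= zeta ->
  0 <= u <= s -> 0 <= u' <= s -> 0 <= e -> 0 <= w -> C <= 3 * s -> L <= 3 * s ->
  2 * s + 3 * e + 3 * w <= 2 * rb * zeta ->
  ma <= mo - 2 * u * W + u ^+ 2 -> mb <= mo - 2 * u' * W + u' ^+ 2 ->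
  mo - 2 * C * W <= mc ->
  (1 - tau) * na + tau * nb <= nc + w * L ->
  mo + no <= ma + na -> mo + no <= mb + nb -> mc + nc <= mo + no + e * C ->
  (1 - tau) * u + tau * u' - zeta * s <= C.
Proof.
move=> rb0 rbW /andP[t0 t1] s0 z0 /andP[u0 us] /andP[u'0 u's] e0 w0 Cs Ls sm.
move=> ha hb hc hsc pa pb pc.
have W0 : 0 < 2 * W by move: rb0 rbW; clear; lra.
rewrite -(ler_pM2l W0).
have v0 : 0 <= 1 - tau by rewrite subr_ge0.
have k1 : (1 - tau) * (2 * u * W - u ^+ 2 + no) <= (1 - tau) * na.
  by rewrite ler_wpM2l//; move: ha pa; clear; lra.
have k2 : tau * (2 * u' * W - u' ^+ 2 + no) <= tau * nb.
  by rewrite ler_wpM2l//; move: hb pb; clear; lra.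
have u2 : u ^+ 2 <= s ^+ 2 by rewrite ler_pXn2r// nnegrE ltW.
have u'2 : u' ^+ 2 <= s ^+ 2 by rewrite ler_pXn2r// nnegrE ltW.
have k3 : (1 - tau) * u ^+ 2 + tau * u' ^+ 2 <= s ^+ 2.
  have := ler_wpM2l v0 u2; have := ler_wpM2l t0 u'2; clear; lra.
have k4 := ler_wpM2l e0 Cs.
have k5 := ler_wpM2l w0 Ls.
have k6 := ler_wpM2l (ltW s0) sm.
have k7 : rb * (zeta * s) <= W * (zeta * s) by rewrite ler_wpM2r// mulr_ge0// ltW.
have k8 : 0 <= s ^+ 2 by exact: sqr_ge0.
move: k1 k2 k3 k4 k5 k6 k7 k8 hc hsc pc; clear; lra.
Qed.

Section TwoDirectionsMass.
Context {R : realType} {M : completeMetricType R}.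
Variable Q : probability (borel M) R.
Hypothesis hQ : finite_second_moments Q.
Hypothesis lM : length_space M.
Variable o : M.
Hypothesis hmin : frechet_mean Q o.
Hypothesis hinges : forall eta : R, 0 < eta <= 1 ->
  exists2 r : R, 0 < r & hinge_ball o r eta.
Implicit Types (a b c p q x y z : M) (D : set (borel M)) (r s t eta : R).

Local Notation mom D q := (moment2 Q D q).
Local Notation m1 := (moment1 Q setT o).
Local Ltac slra := clear -hQ lM hmin hinges; lra.

Lemma moment2_toward D a (u : R) : measurable D -> 0 <= u ->
  (forall y, D y -> mdist a y <= mdist o y - u) ->
  mom D a <= mom D o - 2 * u * moment1 Q D o + u ^+ 2.
Proof.
move=> mD u0 h.
have := @moment_ineq _ _ Q hQ D a o o o (-1) 1 0 (- (2 * u)) (u ^+ 2) mD.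
move=> H; have {}/H : forall y : M, D y -> 0 <= - 1 * mdist a y ^+ 2 +
    1 * mdist o y ^+ 2 + 0 * mdist o y ^+ 2 + - (2 * u) * mdist o y + u ^+ 2.
  move=> y /h hy; have a0 := mdist_ge0 a y.
  have : mdist a y ^+ 2 <= (mdist o y - u) ^+ 2.
    by rewrite ler_pXn2r// nnegrE; exact: le_trans hy.
  by slra.
have := ler_wpM2l (sqr_ge0 u) (mass_le1 Q mD); slra.
Qed.

Lemma moment2_away D c : measurable D ->
  mom D o - 2 * mdist o c * moment1 Q D o <= mom D c.
Proof.
move=> mD.
have := @moment_ineq _ _ Q hQ D c o o o 1 (-1) 0 (2 * mdist o c) 0 mD.
move=> H; have {}/H : forall y : M, D y -> 0 <= 1 * mdist c y ^+ 2 +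
    - 1 * mdist o y ^+ 2 + 0 * mdist o y ^+ 2 + 2 * mdist o c * mdist o y + 0.
  move=> y _; have := metric_triangle o c y.
  set C := mdist o c; set Y := mdist o y; set Z := mdist c y.
  have C0 : 0 <= C := mdist_ge0 _ _; have Y0 : 0 <= Y := mdist_ge0 _ _.
  have Z0 : 0 <= Z := mdist_ge0 _ _; move=> h.
  have [CY|CY] := leP C Y.
    have : (Y - C) ^+ 2 <= Z ^+ 2.
      rewrite ler_pXn2r// ?nnegrE; first by move: h; slra.
      by move: CY; slra.
    by have := sqr_ge0 C; slra.
  have : Y * Y <= C * Y by rewrite ler_wpM2r// ltW.
  by have := mulr_ge0 C0 Y0; have := sqr_ge0 Z; slra.
slra.
Qed.

(** Bounds the rate 2 W from below by the mass of D. *)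
Lemma moment1_mass D rho : measurable D -> (forall y : M, D y -> rho <= mdist o y) ->
  rho * mass Q D <= moment1 Q D o.
Proof.
move=> mD h.
have := @moment_ineq _ _ Q hQ D o o o o 0 0 0 1 (- rho) mD.
move=> H; have {}/H : forall y : M, D y -> 0 <= 0 * mdist o y ^+ 2 +
    0 * mdist o y ^+ 2 + 0 * mdist o y ^+ 2 + 1 * mdist o y + - rho.
  by move=> y /h; slra.
slra.
Qed.

(** The separation k fixes the tolerance zeta, before the bounds rho and beta
    on the distance and the mass of D are known; the scale s0 depends on all of
    them. The order matters: a net has to be chosen with mesh proportional to
    zeta, and beta is then divided by the number of its pairs. *)
Lemma mass_two_directions (k : R) : 0 < k <= 1 ->
  exists zeta : R, 0 < zeta <= 1 / 4 /\ forall rho beta : R, 0 < rho -> 0 < beta ->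
  exists2 s0 : R, 0 < s0 & forall s b b' D, 0 < s < s0 ->
    mdist o b <= (1 + zeta) * s -> mdist o b' <= (1 + zeta) * s ->
    k * s <= mdist b b' -> measurable D ->
    (forall y, D y -> [/\ rho <= mdist o y, mdist b y <= mdist o y - s + zeta * s &
       mdist b' y <= mdist o y - s + zeta * s]) ->
    mass Q D < beta.
Proof.
move=> /[dup] k01 /andP[k0 k1].
pose t := k ^+ 2 / 16; pose tau := t * k ^+ 2 / 36; pose zeta := t * tau * k ^+ 2 / 184.
have k2 : 0 < k ^+ 2 by rewrite exprn_gt0.
have k21 : k ^+ 2 <= 1 by rewrite expr_le1// ltW.
have t0 : 0 < t by rewrite /t; move: k2; slra.
have t1 : t <= 1 / 16 by rewrite /t; move: k21; slra.
have tau0 : 0 < tau by rewrite divr_gt0// mulr_gt0.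
have tk : t * k ^+ 2 <= t by rewrite ler_piMr// ltW.
have tau1 : tau <= 1 / 36 by rewrite /tau; move: tk t1; slra.
have ttk0 : 0 < t * tau * k ^+ 2 by rewrite !mulr_gt0.
have z0 : 0 < zeta by rewrite divr_gt0 ?ltr0n.
have zt : zeta <= t / 184.
  have h1 : t * tau <= t * 1 by rewrite ler_pM2l//; move: tau1; slra.
  have h2 : t * tau * k ^+ 2 <= t * tau by rewrite ler_piMr// mulr_ge0// ltW.
  by rewrite /zeta; move: h1 h2; slra.
have z1 : zeta <= 1 / 184 by move: zt t1; slra.
exists zeta; split; first by rewrite z0; move: z1; slra.
move=> rho beta rho0 beta0.
have m10 : 0 <= m1 by exact: moment1_ge0.
pose B := 2 + m1; have B0 : 0 < B by rewrite /B; move: m10; slra.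
pose rb := rho * beta; have rb0 : 0 < rb by exact: mulr_gt0.
have rbz0 : 0 < rb * zeta by exact: mulr_gt0.
pose e := 2 * rb * zeta / 9.
have e0 : 0 < e by rewrite /e; move: rbz0; slra.
pose eta := Num.min 1 (Num.min (t * tau * k ^+ 2 / 272) (2 * rb * zeta / (81 * B))).
have B81 : 0 < 81 * B by move: B0; slra.
have eta0 : 0 < eta.
  rewrite !lt_min ltr01 andTb; apply/andP; split; first by rewrite divr_gt0 ?ltr0n.
  by apply: divr_gt0 => //; move: rbz0; slra.
have eta1 : eta <= 1 by rewrite ge_min lexx.
have eta2 : 34 * eta <= t * tau * k ^+ 2 / 8.
  have : eta <= t * tau * k ^+ 2 / 272 by rewrite !ge_min lexx !orbT.
  by slra.
have eta3 : 81 * (eta * B) <= 2 * rb * zeta.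
  have : eta <= 2 * rb * zeta / (81 * B) by rewrite !ge_min lexx !orbT.
  by rewrite ler_pdivlMr//; slra.
have [r0 r00 hb0] := hinges (introT andP (conj eta0 eta1)).
pose r := Num.min r0 1.
have r_gt0 : 0 < r by rewrite lt_min r00 ltr01.
have r1 : r <= 1 by rewrite ge_min lexx orbT.
have hb : hinge_ball o r eta by apply: hinge_ball_le hb0; rewrite ge_min lexx.
have [re re0 crit] := mean_is_critical hQ lM hmin hinges e0.
have er : 0 < eta * r / 16 by rewrite divr_gt0// mulr_gt0.
have etar : eta * r / 16 <= r / 16 by rewrite ler_pM2r// ler_piMl// ltW.
pose s0 := Num.min (Num.min re (eta * r / 16)) (rb * zeta / 3) / 4.
have s00 : 0 < s0 by rewrite divr_gt0// !lt_min re0 er divr_gt0.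
exists s0 => // s b b' D /andP[s_gt0 ss0] ob ob' bb' mD hD.
have : 4 * s < Num.min (Num.min re (eta * r / 16)) (rb * zeta / 3).
  by move: ss0; rewrite /s0; slra.
rewrite !lt_min => /andP[/andP[s1 s2] s3].
rewrite ltNge; apply/negP => massD.
have zs : zeta * s <= t / 184 * s by rewrite ler_pM2r.
have ts : t * s <= s / 16 by move: (ler_wpM2r (ltW s_gt0) t1); slra.
have zs0 : 0 < zeta * s by exact: mulr_gt0.
have ts0 : 0 < t * s by exact: mulr_gt0.
have inr x : mdist o x < eta * r / 16 -> mdist o x < r.
  by move: etar r_gt0; slra.
have oo : mdist o o < eta * r / 16 by rewrite mdistxx.
have obr : mdist o b < eta * r / 16 by move: ob s2 zs ts s_gt0; slra.
have obr' : mdist o b' < eta * r / 16 by move: ob' s2 zs ts s_gt0; slra.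
have t01 : 0 <= t <= 1 by rewrite ltW//=; move: t1; slra.
have tau01 : 0 <= tau <= 1 by rewrite ltW//=; move: tau1; slra.
have [a ha] := hb o b (inr _ oo) (inr _ obr) t t01.
have oa : mdist o a = t * mdist o b by case: ha.
have ab : mdist a b = (1 - t) * mdist o b by case: ha.
have b0 : 0 <= mdist o b := mdist_ge0 _ _.
have oab : mdist o a <= mdist o b by rewrite oa ler_piMl//; case/andP: t01.
have oar : mdist o a < eta * r / 16 := le_lt_trans oab obr.
have [c hc] := hb a b' (inr _ oar) (inr _ obr') tau tau01.
set L := mdist a b'; have L0 : 0 <= L := mdist_ge0 _ _.
have LL : L <= (1 + t) * ((1 + zeta) * s).
  have := metric_triangle a o b'; rewrite (metric_sym a o) oa -/L.
  have := ler_wpM2l (ltW t0) ob; move: ob'; slra.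
have L3 : L <= 3 * s.
  apply: le_trans LL _.
  have : (1 + t) * ((1 + zeta) * s) <= 2 * ((1 + zeta) * s).
    apply: ler_wpM2r; first by move: zs0 s_gt0; slra.
    by move: t1; slra.
  by move: zs ts s_gt0; slra.
have ac : mdist a c = tau * L by case: hc.
have tL : tau * L <= L by rewrite ler_piMl//; case/andP: tau01.
have oc : mdist o c <= 3 * s.
  have := metric_triangle o a c; rewrite ac oa.
  have := ler_wpM2l (ltW t0) ob; have := ler_wpM2r L0 tau1.
  by move: zs ts zs0 s_gt0 L3 (ler_wpM2r (ltW zs0) t1); slra.
have ocr : mdist o c < eta * r / 16 by move: oc s2 s_gt0; slra.
have oa1 : mdist o a <= 1 by move: oar etar r1; slra.
have oc1 : mdist o c <= 1 by move: ocr etar r1; slra.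
have e01 : 0 < eta <= 1 by rewrite eta0.
have r01 : 0 < r <= 1 by rewrite r_gt0.
pose W := moment1 Q D o.
have rbW : rb <= W.
  apply: le_trans (@moment1_mass D rho mD _); last by move=> y /hD[].
  by rewrite /rb ler_pM2l.
pose u := (t - 2 * zeta) * s; pose u' := (1 - zeta) * s.
have u01 : 0 <= u <= s.
  by rewrite /u; apply/andP; split; move: zs zs0 ts ts0 s_gt0; slra.
have u'01 : 0 <= u' <= s.
  by rewrite /u'; apply/andP; split; move: zs zs0 ts ts0 s_gt0; slra.
have mDC : measurable (~` D) by exact: measurableC.
have C1 : mom D a <= mom D o - 2 * u * W + u ^+ 2.
  apply: moment2_toward => //; first by case/andP: u01.
  move=> y /hD[_ hy _]; have := metric_triangle a b y; rewrite ab.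
  have t1' : 0 <= 1 - t by move: t1; slra.
  have := ler_wpM2l t1' ob; move: hy; rewrite /u.
  by move: (mulr_gt0 t0 zs0); slra.
have C2 : mom D b' <= mom D o - 2 * u' * W + u' ^+ 2.
  apply: moment2_toward => //; first by case/andP: u'01.
  by move=> y /hD[_ _ hy]; move: hy; rewrite /u'; slra.
have C3 := moment2_away c mD.
have C4 := moment2_semiconcave hQ lM mDC e01 r01 tau01 oar obr' oc1 hc.
rewrite -/B -/L in C4.
have C5 : mom D o + mom (~` D) o <= mom D a + mom (~` D) a.
  by rewrite -!moment2_setC//; exact: frechet_mean_moment2.
have C6 : mom D o + mom (~` D) o <= mom D b' + mom (~` D) b'.
  by rewrite -!moment2_setC//; exact: frechet_mean_moment2.
have C7 : mom D c + mom (~` D) c <= mom D o + mom (~` D) o + e * mdist o c.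
  rewrite -!moment2_setC// addrC -lerBlDr; apply: crit.
  by move: oc s1 s_gt0; slra.
have w0 : 0 <= 9 * eta * B by rewrite !mulr_ge0// ltW.
have sm : 2 * s + 3 * e + 3 * (9 * eta * B) <= 2 * rb * zeta.
  by move: s3 eta3 rbz0; rewrite /e; slra.
have C4' : (1 - tau) * mom (~` D) a + tau * mom (~` D) b' <= mom (~` D) c + 9 * eta * B * L.
  by move: C4; slra.
have Cl := two_directions_numeric t rb0 rbW tau01 s_gt0 (ltW z0) u01 u'01 (ltW e0)
  w0 oc L3 sm C1 C2 C3 C4' C5 C6 C7.
have Cl' : ((1 - tau) * t + tau - 4 * zeta) * s <= mdist o c.
  apply: le_trans Cl; rewrite /u /u'.
  by move: zs0 (mulr_gt0 tau0 zs0); slra.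
have X5 : 0 <= mdist c b <= 5 * s.
  rewrite mdist_ge0/=; have := metric_triangle c o b; rewrite (metric_sym c o).
  by move: oc ob zs ts s_gt0; slra.
have bb3 : mdist b b' <= 3 * s.
  have := metric_triangle b o b'; rewrite (metric_sym b o).
  by move: ob ob' zs ts s_gt0; slra.
apply: (apex_near k01 (erefl t) (erefl tau) (erefl zeta) eta2 (ltW eta0) s_gt0
  L0 LL b0 ob (mdist_ge0 o c) Cl' X5 bb' bb3).
by apply: apex_bound ha hc (inr _ ocr) (inr _ obr); exact: ltW.
Qed.

End TwoDirectionsMass.

(** * Packing bounds from finite Hausdorff dimension *)

Section Digits.
Context {R : realType}.
Variable N : nat.
Hypothesis N1 : (1 < N)%N.
Implicit Types y z : R.

(** For y in [0, 1), the n-th residue is the fractional part of N^n y, and the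
    digits are those of the expansion of y in base N. *)
Fixpoint residue y n : R :=
  if n is m.+1 then N%:R * residue y m - (Num.truncn (N%:R * residue y m))%:R else y.

Definition digit y n := Num.truncn (N%:R * residue y n).

Lemma residue_itv y n : 0 <= y < 1 -> 0 <= residue y n < 1.
Proof.
move=> y01; case: n => //= n.
have [h|h] := leP 0 (N%:R * residue y n).
  by have /andP[h1] := truncn_itv h; rewrite -natr1 => h2; apply/andP; split; lra.
exfalso; move: h; rewrite ltNge => /negP; apply; apply: mulr_ge0 => //.
elim: n => [|n /=]; first by case/andP: y01.
by move=> h; have /andP[h1 _] := truncn_itv (mulr_ge0 (ler0n R N) h); lra.
Qed.

Lemma digit_lt y n : 0 <= y < 1 -> (digit y n < N)%N.
Proof.
move=> /(residue_itv n)/andP[h1 h2]; rewrite truncn_lt_nat ?mulr_ge0//.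
by rewrite -[ltRHS]mulr1 ltr_pM2l// ltr0n; case: N N1.
Qed.

Lemma residue_agree y z n : (forall j, (j < n)%N -> digit y j = digit z j) ->
  residue y n - residue z n = N%:R ^+ n * (y - z).
Proof.
elim: n => [|n IH] h /=; first by rewrite expr0 mul1r.
have := h n (ltnSn n); rewrite /digit => ->.
have {}IH := IH (fun j jn => h j (ltnW jn)).
by rewrite exprS -mulrA -IH; ring.
Qed.

(** Two numbers whose first n digits agree differ by at most N^-n, by
    [residue_agree]; so distinct numbers have a first different digit. *)
Lemma digits_first_diff y z : 0 <= y < 1 -> 0 <= z < 1 -> y != z ->
  exists n, [/\ forall j, (j < n)%N -> digit y j = digit z j,
    digit y n != digit z n & `|y - z| <= N%:R^-1 ^+ n].
Proof.
move=> y01 z01 yz.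
have N0 : 0 < N%:R :> R by rewrite ltr0n; case: N N1.
have bnd n : (forall j, (j < n)%N -> digit y j = digit z j) -> `|y - z| <= N%:R^-1 ^+ n.
  move=> /residue_agree h.
  have /andP[y1 y2] := residue_itv n y01; have /andP[z1 z2] := residue_itv n z01.
  rewrite exprVn -div1r ler_pdivlMr ?exprn_gt0// mulrC.
  have -> : N%:R ^+ n * `|y - z| = `|N%:R ^+ n * (y - z)|.
    by rewrite normrM [X in _ = X * _]ger0_norm// exprn_ge0// ltW.
  rewrite -h ler_norml.
  apply/andP; split; lra.
have ex : exists n, digit y n != digit z n.
  apply: contrapT => /forallNP H.
  have all n : `|y - z| <= N%:R^-1 ^+ n.
    by apply: bnd => j _; apply/eqP/negPn/negP/H.
  have d0 : 0 < `|y - z| by rewrite normr_gt0 subr_eq0.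
  have := all (Num.truncn (`|y - z|^-1)).+1; apply/negP; rewrite -ltNge.
  set k := Num.truncn _.
  have /andP[_ hk] : k%:R <= `|y - z|^-1 < k.+1%:R by apply: truncn_itv; rewrite invr_ge0.
  rewrite exprVn -[ltRHS]invrK ltf_pV2 ?posrE ?exprn_gt0 ?invr_gt0//.
  by apply: lt_trans hk _; rewrite -natrX ltr_nat ltn_expl.
exists (ex_minn ex); case: ex_minnP => n dn min.
have agree j : (j < n)%N -> digit y j = digit z j.
  move=> jn; apply/eqP; apply: contraT => /min; by rewrite leqNgt jn.
by split => //; exact: bnd.
Qed.

End Digits.

Section HolderCover.
Context {R : realType} {M : metricType R}.

(** The hypothesis says that the inverse of x is Hoelder continuous with
    exponent D. Then a cover of M by sets E i induces a cover of [0, 1) by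
    intervals of half-length C (diameter (E i))^D, so that the sum of these is
    bounded below by Lebesgue measure. *)
Lemma hausdorff_measure_gt0 (D C : R) (x : R -> M) : 0 < D -> 0 < C ->
  (forall y z, 0 <= y < 1 -> 0 <= z < 1 -> `|y - z| <= C * mdist (x y) (x z) `^ D) ->
  (0 < hausdorff_measure D [set: M])%E.
Proof.
move=> D0 C0 hx; rewrite ltNge; apply/negP => H.
pose eps : R := (4 * C)^-1; have eps0 : 0 < eps by rewrite invr_gt0 mulr_gt0.
have : (hausdorff_content D 1 [set: M] < eps%:E)%E.
  apply: (@le_lt_trans _ _ 0%E); last by rewrite lte_fin.
  by apply: le_trans H; apply: ereal_sup_ubound; exists 1 => //=.
move=> /ereal_inf_lt[_ [E [cov dE] <-] sE].
have dfin i : exists2 r : R, 0 <= r & diameter (E i) = r%:E.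
  have := dE i; have : (0 <= diameter (E i))%E by rewrite /diameter le_max lexx.
  by case: (diameter (E i)) => [r| |] //=; rewrite ?lee_fin; exists r.
pose r i := sval (cid2 (dfin i)).
have r0 i : 0 <= r i by rewrite /r; case: cid2.
have rE i : diameter (E i) = (r i)%:E by rewrite /r; case: cid2.
have dist i p q : E i p -> E i q -> mdist p q <= r i.
  move=> ip iq; rewrite -lee_fin -rE /diameter le_max; apply/orP; right.
  by apply: ereal_sup_ubound; exists (p, q).
pose A i := [set y : R | 0 <= y < 1 /\ E i (x y)].
pose l i := C * r i `^ D.
have l0 i : 0 <= l i by rewrite mulr_ge0 ?powR_ge0// ltW.
(* if E i contains no point of the image, xget returns 0, which is harmless *)
pose J i : set R := [set` `[xget 0 (A i) - l i, xget 0 (A i) + l i]].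
have covJ : (`[0, 1[%classic : set R) `<=` \bigcup_i J i.
  move=> y /=; rewrite in_itv/= => y01.
  have [i _ iy] := cov (x y) I; exists i => //=.
  have Ay : A i y by split.
  have [g01 gE] := xgetPex 0 (ex_intro _ y Ay).
  set g := xget 0 (A i) in g01 gE *.
  have := hx y g y01 g01.
  have : C * mdist (x y) (x g) `^ D <= l i.
    rewrite ler_pM2l//; apply: ge0_ler_powR; rewrite ?nnegrE ?mdist_ge0 ?(ltW D0)//.
    exact: dist.
  rewrite /J /= -/g in_itv/= ler_norml => h1 /andP[h2 h3]; apply/andP; split; lra.
have mJ i : measurable (J i) by exact: measurable_itv.
have m01 : lebesgue_measure (`[0, 1[%classic : set R) = 1%E.
  by rewrite lebesgue_measure_itv/= lte_fin ltr01 oppr0 adde0.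
have : (1 <= \sum_(0 <= i <oo) lebesgue_measure (J i))%E.
  by rewrite -m01; exact: measure_sigma_subadditive.
apply/negP; rewrite -ltNge.
apply: (@le_lt_trans _ _ (\sum_(0 <= i <oo) ((2 * C)%:E * (diameter (E i) `^ D)))%E).
  apply: lee_nneseries => // i _; rewrite lebesgue_measure_itv/=.
  rewrite rE poweR_EFin -EFinM; case: ifPn => _; last first.
    by rewrite lee_fin mulr_ge0 ?powR_ge0// mulr_ge0// ltW.
  by rewrite -EFinB lee_fin /l; lra.
rewrite nneseriesZl; last by move=> i _; exact: poweR_ge0.
apply: (@lt_le_trans _ _ ((2 * C)%:E * eps%:E)%E).
  by rewrite lte_pmul2l// lte_fin mulr_gt0.
rewrite -EFinM lee_fin /eps.
have -> : 2 * C * (4 * C)^-1 = 1 / 2 by field; rewrite gt_eqF.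
lra.
Qed.

End HolderCover.

Section Packing.
Context {R : realType} {M : completeMetricType R}.
Implicit Types (o x : M).

Lemma hausdorff_dim_measure0 : (hausdorff_dim [set: M] < +oo)%E ->
  exists2 D : R, 0 < D & hausdorff_measure D [set: M] = 0%E.
Proof. by move=> /ereal_inf_lt[_ [D [D0 HD] <-] _]; exists D. Qed.

(** Given N points f i in the ball of radius s around o, separated by k s, a tree
    is built as follows: a node of level n has a child for each i, reached by
    moving from it towards f i in the ratio lam n. All nodes move towards the
    same points, and only the ratio shrinks, so that the hinge inequality of a
    single ball applies at all levels. *)
Section Cantor.
Variables (o : M) (r s k : R) (N : nat) (f : nat -> M).
Hypotheses (k01 : 0 < k <= 1) (s0 : 0 < s) (sr : 2 * s < r) (N1 : (1 < N)%N).
Hypothesis hb : hinge_ball o r (1 / 2).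
Hypothesis fs : forall i, (i < N)%N -> mdist o (f i) < s.
Hypothesis fk : forall i j, (i < N)%N -> (j < N)%N -> i != j -> k * s <= mdist (f i) (f j).

(* Children of a node of level n are separated by lam n * k s / 2, that is by
   2 q^(n + 1) s, while all descendants of a child stay within q^(n + 1) s / 2
   of it: this is how lam and q are chosen. *)
Let q := k / 32.
Let lam n : R := q ^+ n / 8.

Let child x l i : M := xget o [set m | hinge_point o r (1 / 2) x (f i) l m].

Fixpoint cantor_node (y : R) n : M :=
  if n is m.+1 then child (cantor_node y m) (lam m) (digit N y m) else o.

Let q01 : 0 < q <= 1 / 32.
Proof. by case/andP: k01 => ? ?; rewrite /q; apply/andP; split; lra. Qed.

Let qn01 n : 0 < q ^+ n <= 1.
Proof.
have /andP[q0 q1] := q01.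
by rewrite exprn_gt0//= exprn_ile1 ?(ltW q0)//; lra.
Qed.

Lemma cantor_node_step (y : R) n : 0 <= y < 1 -> mdist o (cantor_node y n) <= s ->
  hinge_point o r (1 / 2) (cantor_node y n) (f (digit N y n)) (lam n)
    (cantor_node y n.+1).
Proof.
move=> y01 ys; rewrite /= /child.
have di := digit_lt N1 n y01.
have := hb (a := cantor_node y n) (c := f (digit N y n)).
have srr : s < r by move: s0 sr; lra.
move=> /(_ (le_lt_trans ys srr) (lt_trans (fs di) srr) (lam n)).
have /andP[h1 h2] := qn01 n.
case=> [|m hm]; first by rewrite /lam; apply/andP; split; lra.
by apply: (xgetPex o (P := [set m | hinge_point o r _ _ _ _ m])); exists m.
Qed.

(** Both bounds are proved together: being near o is needed to move further, and
    the total displacement is a telescoping sum. *)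
Lemma cantor_node_bound (y : R) n : 0 <= y < 1 ->
  mdist o (cantor_node y n) <= s * (1 - q ^+ n) / 2 /\
  mdist (cantor_node y n) (cantor_node y n.+1) <= s * (q ^+ n - q ^+ n.+1) / 2.
Proof.
have s0' := s0; have sr' := sr.
move=> y01.
have step m : mdist o (cantor_node y m) <= s * (1 - q ^+ m) / 2 ->
    mdist (cantor_node y m) (cantor_node y m.+1) <= s * (q ^+ m - q ^+ m.+1) / 2.
  move=> h; have /andP[q0 q1] := qn01 m; have /andP[p0 p1] := q01.
  have sq : 0 < s * q ^+ m by rewrite mulr_gt0.
  have hs : mdist o (cantor_node y m) <= s by lra.
  have [-> _ _] := cantor_node_step y01 hs.
  have hf := fs (digit_lt N1 m y01).
  have := metric_triangle (cantor_node y m) o (f (digit N y m)).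
  rewrite (metric_sym _ o) => h2.
  have h3 : mdist (cantor_node y m) (f (digit N y m)) <= 2 * s by lra.
  apply: (@le_trans _ _ (lam m * (2 * s))).
    by rewrite ler_wpM2l// /lam; lra.
  have : s * q ^+ m * q <= s * q ^+ m * (1 / 32) by rewrite ler_pM2l.
  by rewrite /lam exprS; lra.
elim: n => [|n [IH1 IH2]].
  have h0 : mdist o (cantor_node y 0) <= s * (1 - q ^+ 0) / 2.
    by rewrite /= mdistxx expr0 subrr mulr0 mul0r.
  by split => //; exact: step.
have h : mdist o (cantor_node y n.+1) <= s * (1 - q ^+ n.+1) / 2.
  by have := metric_triangle o (cantor_node y n) (cantor_node y n.+1); lra.
by split => //; exact: step.
Qed.

Lemma cantor_node_cauchy (y : R) n m : 0 <= y < 1 -> (n <= m)%N ->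
  mdist (cantor_node y n) (cantor_node y m) <= s * q ^+ n / 2.
Proof.
have s0' := s0; have sr' := sr.
move=> y01 nm.
suff : mdist (cantor_node y n) (cantor_node y m) <= s * (q ^+ n - q ^+ m) / 2.
  have /andP[h _] := qn01 m; have := mulr_gt0 s0 h; lra.
rewrite -(subnKC nm); elim: (m - n)%N => [|j IH].
  by rewrite addn0 mdistxx subrr mulr0 mul0r.
rewrite addnS.
have [_] := cantor_node_bound (n + j) y01.
have := metric_triangle (cantor_node y n) (cantor_node y (n + j)) (cantor_node y (n + j).+1).
lra.
Qed.

Lemma cantor_point_ex (y : R) : exists x, 0 <= y < 1 ->
  forall n, mdist (cantor_node y n) x <= s * q ^+ n / 2.
Proof.
have s0' := s0; have sr' := sr.
have [y01|] := pselect (0 <= y < 1); last by exists o.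
have [n m nm|eps e0|x hx] := @cauchy_limit_rate _ _ (cantor_node y) (fun n => s * q ^+ n / 2).
- exact: cantor_node_cauchy.
- have [|n hn] := @expr_small _ q (eps / s) _ (divr_gt0 e0 s0).
    by have /andP[? ?] := q01; apply/andP; split; lra.
  by exists n; move: hn; rewrite ltr_pdivlMr//; have /andP[h _] := qn01 n; have := mulr_gt0 s0 h; lra.
- by exists x.
Qed.

Definition cantor_point (y : R) : M := sval (cid (cantor_point_ex y)).

Lemma cantor_point_sep (y z : R) : 0 <= y < 1 -> 0 <= z < 1 -> y != z ->
  exists n, q ^+ n.+1 * s <= mdist (cantor_point y) (cantor_point z) /\
    `|y - z| <= N%:R^-1 ^+ n.
Proof.
have s0' := s0; have sr' := sr.
move=> y01 z01 yz; have [n [agree dn yzn]] := digits_first_diff N1 y01 z01 yz.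
exists n; split => //.
have hy := svalP (cid (cantor_point_ex y)) y01 n.+1.
have hz := svalP (cid (cantor_point_ex z)) z01 n.+1.
rewrite -/(cantor_point y) -/(cantor_point z) in hy hz.
have same m : (m <= n)%N -> cantor_node y m = cantor_node z m.
  by elim: m => //= m IH mn; rewrite (IH (ltnW mn)) agree.
have [by_ _] := cantor_node_bound n y01.
have /andP[q0 q1] := qn01 n; have /andP[p0 p1] := q01.
have bs : mdist o (cantor_node y n) <= s.
  by have := mulr_gt0 s0 q0; lra.
have sy := cantor_node_step y01 bs.
have bz := bs; rewrite same// in bz.
have sz := cantor_node_step z01 bz; rewrite -(same n)// in sz.
have half : 0 <= (1 / 2 : R) <= 1 by apply/andP; split; lra.
have lam01 : 0 <= lam n <= 1 by rewrite /lam; apply/andP; split; lra.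
have fz := fs (digit_lt N1 n z01).
have [b2 _] := cantor_node_bound n.+1 y01.
have /andP[q0' q1'] := qn01 n.+1.
have c1 : mdist o (f (digit N z n)) < r by lra.
have c2 : mdist o (cantor_node y n.+1) < r by have := mulr_gt0 s0 q0'; lra.
have := hinge_contraction half lam01 c1 c2 sy sz.
have kf := fk (digit_lt N1 n y01) (digit_lt N1 n z01) dn.
have : (1 - 1 / 2) * lam n * (k * s) <= (1 - 1 / 2) * lam n * mdist (f (digit N y n)) (f (digit N z n)).
  by rewrite ler_wpM2l// /lam; lra.
have := metric_triangle (cantor_node y n.+1) (cantor_point y) (cantor_node z n.+1).
have := metric_triangle (cantor_point y) (cantor_point z) (cantor_node z n.+1).
rewrite (metric_sym (cantor_point z)).
have e1 : q ^+ n.+1 = q ^+ n * (k / 32) by rewrite exprSr.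
rewrite e1 in hy hz *; rewrite /lam; move: hy hz; clear; lra.
Qed.

End Cantor.

(** If N >= q^-D, the limit points of the tree, indexed by expansions in base N,
    are separated by q^(n + 1) s whenever the indices differ by at most N^-n,
    hence the index is Hoelder continuous with exponent D as a function of the
    point. So H^D = 0 bounds N, independently of s. *)
Lemma packing o (r D k : R) : 0 < D -> hausdorff_measure D [set: M] = 0%E ->
  hinge_ball o r (1 / 2) -> 0 < k <= 1 ->
  exists N : nat, forall (s : R) (f : nat -> M), 0 < s -> 2 * s < r ->
    (forall i, (i < N)%N -> mdist o (f i) < s) ->
    exists i j, [/\ (i < N)%N, (j < N)%N, i != j & mdist (f i) (f j) < k * s].
Proof.
move=> D0 HD hb k01; pose q := k / 32.
have /andP[k0 k1] := k01.
have q0 : 0 < q by rewrite /q; lra.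
pose N := (Num.truncn ((q `^ D)^-1)).+2; exists N => s f s0 sr fs.
apply: contrapT => H.
have N1 : (1 < N)%N by [].
have fk i j : (i < N)%N -> (j < N)%N -> i != j -> k * s <= mdist (f i) (f j).
  by move=> iN jN ij; rewrite leNgt; apply/negP => h; apply: H; exists i, j.
have qs : 0 < (q * s)^-1 by rewrite invr_gt0 mulr_gt0.
pose x := cantor_point k01 s0 sr N1 hb fs.
suff : (0 < hausdorff_measure D [set: M])%E by rewrite HD ltxx.
apply: (@hausdorff_measure_gt0 _ _ D ((q * s)^-1 `^ D) x D0 (powR_gt0 _ qs)).
move=> y z y01 z01; have [->|yz] := eqVneq y z.
  by rewrite subrr normr0 mulr_ge0 ?powR_ge0.
have [n [sep yzn]] := cantor_point_sep k01 s0 sr N1 hb fs fk y01 z01 yz.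
apply: le_trans yzn _; rewrite -powRM ?(ltW qs) ?mdist_ge0//.
have NqD : N%:R^-1 <= q `^ D.
  rewrite -[leRHS]invrK lef_pV2 ?posrE ?invr_gt0 ?powR_gt0 ?ltr0n//.
  have V0 : 0 <= (q `^ D)^-1 by rewrite invr_ge0 powR_ge0.
  have /andP[_ /ltW h] := truncn_itv V0.
  by apply: le_trans h _; rewrite ler_nat.
apply: (@le_trans _ _ ((q `^ D) ^+ n)).
  by apply: lerXn2r => //; rewrite nnegrE ?powR_ge0// invr_ge0.
rewrite -powR_mulrn ?powR_ge0// powRAC powR_mulrn ?(ltW q0)//.
apply: ge0_ler_powR; rewrite ?nnegrE ?(ltW D0) ?exprn_ge0 ?(ltW q0) ?mulr_ge0 ?(ltW qs) ?mdist_ge0//.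
rewrite mulrC ler_pdivlMr ?mulr_gt0//.
by rewrite mulrA -exprSr.
Qed.
End Packing.

(** * Almost every point is reached in one direction *)

Section Nets.
Context {R : realType} {M : metricType R}.

(** A maximal e-separated list of points of A is a net. *)
Lemma finite_net (o : M) (A : set M) (e : R) (N : nat) :
  (forall f : nat -> M, (forall i, (i < N)%N -> A (f i)) ->
     exists i j, [/\ (i < N)%N, (j < N)%N, i != j & mdist (f i) (f j) < e]) ->
  exists net : seq M, (size net <= N)%N /\
    forall z, A z -> exists2 w, w \in net & mdist w z < e.
Proof.
move=> HN; apply: contrapT => H.
have sep n : (n <= N)%N -> exists l : seq M, [/\ size l = n,
    forall w, w \in l -> A w & pairwise (fun a b => e <= mdist a b) l].
  elim: n => [_|n IH nN]; first by exists [::].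
  have [l [ln lA lp]] := IH (ltnW nN).
  have [z [Az zl]] : exists z, A z /\ forall w, w \in l -> e <= mdist w z.
    apply: contrapT => H2; apply: H; exists l; split; first by rewrite ln ltnW.
    move=> z Az; apply: contrapT => H3; apply: H2; exists z; split => // w wl.
    by rewrite leNgt; apply/negP => h; apply: H3; exists w.
  exists (z :: l); split; first by rewrite /= ln.
    by move=> w; rewrite inE => /predU1P[->//|/lA].
  rewrite /= lp andbT; apply/allP => w /zl; by rewrite metric_sym.
have [l [lN lA /(pairwiseP o) lp]] := sep N (leqnn N).
have [i iN|i [j [iN jN ij]]] := HN (nth o l).
  by apply: lA; rewrite mem_nth ?lN.
apply/negP; rewrite -leNgt; have [h|h|h] := ltngtP i j.
- by apply: lp => //; rewrite inE /= lN.
- by rewrite metric_sym; apply: lp => //; rewrite inE /= lN.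
- by rewrite h eqxx in ij.
Qed.

End Nets.

Section SmallCovers.
Context d {T : measurableType d} {R : realType} (Q : probability T R).

Lemma cover_seq (I : eqType) (l : seq I) (E : I -> set T) (beta : R) :
  (forall p, p \in l -> measurable (E p) /\ (Q (E p) <= beta%:E)%E) ->
  exists D, [/\ measurable D, forall p, p \in l -> E p `<=` D &
    (Q D <= ((size l)%:R * beta)%:E)%E].
Proof.
elim: l => [|p l IH] H.
  by exists set0; split => //; rewrite measure0 mul0r.
have [q ql|D [mD lD QD]] := IH; first by apply: H; rewrite inE ql orbT.
have [mE QE] := H p (mem_head _ _).
exists (E p `|` D); split.
- exact: measurableU.
- move=> q; rewrite inE => /predU1P[->|/lD qD]; first exact: subsetUl.
  by apply: subset_trans qD _; exact: subsetUr.
- apply: le_trans (measureU2 Q mE mD) _.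
  by rewrite /= -natr1 mulrDl mul1r addrC EFinD leeD.
Qed.

Lemma negligible_small (A : set T) :
  (forall e : R, 0 < e -> exists D, [/\ measurable D, A `<=` D & (Q D <= e%:E)%E]) ->
  Q.-negligible A.
Proof.
move=> H; pose D n := sval (cid (H n.+1%:R^-1 (ltac:(by rewrite invr_gt0)))).
have hD n := svalP (cid (H n.+1%:R^-1 (ltac:(by rewrite invr_gt0)))).
exists (\bigcap_n D n); split.
- by apply: bigcap_measurable => // n _; case: (hD n).
- have mI : measurable (\bigcap_n D n) by apply: bigcap_measurable => // n _; case: (hD n).
  apply/eqP; rewrite -measure_le0; apply/lee_addgt0Pr => e e0; rewrite add0e.
  have [n /(_ n (leqnn n)) hn] := harmonic_small e0.
  have [mD _ QD] := hD n; apply: (@le_trans _ _ (Q (D n))).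
    by apply: le_measure; rewrite ?inE//; exact: bigcap_inf.
  by apply: le_trans QD _; rewrite lee_fin ltW.
- by move=> x Ax n _; have [_ AD _] := hD n; exact: AD.
Qed.

End SmallCovers.

Section AlmostBetween.
Context {R : realType} {M : metricType R}.

(** The points which almost lie at distance s from o on a shortest curve from o
    to y. In a length space there are always such points, whether or not a
    shortest curve exists. *)
Definition almost_between o y s (eps : R) : set M :=
  [set z | mdist o z <= s + eps /\ mdist z y <= mdist o y - s + eps].

End AlmostBetween.

Section Thin.
Context {R : realType} {M : completeMetricType R}.
Variable Q : probability (borel M) R.
Hypothesis hQ : finite_second_moments Q.
Hypothesis lM : length_space M.
Variable o : M.
Hypothesis hmin : frechet_mean Q o.
Hypothesis hinges : forall eta : R, 0 < eta <= 1 ->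
  exists2 r : R, 0 < r & hinge_ball o r eta.
Hypothesis hdim : (hausdorff_dim [set: M] < +oo)%E.
Implicit Types (a b c p q x y z : M) (D : set (borel M)) (r s t eta : R).
Local Ltac slra := clear -hQ lM hmin hinges hdim; lra.

(** The points almost between o and y at distance t from o accumulate at a single
    place. *)
Definition thin o y t := forall e : R, 0 < e -> exists2 delta : R, 0 < delta &
  forall b b', almost_between o y t delta b -> almost_between o y t delta b' ->
    mdist b b' < e.

(** A quantitative failure of thinness, relative to the scale s so that it can be
    transported to smaller scales. *)
Definition forked (k : R) s : set M := [set y | forall delta : R, 0 < delta ->
  exists b b', [/\ almost_between o y s delta b, almost_between o y s delta b' &
    k * s <= mdist b b']].

(** Moving towards o keeps points almost between o and y, and by contraction it
    keeps half of their relative separation. *)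
Lemma forked_shrink (k : R) r s s' : hinge_ball o r (1 / 2) -> 0 < s' <= s ->
  2 * s < r -> forked k s `<=` forked (k / 2) s'.
Proof.
move=> hb /andP[s'0 s's] sr y hy delta d0.
have s0 : 0 < s := lt_le_trans s'0 s's.
pose del := Num.min (delta / 2) s; have del0 : 0 < del by rewrite lt_min s0 divr_gt0.
have del1 : del <= delta / 2 by rewrite ge_min lexx.
have del2 : del <= s by rewrite ge_min lexx orbT.
have [b [b' [[ob by_] [ob' b'y] bb']]] := hy del del0.
pose l := s' / s; have ls : l * s = s' by rewrite /l mulfVK// gt_eqF.
have l0 : 0 <= l by rewrite divr_ge0// ltW.
have l1 : l <= 1 by rewrite ler_pdivrMr// mul1r.
have l01 : 0 <= l <= 1 by rewrite l0.
have oo : mdist o o < r by rewrite mdistxx; move: sr s0; slra.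
have obr : mdist o b < r by move: ob del2 sr; slra.
have obr' : mdist o b' < r by move: ob' del2 sr; slra.
have [m hm] := hb o b oo obr l l01.
have [m' hm'] := hb o b' oo obr' l l01.
have [om mb _] := hm; have [om' mb' _] := hm'.
have half : 0 <= (1 / 2 : R) <= 1 by apply/andP; split; lra.
have omr : mdist o m < r.
  by apply: le_lt_trans obr; rewrite om ler_piMl// mdist_ge0.
have ctr := hinge_contraction half l01 obr' omr hm hm'.
have aux z w : mdist o z <= s + del -> mdist z y <= mdist o y - s + del ->
    mdist o w = l * mdist o z -> mdist w z = (1 - l) * mdist o z ->
    almost_between o y s' delta w.
  move=> oz zy ow wz; have h1 := ler_wpM2l l0 oz.
  have l1' : 0 <= 1 - l by rewrite subr_ge0.
  have h2 := ler_wpM2l l1' oz; have h3 := metric_triangle w z y.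
  have h4 : l * del <= del by rewrite ler_piMl// ltW.
  have h5 : 0 <= l * del by rewrite mulr_ge0// ltW.
  split; first by rewrite ow; move: h1 h4 del1 d0; rewrite mulrDr ls; slra.
  by move: h2 h3 zy h5 del1 ls; rewrite wz; slra.
exists m, m'; split; [exact: aux ob by_ om mb|exact: aux ob' b'y om' mb'|].
apply: le_trans ctr; have := ler_wpM2l l0 bb'.
have -> : l * (k * s) = k * s' by rewrite -ls; ring.
slra.
Qed.

(** A fork at the scale s is also a fork at every smaller scale s', where it can
    be approximated by a pair of points of a net. The number of pairs is bounded
    independently of s' by the packing bound, and the points y beyond a given
    separated pair have mass less than beta once s' is small; so the total mass
    is arbitrarily small. *)
Lemma forked_negligible : exists2 r : R, 0 < r &
  hinge_ball o r (1 / 2) /\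
  forall k rho s, 0 < k <= 1 -> 0 < rho -> 0 < s -> 2 * s < r ->
    Q.-negligible (forked k s `&` [set y | rho <= mdist o y]).
Proof.
have [|r r0 hb] := hinges (eta := 1 / 2); first by apply/andP; split; lra.
exists r => //; split => // k rho s /andP[k0 k1] rho0 s0 sr.
have [D D0 HD] := hausdorff_dim_measure0 hdim.
have [|z [/andP[z0 z1] hz]] := mass_two_directions hQ lM hmin hinges (k := k / 4).
  by apply/andP; split; lra.
(* The mesh z' s' of the net must preserve both the tolerance z and the
   separation, which drops from k / 2 to k / 4. *)
pose z' := Num.min (z / 2) (k / 8).
have z'0 : 0 < z' by rewrite lt_min; apply/andP; split; lra.
have z'z : z' <= z / 2 by rewrite ge_min lexx.
have z'k : z' <= k / 8 by rewrite ge_min lexx orbT.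
have [|N hN] := packing (k := z' / 2) D0 HD hb.
  by apply/andP; split; lra.
apply: negligible_small => e e0.
pose beta := e / (N * N).+1%:R; have beta0 : 0 < beta by rewrite divr_gt0.
have [s1 s10 hs1] := hz rho beta rho0 beta0.
pose s' := Num.min (s1 / 2) (Num.min s (r / 8)).
have s'0 : 0 < s' by rewrite !lt_min s0 !divr_gt0.
have s's1 : s' <= s1 / 2 by rewrite ge_min lexx.
have s's : s' <= s by rewrite !ge_min lexx orbT.
have s'r : s' <= r / 8 by rewrite !ge_min lexx !orbT.
have [net [sn hnet]] : exists net : seq M, (size net <= N)%N /\
    forall w, mdist o w < 2 * s' -> exists2 v, v \in net & mdist v w < z' * s'.
  apply: (@finite_net _ _ o (fun w => mdist o w < 2 * s')) => f hf.
  have [||i [j [iN jN ij fij]]] := hN (2 * s') f _ _ hf; [by lra|by lra|].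
  by exists i, j; split => //; move: fij; congr (_ < _); field.
pose good (p : M * M) := [&& mdist o p.1 <= (1 + z) * s', mdist o p.2 <= (1 + z) * s' &
  k / 4 * s' <= mdist p.1 p.2].
pose E (p : M * M) : set (borel M) := [set y : borel M | [/\ rho <= mdist o (y : M),
  mdist p.1 (y : M) <= mdist o (y : M) - s' + z * s' &
  mdist p.2 (y : M) <= mdist o (y : M) - s' + z * s']].
have mE (pq : M * M) : measurable (E pq).
  have mR : measurable_fun setT (fun y : borel M => mdist o (y : M) - s' + z * s').
    by apply: measurable_funD => //; apply: measurable_funB => //; exact: measurable_mdist.
  have -> : E pq = [set y : borel M | rho <= mdist o (y : M)] `&`
     ([set y : borel M | mdist pq.1 (y : M) <= mdist o (y : M) - s' + z * s'] `&`
      [set y : borel M | mdist pq.2 (y : M) <= mdist o (y : M) - s' + z * s']).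
    by apply/seteqP; split => [y []|y [? []]].
  apply: measurableI; last apply: measurableI.
  - rewrite -[X in measurable X]setTI.
    by apply: measurable_fun_le => //; exact: measurable_mdist.
  - rewrite -[X in measurable X]setTI.
    by apply: measurable_fun_le => //; exact: measurable_mdist.
  - rewrite -[X in measurable X]setTI.
    by apply: measurable_fun_le => //; exact: measurable_mdist.
have [pq|C [mC hC QC]] := @cover_seq _ _ _ Q _
    [seq p <- [seq (v, w) | v <- net, w <- net] | good p] E beta.
  rewrite mem_filter => /andP[/and3P[g1 g2 g3] _]; split; first exact: mE.
  have := hs1 s' pq.1 pq.2 (E pq) _ g1 g2 g3 (mE pq) (fun y h => h).
  rewrite s'0 /= => /(_ ltac:(lra)); rewrite /mass => /ltW h.
  by rewrite -[X in (X <= _)%E]fineK ?lee_fin// fin_num_measure.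
exists C; split => //; last first.
  apply: le_trans QC _; rewrite lee_fin.
  apply: (@le_trans _ _ ((N * N).+1%:R * beta)).
    rewrite ler_pM2r// ler_nat size_filter (leq_trans (count_size _ _))//.
    by rewrite size_allpairs ltnW// ltnS leq_mul.
  by rewrite /beta mulrC mulfVK// pnatr_eq0.
move=> y [fy ry].
have zs : 0 < z * s' by rewrite mulr_gt0.
have s's0 : 0 < s' <= s by rewrite s'0.
have [|b [b' [[ob by_] [ob' b'y] bb']]] :=
  forked_shrink hb s's0 sr fy (delta := z * s' / 2); first by lra.
have z1s : z * s' <= 1 / 4 * s' by rewrite ler_pM2r.
have [|v vn vb] := hnet b; first by move: ob z1s s'0; slra.
have [|v' vn' vb'] := hnet b'; first by move: ob' z1s s'0; slra.
have z's1 : z' * s' <= z / 2 * s' by rewrite ler_pM2r.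
have z's2 : z' * s' <= k / 8 * s' by rewrite ler_pM2r.
apply: (hC (v, v')).
  rewrite mem_filter; apply/andP; split; last by apply/allpairsP; exists (v, v').
  rewrite /good /=; apply/and3P; split.
  - have := metric_triangle o b v; rewrite (metric_sym b v).
    by move: ob vb z's1 zs; slra.
  - have := metric_triangle o b' v'; rewrite (metric_sym b' v').
    by move: ob' vb' z's1 zs; slra.
  - have := metric_triangle b v b'; rewrite (metric_sym b v).
    have := metric_triangle v v' b'.
    by move: bb' vb vb' z's2; slra.
split => //=.
- have := metric_triangle v b y; move: by_ vb z's1; slra.
- have := metric_triangle v' b' y; move: b'y vb' z's1; slra.
Qed.

(** Thinness fails in the countable union over separations, scales and lower
    bounds of R(y), since a fork at t is also a fork at smaller scales, which
    may be taken from a sequence. *)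
Lemma ae_thin : exists2 r : R, 0 < r &
  {ae Q, forall y : M, 0 < mdist o y -> forall t, 0 < t < r -> thin o y t}.
Proof.
have [r r0 [hb hneg]] := forked_negligible.
exists (r / 2); first by rewrite divr_gt0.
pose inv (n : nat) : R := n.+1%:R^-1.
have inv0 n : 0 < inv n by rewrite invr_gt0.
have inv1 n : inv n <= 1 by rewrite invf_le1// ler1n.
have small (e : R) : 0 < e -> exists n, inv n < e.
  by move=> /harmonic_small[n /(_ n (leqnn n))]; exists n.
pose sn n := inv n * (r / 4).
pose bad := \bigcup_j \bigcup_m \bigcup_n
  (forked (inv m) (sn n) `&` [set y : M | inv j <= mdist o y]).
have nbad : Q.-negligible (bad : set (borel M)).
  apply: negligible_bigcup => j; apply: negligible_bigcup => m.
  apply: negligible_bigcup => n.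
  have h : inv n * (r / 4) <= 1 * (r / 4) by rewrite ler_pM2r// divr_gt0.
  apply: hneg; rewrite ?inv0 ?inv1 ?mulr_gt0 ?divr_gt0//; rewrite /sn; lra.
apply: negligibleS nbad => y /= /not_implyP[y0 /existsNP[t /not_implyP[/andP[t0 tr]]]].
move=> /existsNP[e /not_implyP[e0 H]].
have [j hj] := small _ y0.
have [n hn] := small (t / (r / 4)) (divr_gt0 t0 (divr_gt0 r0 (ltr0Sn _ _))).
have [m hm] := small (e / t / 2) (divr_gt0 (divr_gt0 e0 t0) (ltr0Sn _ _)).
exists j => //; exists m => //; exists n => //; split; last exact: ltW.
have fk : forked (e / t) t y.
  move=> delta d0; apply: contrapT => H2; apply: H; exists delta => // b b' hb1 hb2.
  rewrite ltNge; apply/negP => h; apply: H2; exists b, b'; split => //.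
  by rewrite mulfVK// gt_eqF.
have snt : 0 < sn n <= t.
  rewrite mulr_gt0 ?divr_gt0//=; apply: ltW; rewrite /sn -ltr_pdivlMr// divr_gt0//.
have t2 : 2 * t < r by lra.
have := forked_shrink hb snt t2 fk; move=> h delta /h [b [b' [h1 h2 h3]]].
exists b, b'; split => //; apply: le_trans h3.
by rewrite ler_pM2r ?(ltW hm)//; case/andP: snt.
Qed.

End Thin.

(** * Following the direction up to the target *)

Section ThinPoints.
Context {R : realType} {M : completeMetricType R}.
Hypothesis lM : length_space M.
Variables o y : M.
Implicit Types (a b c p q w z : M) (r s t h : R).
Local Notation d0 := (mdist o y).
Local Ltac slra := clear -lM; lra.

(** The last condition is stronger than uniqueness of the point between o and y
    at distance t: it also controls points that are almost between, and these
    exist for every t. *)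
Definition thin_point t z := [/\ mdist o z = t, mdist z y = d0 - t &
  forall e : R, 0 < e -> exists2 delta, 0 < delta &
    forall b, almost_between o y t delta b -> mdist b z < e].

Lemma thin_limit t : 0 <= t <= d0 -> thin o y t -> exists z, thin_point t z.
Proof.
move=> t01 th; have [t0 t1] := andP t01.
have pex n : exists p, mdist o p = t /\ mdist p y <= d0 - t + harmonic n.
  have [|p p1 p2] := @length_space_point _ _ o y t (harmonic n) lM t01; last by exists p.
  exact: harmonic_gt0.
pose p n := sval (cid (pex n)).
have hp n : mdist o (p n) = t /\ mdist (p n) y <= d0 - t + harmonic n.
  exact: svalP (cid (pex n)).
have [|z hz] := cauchy_limit (u := p).
  move=> e e0; have [delta del0 hd] := th e e0.
  have [N hN] := harmonic_small del0; exists N => n Nn.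
  have ab k : (N <= k)%N -> almost_between o y t delta (p k).
    by move=> /hN h; have [h1 h2] := hp k; split; move: h h1 h2 del0; slra.
  by apply: hd; apply: ab.
have oz : mdist o z <= t.
  apply/ler_addgt0Pr => e e0; have [N /(_ N (leqnn N)) h] := hz e e0.
  by have := metric_triangle o (p N) z; rewrite (metric_sym (p N)) (hp N).1; move: h; slra.
have zy : mdist z y <= d0 - t.
  apply/ler_addgt0Pr => e e0; have e20 : 0 < e / 2 by rewrite divr_gt0.
  have [N1 h1] := hz _ e20; have [N2 h2] := harmonic_small e20.
  have := h1 (maxn N1 N2) (leq_maxl _ _); have := h2 (maxn N1 N2) (leq_maxr _ _).
  have [_] := hp (maxn N1 N2); have := metric_triangle z (p (maxn N1 N2)) y; slra.
have tr := metric_triangle o z y.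
exists z; split; [by move: oz zy tr; slra|by move: oz zy tr; slra|].
move=> e /th[delta del0 hd]; exists delta => // b hb; apply: hd => //.
by split; move: oz zy del0; slra.
Qed.

(** A point at distance s from o on an almost shortest path from o to z' is almost
    between o and y, thus close to z. So thin points lie on one shortest
    curve. *)
Lemma thin_point_dist s t z z' : s <= t -> 0 <= s -> thin_point s z -> thin_point t z' ->
  mdist z z' = t - s.
Proof.
move=> st s0 [oz zy hz] [oz' zy' _].
apply/eqP; rewrite eq_le; apply/andP; split; last first.
  by have := metric_triangle o z z'; rewrite oz oz'; slra.
apply/ler_addgt0Pr => e e0; have e20 : 0 < e / 2 by rewrite divr_gt0.
have [del del0 hd] := hz _ e20.
pose de := Num.min del (e / 2).
have de0 : 0 < de by rewrite lt_min del0.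
have de1 : de <= del by rewrite ge_min lexx.
have de2 : de <= e / 2 by rewrite ge_min lexx orbT.
have [|p op pz] := @length_space_point _ _ o z' s de lM _ de0.
  by rewrite s0 oz'.
have : mdist p z < e / 2.
  apply: hd; split; first by rewrite op; move: del0; slra.
  by have := metric_triangle p z' y; rewrite zy' oz' in pz *; move: pz de1; slra.
have := metric_triangle z p z'; rewrite (metric_sym z p); rewrite oz' in pz.
by move: pz de2; slra.
Qed.

Lemma thin_point_unique t z b : thin_point t z -> mdist o b = t ->
  mdist b y = d0 - t -> b = z.
Proof.
move=> [_ _ hz] ob by_; apply: mdist_positivity; apply/eqP.
rewrite eq_le mdist_ge0 andbT; apply/ler_addgt0Pr => e /hz[del del0 hd].
rewrite add0r; apply: ltW; apply: hd; split; rewrite ?ob ?by_; move: del0; slra.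
Qed.

Lemma thin_zero : thin o y 0.
Proof.
move=> e e0; exists (e / 3); first by rewrite divr_gt0.
move=> b b' [ob _] [ob' _]; have := metric_triangle b o b'.
by rewrite (metric_sym b o); move: ob ob' e0; slra.
Qed.

(** Shortest curves do not branch. The points z at level t0 and a at level
    t0 - h lie on the same shortest curve from o, and q, q' are almost between o
    and y at level t > t0, with ep = t - t0. On the shortest curve from a to q,
    the point m at distance about h from a is almost between o and y at level
    t0, hence close to z. So |q'm| is about ep, while |aq'| and |aq| are both
    about h + ep; the hinge inequality for a, q tested at q' then says that
    tau |qq'|^2 / 2 is almost 0. *)
Lemma thin_step w r t t0 h z a : hinge_ball w r (1 / 2) -> 0 < h -> h <= t0 ->
  thin_point t0 z -> mdist o a = t0 - h -> mdist a z = h ->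
  t0 < t <= d0 -> mdist w a < r -> mdist w z < r / 4 -> t - t0 <= r / 4 ->
  thin o y t.
Proof.
move=> hb h0 ht0 [oz zy hz] oa az /andP[tt0 td] wa wz tr e e0.
pose ep := t - t0; have ep0 : 0 < ep by rewrite subr_gt0.
pose tau := h / (h + ep).
have hep0 : 0 < h + ep by exact: addr_gt0.
have tau0 : 0 < tau by rewrite divr_gt0.
have tau1 : tau <= 1 by rewrite ler_pdivrMr// mul1r; move: ep0; slra.
have tauE : tau * (h + ep) = h by rewrite /tau mulfVK// gt_eqF.
have r0 : 0 < r by move: ep0 tr; rewrite /ep; slra.
(* om bounds all errors; om * (ep * c) bounds |qq'|^2 at the end *)
pose c := 1 + 8 / tau; have c0 : 0 < c by rewrite addr_gt0// divr_gt0.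
pose om := Num.min (Num.min ep (r / 4)) (e ^+ 2 / (2 * (ep * c))).
have e2 : 0 < e ^+ 2 by rewrite exprn_gt0.
have epc : 0 < ep * c by rewrite mulr_gt0.
have om0 : 0 < om by rewrite !lt_min ep0 !divr_gt0//= mulr_gt0.
have om1 : om <= ep by rewrite !ge_min lexx.
have om2 : om <= r / 4 by rewrite !ge_min lexx !orbT.
have om3 : om * (ep * c) < e ^+ 2.
  have : om <= e ^+ 2 / (2 * (ep * c)) by rewrite !ge_min lexx !orbT.
  by rewrite ler_pdivlMr ?mulr_gt0//; move: e2; slra.
have om30 : 0 < om / 3 by rewrite divr_gt0.
have [d2 d20 hd2] := hz _ om30.
pose sg := Num.min (d2 / 2) (om / 3).
have sg0 : 0 < sg by rewrite lt_min om30 divr_gt0.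
have sg1 : sg <= d2 / 2 by rewrite ge_min lexx.
have sg2 : sg <= om / 3 by rewrite ge_min lexx orbT.
have [d1 d10 hd1] := hz _ sg0.
pose de := Num.min (Num.min d1 (d2 / 2)) (om / 3) / 3.
have de0 : 0 < de by rewrite divr_gt0// !lt_min d10 om30 divr_gt0.
have de1 : 3 * de <= d1.
  by rewrite mulrC mulfVK// !ge_min lexx.
have de2 : 3 * de <= d2 / 2.
  by rewrite mulrC mulfVK// !ge_min lexx orbT.
have de3 : 3 * de <= om / 3.
  by rewrite mulrC mulfVK// !ge_min lexx orbT.
exists de => // q q' hq hq'.
have near b : almost_between o y t de b ->
    [/\ mdist z b <= ep + 2 * de + sg, mdist a b <= h + ep + 2 * de + sg,
     h + ep - de <= mdist a b & mdist w b < r].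
  move=> [ob by_]; have ob' : t - de <= mdist o b.
    by have := metric_triangle o b y; move: by_; slra.
  have [|p op pb] := @length_space_point _ _ o b t0 de lM _ de0.
    by apply/andP; split; move: ob' om1 de3 h0 ht0 om0; rewrite /ep; slra.
  have py : mdist p y <= d0 - t0 + 3 * de.
    by have := metric_triangle p b y; move: pb ob by_; slra.
  have zp : mdist p z < sg.
    by apply: hd1; split; [rewrite op; move: d10; slra|move: py de1; slra].
  have zb : mdist z b <= ep + 2 * de + sg.
    have := metric_triangle z p b; rewrite (metric_sym z p).
    by move: zp pb ob; rewrite /ep; slra.
  split => //.
  - by have := metric_triangle a z b; rewrite az; move: zb; slra.
  - by have := metric_triangle o a b; rewrite oa; move: ob'; rewrite /ep; slra.
  - have := metric_triangle w z b; move: wz zb tr om2 de3 sg2 r0 om0; rewrite /ep; slra.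
have [zq aq aq2 wq] := near q hq; have [zq' aq' aq2' wq'] := near q' hq'.
have tau01 : 0 <= tau <= 1 by rewrite ltW.
have [m [am mq hm]] := hb a q wa wq tau tau01.
have qy := hq.2.
have aqt : tau * mdist a q <= h + 2 * de + sg.
  have h1 := ler_wpM2l (ltW tau0) aq.
  have h2 : tau * (2 * de + sg) <= 2 * de + sg.
    by rewrite ler_piMl//; move: de0 sg0; slra.
  by move: h1 h2 tauE; slra.
have aqt2 : (1 - tau) * mdist a q <= ep + 2 * de + sg.
  have t1' : 0 <= 1 - tau by rewrite subr_ge0.
  have h1 := ler_wpM2l t1' aq.
  have h2 : 0 <= tau * (2 * de + sg).
    by apply: mulr_ge0; [exact: ltW|move: de0 sg0; slra].
  by move: h1 h2 tauE; slra.
have mz : mdist m z < om / 3.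
  apply: hd2; split.
    have := metric_triangle o a m; rewrite oa am; move: aqt de2 sg1 de0; slra.
  have := metric_triangle m q y; rewrite mq; move: aqt2 qy de2 sg1; rewrite /ep; slra.
have q'm : mdist q' m <= ep + om.
  have := metric_triangle q' z m; rewrite (metric_sym q' z) (metric_sym z m).
  by move: zq' mz de3 sg2 de0 om0; slra.
have := hm q' wq'; set D := mdist a q in aq aq2 aqt aqt2 *.
set D' := mdist a q' in aq' aq2' *; rewrite (metric_sym q' q).
set x := mdist q q'; set v := mdist q' m in q'm *.
have low : ep - om <= D' - tau * D.
  by move: aq2' aqt de3 sg2 om0 de0; slra.
have epom : 0 <= ep - om by rewrite subr_ge0.
have low2 : (ep - om) ^+ 2 <= (D' - tau * D) ^+ 2.
  by apply: lerXn2r => //; rewrite nnegrE; exact: le_trans low.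
have v2 : v ^+ 2 <= (ep + om) ^+ 2.
  by apply: lerXn2r => //; rewrite nnegrE ?mdist_ge0// addr_ge0// ltW.
have DD : (D' - D) ^+ 2 <= om ^+ 2.
  rewrite -real_normK ?num_real//; apply: lerXn2r; rewrite ?nnegrE ?(ltW om0)//.
  by rewrite ler_norml; apply/andP; split; move: aq aq2 aq' aq2' de3 sg2 de0 sg0; slra.
move=> H.
have H2 : 1 / 2 * tau * (x ^+ 2 - (D' - D) ^+ 2) <= 4 * (ep * om).
  by move: H low2 v2; slra.
have H3 : x ^+ 2 - (D' - D) ^+ 2 <= 8 / tau * (ep * om).
  rewrite mulrAC ler_pdivlMr//; move: H2; slra.
have H4 : om * om <= ep * om by rewrite ler_wpM2r// ltW.
have x2 : x ^+ 2 < e ^+ 2.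
  apply: le_lt_trans om3; rewrite /c; move: H3 H4 DD; slra.
by move: x2; rewrite ltr_pXn2r// nnegrE ?mdist_ge0// ltW.
Qed.

Hypothesis hinges_all : forall p, exists2 r, 0 < r & hinge_ball p r (1 / 2).

(** Let T be the supremum of the levels up to which y is thin. The thin points z u
    with u < T form a curve of unit speed, which has a limit w as u tends to T.
    A hinge ball around w contains the points at the levels T - h and T - 2 h for
    small h, and its radius allows [thin_step] to start at T - h and to go beyond
    T, unless T is already the distance from o to y. *)
Lemma thin_everywhere r1 : 0 < r1 -> 0 < d0 -> (forall t, 0 < t < r1 -> thin o y t) ->
  forall t, 0 <= t <= d0 -> thin o y t.
Proof.
move=> r10 d00 th1.
pose S := [set t : R | 0 <= t <= d0 /\ forall u, 0 <= u <= t -> thin o y u].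
have S0 : S (Num.min (r1 / 2) d0).
  split.
    rewrite ge_min lexx orbT andbT le_min (ltW d00) andbT.
    by rewrite ltW// divr_gt0.
  move=> u /andP[u0]; rewrite le_min => /andP[u1 _].
  have [->|un0] := eqVneq u 0; first exact: thin_zero.
  by apply: th1; rewrite lt_neqAle eq_sym un0 u0 /=; move: u1 r10; slra.
have hS : has_sup S.
  by split; [exists (Num.min (r1 / 2) d0)|exists d0 => t [/andP[]]].
pose T := sup S.
have T0 : 0 < T.
  apply: (@lt_le_trans _ _ (Num.min (r1 / 2) d0)); first by rewrite lt_min d00 divr_gt0.
  by apply: ub_le_sup => //; case: hS.
have Td : T <= d0 by apply: ge_sup; [case: hS|move=> t [/andP[]]].
have thT u : 0 <= u < T -> thin o y u.
  move=> /andP[u0 uT]; have [t [_ tS] ut] := sup_adherent (eps := T - u) ltac:(by rewrite subr_gt0) hS.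
  apply: tS; rewrite u0 /=; apply: ltW; move: ut; rewrite -/T; slra.
have zex u : exists z, 0 <= u < T -> thin_point u z.
  have [uT|] := pselect (0 <= u < T); last by exists o.
  have [|z hz] := thin_limit _ (thT u uT); last by exists z.
  by case/andP: uT => -> uT /=; move: uT Td; slra.
pose z u := sval (cid (zex u)); have hz u : 0 <= u < T -> thin_point u (z u).
  exact: (svalP (cid (zex u))).
have zd u v : 0 <= u -> u <= v -> v < T -> mdist (z u) (z v) = v - u.
  move=> u0 uv vT; apply: thin_point_dist => //; apply: hz.
    by rewrite u0 (le_lt_trans uv).
  by rewrite vT (le_trans u0).
pose un n : R := T - T * harmonic n.
have un0 n : 0 <= un n.
  by rewrite subr_ge0 ler_piMr ?(ltW T0)// /harmonic invf_le1// ler1n.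
have unT n : un n < T by rewrite ltrBlDl ltrDr mulr_gt0// harmonic_gt0.
have [|w hw] := cauchy_limit (u := z \o un).
  move=> e e0; have [N hN] := harmonic_small (divr_gt0 e0 T0); exists N => n Nn /=.
  have NN := hN N (leqnn N); rewrite ltr_pdivlMr// in NN.
  have uNn : un N <= un n.
    by rewrite lerB// ler_pM2l// /harmonic lef_pV2 ?posrE// ler_nat.
  rewrite zd// /un; have : 0 < T * harmonic n by rewrite mulr_gt0// harmonic_gt0.
  move: NN; slra.
have wz u : 0 <= u < T -> mdist w (z u) <= T - u.
  move=> /andP[u0 uT]; apply/ler_addgt0Pr => e e0.
  have [N1 h1] := hw e e0.
  have Tu : 0 < (T - u) / T by rewrite divr_gt0// subr_gt0.
  have [N2 h2] := harmonic_small Tu.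
  set n := maxn N1 N2; have := h1 n (leq_maxl _ _); have := h2 n (leq_maxr _ _).
  rewrite ltr_pdivlMr// => k2 /= k1.
  have uun : u <= un n by rewrite /un; move: k2; slra.
  have := metric_triangle w (z (un n)) (z u).
  rewrite (metric_sym (z (un n))) zd//.
  by have := unT n; move: k1; slra.
have [r r0 hb] := hinges_all w.
pose h := Num.min (r / 16) (T / 4).
have h0 : 0 < h by rewrite lt_min !divr_gt0.
have h1 : h <= r / 16 by rewrite ge_min lexx.
have h2 : h <= T / 4 by rewrite ge_min lexx orbT.
pose t0 := T - h.
have t0T : 0 <= t0 < T by rewrite /t0; apply/andP; split; move: h0 h2 T0; slra.
have t0h : 0 <= t0 - h < T by rewrite /t0; apply/andP; split; move: h0 h2 T0; slra.
pose T' := Num.min d0 (T + r / 16).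
have ST' : S T'.
  split.
    rewrite le_min ge_min lexx /= (ltW d00) andbT /=.
    by move: T0 r0; slra.
  move=> u /andP[u0 uT'].
  have [ut0|ut0] := leP u t0.
    by apply: thT; rewrite u0; case/andP: t0T => _; exact: le_lt_trans.
  have := uT'; rewrite le_min => /andP[ud uT].
  apply: (thin_step (t0 := t0) (h := h) (z := z t0) (a := z (t0 - h)) hb) => //.
  - by move: h2 T0; rewrite /t0; slra.
  - exact: hz.
  - by case: (hz _ t0h).
  - rewrite zd//; first by ring.
    + by case/andP: t0h.
    + by move: h0; slra.
    + by case/andP: t0T.
  - by rewrite ut0.
  - by apply: le_lt_trans (wz _ t0h) _; move: h1 r0; rewrite /t0; slra.
  - by apply: le_lt_trans (wz _ t0T) _; move: h1 r0; rewrite /t0; slra.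
  - by move: uT h1 r0; rewrite /t0; slra.
have T'T : T' <= T by apply: ub_le_sup => //; case: hS.
have dT : T' = d0.
  rewrite /T'; apply/min_idPl; move: T'T; rewrite /T' ge_min => /orP[|]; last first.
    by move: r0; slra.
  by move: r0; slra.
by case: ST' => _; rewrite dT.
Qed.

End ThinPoints.

(** * From points to curves *)

Section ConstantSpeed.
Context {R : realType} {M : metricType R}.
Implicit Types (g : R -> M) (x y o : M).

(** Stated for partitions of [a, 1], for the induction on the partition. *)
Lemma polygon_length_constant_speed (L : R) g (s : seq R) (a : R) :
  (forall u v, 0 <= u -> u <= v -> v <= 1 -> mdist (g u) (g v) = L * (v - u)) ->
  0 <= a -> itv_partition a 1 s ->
  \sum_(0 <= i < size s) mdist ((g \o nth 1 (a :: s)) i) ((g \o nth 1 (a :: s)) i.+1)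
    = L * (1 - a).
Proof.
move=> hg; elim: s a => [|b s IH] a a0 sa.
  by rewrite big_nil (itv_partition_nil sa) subrr mulr0.
have [/= /andP[ab _] _] := sa; have sb := itv_partition_cons sa.
have b0 : 0 <= b by apply: le_trans a0 (ltW ab).
have b1 := itv_partition_le sb.
rewrite big_nat_recl//= hg ?(ltW ab)//.
have /= -> := IH b b0 sb; ring.
Qed.

Lemma curve_length_constant_speed (L : R) g :
  (forall u v, 0 <= u -> u <= v -> v <= 1 -> mdist (g u) (g v) = L * (v - u)) ->
  curve_length g = L%:E.
Proof.
move=> hg; rewrite /curve_length.
have -> : [set (polygon_length g s)%:E | s in itv_partition 0 1] = [set L%:E].
  apply/seteqP; split => [_ [s hs <-]|_ ->] /=.
    by rewrite /polygon_length (polygon_length_constant_speed hg)// subr0 mulr1.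
  exists [:: 1]; first exact: itv_partition1.
  rewrite /polygon_length (polygon_length_constant_speed hg) ?subr0 ?mulr1//.
  exact: itv_partition1.
by rewrite ereal_sup1.
Qed.

Lemma continuous_lipschitz (L : R) g : 0 < L ->
  (forall u v, mdist (g u) (g v) <= L * `|u - v|) -> continuous g.
Proof.
move=> L0 hg x; apply/metricType_numDomainType.cvgrPdist_lt => e e0.
near=> y; apply: le_lt_trans (hg _ _) _.
rewrite mulrC -ltr_pdivlMr//; near: y.
have /cvgrPdist_lt := @cvg_id _ (nbhs x); apply; exact: divr_gt0.
Unshelve. all: by end_near. Qed.

Lemma same_up_to_reparam_const x g h : (forall u, 0 <= u <= 1 -> g u = x) ->
  (forall u, 0 <= u <= 1 -> h u = x) -> same_up_to_reparam g h.
Proof.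
move=> hg hh; exists (cst x); split.
- by apply: continuous_subspaceT => u; exact: cvg_cst.
- by exists id; split=> //; apply: continuous_subspaceT => u; exact: cvg_id.
- by exists id; split=> //; apply: continuous_subspaceT => u; exact: cvg_id.
Qed.

(** The unit speed curve zeta passes through all points between o and x. A shortest
    curve h from x to o consists of such points, and the distance from o decreases
    along h; hence h is the constant speed curve composed with
    u |-> 1 - |o h(u)| / |ox|. *)
Lemma unique_shortest_curve_of_points o x (zeta : R -> M) :
  (forall u v, 0 <= u -> u <= v -> v <= mdist o x -> mdist (zeta u) (zeta v) = v - u) ->
  (forall b, mdist o b + mdist b x = mdist o x -> b = zeta (mdist o b)) ->
  unique_shortest_curve x o.
Proof.
set L := mdist o x => hz hu; have L0 : 0 <= L := mdist_ge0 _ _.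
have zx : zeta L = x by rewrite /L -hu// mdistxx addr0.
have zo : zeta 0 = o.
  by rewrite -[X in zeta X](mdistxx o) -hu// mdistxx add0r.
have on_curve g u : shortest_curve x o g -> 0 <= u <= 1 -> g u = zeta (mdist o (g u)).
  move=> gs u01; apply: hu; have := shortest_curve_add gs u01.
  by rewrite (metric_sym x (g u)) (metric_sym (g u) o) (metric_sym x o) addrC.
have [L00|LN0] := eqVneq L 0.
  have xo : o = x by exact: mdist_positivity.
  have ax (g : R -> M) u : shortest_curve x o g -> 0 <= u <= 1 -> g u = o.
    move=> gs u01; rewrite (on_curve g u gs u01).
    have := shortest_curve_add gs u01; rewrite (metric_sym x o) -/L L00 (metric_sym (g u) o).
    have := mdist_ge0 x (g u); have := mdist_ge0 o (g u) => h1 h2 h3.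
    by have -> : mdist o (g u) = 0 by lra.
  exists (cst o).
    split; first by split; rewrite ?xo//; apply: continuous_subspaceT => u; exact: cvg_cst.
    rewrite (metric_sym x o) -/L L00; apply: curve_length_constant_speed => u v _ _ _.
    by rewrite /= mdistxx mul0r.
  by move=> h hs; apply: (@same_up_to_reparam_const o) => // u u01; exact: ax.
have Lp : 0 < L by rewrite lt_neqAle eq_sym LN0.
(* a parametrization that is constant outside [0, 1] is continuous on all of R *)
pose clamp (u : R) : R := Num.min 1 (Num.max 0 u).
have clamp01 u : 0 <= clamp u <= 1.
  by rewrite /clamp ge_min lexx le_min ler01 le_max lexx.
have clampE u : 0 <= u <= 1 -> clamp u = u.
  by move=> /andP[u0 u1]; rewrite /clamp (max_idPr u0) (min_idPr u1).
have clamp_le u v : u <= v -> clamp u <= clamp v <= clamp u + (v - u).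
  move=> uv; rewrite /clamp.
  have [?|?] := leP 0 u; have [?|?] := leP 0 v; have [?|?] := leP 1 u;
    have [?|?] := leP 1 v; rewrite ?(min_r (@ler01 R)); apply/andP; split; lra.
pose g (u : R) := zeta (L * (1 - clamp u)).
have gd u v : u <= v -> mdist (g u) (g v) = L * (clamp v - clamp u).
  move=> uv; have /andP[c1 _] := clamp_le _ _ uv.
  have /andP[u0 u1] := clamp01 u; have /andP[v0 v1] := clamp01 v.
  rewrite metric_sym hz.
  - by ring.
  - by rewrite mulr_ge0// subr_ge0.
  - by rewrite ler_pM2l// lerD2l lerN2.
  - by rewrite ler_piMr//; lra.
have gc : continuous g.
  apply: (@continuous_lipschitz L) => // u v.
  wlog uv : u v / u <= v.
    by move=> H; case/orP: (le_total u v) => uv; [exact: H|rewrite metric_sym distrC; exact: H].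
  rewrite gd// ler_pM2l// distrC ger0_norm ?subr_ge0//.
  by have /andP[_] := clamp_le _ _ uv; lra.
have g0 : g 0 = x by rewrite /g clampE ?lexx ?ler01// subr0 mulr1.
have g1 : g 1 = o by rewrite /g clampE ?lexx ?ler01// subrr mulr0.
exists g.
  split; first by split => //; exact: continuous_subspaceT.
  rewrite (metric_sym x o) -/L; apply: curve_length_constant_speed => u v u0 uv v1.
  by rewrite gd// !clampE// ?u0 ?v1 ?(le_trans u0 uv) ?(le_trans uv v1).
move=> h hs; have [[hc h0 h1] _] := hs; exists g; split.
- exact: continuous_subspaceT.
- exists id; split => //; first by apply: continuous_subspaceT => u; exact: cvg_id.
pose phi u := 1 - mdist o (h u) / L.
exists phi; split.
- move=> u; apply: cvgB; first exact: cvg_cst.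
  apply: cvgM; last exact: cvg_cst.
  exact: (continuous_comp (hc u) (@continuous_mdist _ _ o _)).
- move=> u v; rewrite !in_itv/= => /andP[u0 u1] /andP[v0 v1] uv.
  rewrite /phi lerD2l lerN2 ler_pM2r ?invr_gt0//.
  have := shortest_curve_between hs u0 uv v1.
  have := shortest_curve_add hs (introT andP (conj u0 u1)).
  have := mdist_ge0 (h u) (h v).
  rewrite (metric_sym (h u) o) (metric_sym (h v) o); lra.
- by rewrite /phi h0 h1 mdistxx mul0r subr0 -/L mulfV// subrr.
- move=> u; rewrite in_itv/= => u01; rewrite /g clampE.
    have -> : L * (1 - phi u) = mdist o (h u) by rewrite /phi opprB addrC subrK mulrC mulfVK.
    exact: on_curve.
  have := shortest_curve_add hs u01; rewrite (metric_sym x o) (metric_sym _ o) -/L => hL.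
  have := mdist_ge0 x (h u) => p1; have p2 := mdist_ge0 o (h u).
  rewrite /phi; apply/andP; split.
    by rewrite subr_ge0 ler_pdivrMr// mul1r; lra.
  by rewrite lerBlDr lerDl divr_ge0.
Qed.

End ConstantSpeed.

Section Main.
Context {R : realType} {M : completeMetricType R}.

Lemma unique_shortest_curve_of_thin (o x : M) : length_space M ->
  (forall t, 0 <= t <= mdist o x -> thin o x t) -> unique_shortest_curve x o.
Proof.
move=> lM th.
have zex t : exists z, 0 <= t <= mdist o x -> thin_point o x t z.
  have [t01|] := pselect (0 <= t <= mdist o x); last by exists o.
  by have [z hz] := thin_limit lM t01 (th t t01); exists z.
pose z t := sval (cid (zex t)).
have hz t : 0 <= t <= mdist o x -> thin_point o x t (z t).
  exact: (svalP (cid (zex t))).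
apply: (@unique_shortest_curve_of_points _ _ o x z) => [u v u0 uv vx|b ob].
  apply: (@thin_point_dist _ _ lM o x) => //; apply: hz.
    by rewrite u0 (le_trans uv).
  by rewrite vx (le_trans u0).
apply: (@thin_point_unique _ _ o x (mdist o b)) => //.
  apply: hz; rewrite mdist_ge0 -ob lerDl; exact: mdist_ge0.
by rewrite -ob addrAC subrr add0r.
Qed.

End Main.

Theorem theorem7p6 (R : realType) (M : completeMetricType R)
  (hM : alexandrov_space M)
  (d : measure_display) (Omega : measurableType d) (P : probability Omega R)
  (X : {RV P >-> borel M})
  (hX : finite_second_moments (distribution P X))
  (mu : M) (hmu : frechet_mean (distribution P X) mu) :
  {ae distribution P X, forall x : M, unique_shortest_curve x mu}.
Proof.
case: hM => lM hdim [kappa curv].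
have hinge (p : M) (eta : R) : 0 < eta <= 1 ->
    exists2 r, 0 < r & hinge_ball p r eta.
  by move=> eta01; exact: curvature_ge_hinge eta01 curv.
have [r r0 ae] := ae_thin hX lM hmu (hinge mu) hdim.
apply: negligibleS ae => x; apply: contra_not => thx.
apply: unique_shortest_curve_of_thin => //.
have [x0|xN0] := eqVneq (mdist mu x) 0.
  move=> t; rewrite x0 => /andP[t0 t1].
  have -> : t = 0 by apply/eqP; rewrite eq_le t1.
  exact: thin_zero.
have xp : 0 < mdist mu x by rewrite lt_neqAle eq_sym xN0 mdist_ge0.
apply: (thin_everywhere lM _ r0 xp (thx xp)) => p.
by apply: hinge; apply/andP; split; lra.
Qed.
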